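(* Let $\mu$ be the Borel probability measure on $\Omega$ defined in the context, and let $\mathbb{P}_\mu$ be the corresponding probability measure on $X_\Omega$. For every $x\in X_\Omega$, $$ \liminf_{n\to\infty}\frac{-\log_{m_d}(\mathbb{P}_\mu(B_n(x)))}{L_d\circ\cdots\circ L_1(n)}\le\omega_1\log_{m_d}(t_\varnothing). $$ Consequently $$ \dim_H(X_\Omega)=\omega_1\log_{m_d}(t_\varnothing)=\frac{q-1}{q}\log_{m_d}(t_\varnothing). $$
   Context: Setting. Let $d\ge2$, $q\ge2$ and $m_1\ge\cdots\ge m_d\ge2$ be integers, $\mathcal{A}_k=\{0,\dots,m_k-1\}$, $\mathbb{N}^*=\{1,2,\dots\}$, $\Sigma=(\mathcal{A}_1\times\cdots\times\mathcal{A}_d)^{\mathbb{N}^*}$, with elements $x=(x_i)_{i\ge1}$, $x_i=(x_i^1,\dots,x_i^d)$. Let $\Omega\subset\Sigma$ be nonempty and closed (product topology), $X_\Omega=\{x\in\Sigma:(x_{iq^\ell})_{\ell\ge0}\in\Omega\ \forall i\ge1,\ q\nmid i\}$. For a Borel probability measure $\mu$ on $\Omega$, $\mathbb{P}_\mu$ is the unique Borel probability measure on $\Sigma$ (supported on $X_\Omega$) with $\mathbb{P}_\mu([x_1\cdots x_n])=\prod_{i\le n,\ q\nmid i}\mu([x_ix_{qi}\cdots x_{q^ri}])$, where $q^ri\le n<q^{r+1}i$ and $[w]$ is the set of sequences beginning with $w$. Balls. For $2\le i\le d$ let $\gamma_i=\log(m_i)/\log(m_{i-1})$ and $L_i(n)=\lceil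 n/\gamma_i\rceil$; $L_1$ is the identity. Let $B_n(x)=\{u\in\Sigma:\forall 1\le k\le d,\ \forall 1\le i\le(L_k\circ\cdots\circ L_1)(n),\ u_i^k=x_i^k\}$; $\Sigma$ carries the metric for which these are the closed balls of radius $m_1^{-n}$ (distance $m_1^{-\sup\{n\ge0:u\in B_n(x)\}}$ between $x$ and $u$), and Hausdorff dimension refers to it. Parameters. For $1\le k\le d-1$ let $p_k$ be the non-negative integer with $q^{p_k}\le\frac{1}{\gamma_d\gamma_{d-1}\cdots\gamma_{k+1}}<q^{p_k+1}$, and $a_k=q^{p_k}\prod_{i=k+1}^d\gamma_i$. For $1\le s\le d-1$ let $\sigma_s$ be the permutation of $\{s,\dots,d-1\}$ for which $(a_{\sigma_s(t)})_{s\le t\le d-1}$ is non-decreasing, ties being ordered by increasing index. Weights. For $p\ge1$: $\delta_p^{d,d-1}=\frac{(q-1)^2}{q^{p+1}}$; and for $1\le s\le d-1$: $\delta_p^{s,s-1}=\frac{(q\,a_{\sigma_s(s)}-1)(q-1)}{q^{p+1}}$, $\delta_p^{s,t}=\frac{(a_{\sigma_s(t+1)}-a_{\sigma_s(t)})(q-1)}{q^p}$ for $s\le t\le d-2$, $\delta_p^{s,d-1}=\frac{(1-a_{\sigma_s(d-1)})(q-1)}{q^p}$. Coordinate functions $\chi_i$ and weights $\delta_i$. For $p\ge1$ let $s(p)=d$ if $p\le p_{d-1}$, $s(p)=s$ if $2\le s\le d-1$ and $p_s+1\le p\le p_{s-1}$, and $s(p)=1$ if $p\ge p_1+1$. List all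 pairs $(p,t)$ with $p\ge1$ and $s(p)-1\le t\le d-1$ by increasing $p$ and, for fixed $p$, by decreasing $t$ (from $d-1$ down to $s(p)-1$). If $(p,t)$ is the $i$-th pair and $s=s(p)$, let $\chi_i$ be the coordinate function $\chi_i(x)=x_p^d$ if $t=d-1$, and $\chi_i(x)=x^{k}_{p-p_k}$ with $k=\sigma_s(t+1)$ if $t\le d-2$. Let $N=p_1+1+\sum_{k=1}^{d-1}(p_1+1-p_k)$; the $N$-th pair is $(p_1+1,0)$. For $1\le i\le N-1$, with $(p,t)$ the $i$-th pair, let $\delta_i=\delta_p^{s(p),t}$; and let $\delta_N=\delta^{1,0}_{p_1+1}+\sum_{p=p_1+2}^\infty\sum_{t=0}^{d-1}\delta_p^{1,t}$. Exponents. $\omega_1=\sum_{i=1}^N\delta_i$, $\omega_k=\frac{\sum_{i=k}^N\delta_i}{\sum_{i=k-1}^N\delta_i}$ for $2\le k\le N$, $\omega_{N+1}=\frac{1}{q\delta_N}$, $\tilde\omega_{N-d+1}=\omega_1\omega_2\cdots\omega_{N-d+1}$. Prefixes. $\mathrm{Pref}_{\chi_1,\dots,\chi_n}(\Omega)=\{(\chi_1(x),\dots,\chi_n(x)):x\in\Omega\}$ and $[X_1\cdots X_n]=\{x\in\Omega:\chi_i(x)=X_i,\ 1\le i\le n\}$. All sums over primed letters below run over those letters for which the resulting word is in the corresponding set of prefixes of $\Omega$. The vector $t$. There is a unique family $t$ with values in $[1,m_d^{\omega_{N+1}d}]$, indexed by $\bigcup_{\ell\ge0}\mathrm{Pref}_{\chi_1,\dots,\chi_{N+\ell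 d}}(\Omega)$, such that for all $\ell\ge0$ and all $(X_1,\dots,X_{N+\ell d})\in\mathrm{Pref}_{\chi_1,\dots,\chi_{N+\ell d}}(\Omega)$, $$\left(t_{X_1\cdots X_{N+\ell d}}\right)^{\frac{1}{\tilde\omega_{N-d+1}\omega_{N+1}}}=\sum_{X'_{N+\ell d+1}}\bigg(\sum_{X'_{N+\ell d+2}}\bigg(\cdots\bigg(\sum_{X'_{N+(\ell+1)d}}t_{X_1\cdots X_{N+\ell d}X'_{N+\ell d+1}\cdots X'_{N+(\ell+1)d}}\bigg)^{\omega_N}\cdots\bigg)^{\omega_{N-d+3}}\bigg)^{\omega_{N-d+2}}.$$ Put $t_\varnothing=\sum_{X'_1}\big(\sum_{X'_2}\big(\cdots\big(\sum_{X'_{N-1}}\big(\sum_{X'_N}t_{X'_1\cdots X'_N}\big)^{\omega_N}\big)^{\omega_{N-1}}\cdots\big)^{\omega_3}\big)^{\omega_2}$. The measure $\mu$. It is the Borel probability measure on $\Omega$ such that for all $\ell\ge0$ and $(X_1,\dots,X_{N+\ell d})\in\mathrm{Pref}_{\chi_1,\dots,\chi_{N+\ell d}}(\Omega)$, $$\mu([X_1\cdots X_{N+\ell d}])=\frac{t_{X_1\cdots X_N}}{t_\varnothing}\prod_{p=2}^N A_p(X_1\cdots X_{p-1})^{\omega_p-1}\cdot\prod_{k=1}^\ell\left[t_{X_1\cdots X_{N+kd}}\ t_{X_1\cdots X_{N+(k-1)d}}^{-\frac{1}{\tilde\omega_{N-d+1}\omega_{N+1}}}\ \prod_{p=2}^d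 A^{(k)}_p(X_1\cdots X_{N+(k-1)d+p-1})^{\omega_{N-d+p}-1}\right],$$ where $A_p(X_1\cdots X_{p-1})=\sum_{X'_p}\big(\sum_{X'_{p+1}}\big(\cdots\big(\sum_{X'_N}t_{X_1\cdots X_{p-1}X'_p\cdots X'_N}\big)^{\omega_N}\cdots\big)^{\omega_{p+2}}\big)^{\omega_{p+1}}$ and $A^{(k)}_p(X_1\cdots X_{N+(k-1)d+p-1})=\sum_{X'_{N+(k-1)d+p}}\big(\cdots\big(\sum_{X'_{N+kd}}t_{X_1\cdots X_{N+(k-1)d+p-1}X'_{N+(k-1)d+p}\cdots X'_{N+kd}}\big)^{\omega_N}\cdots\big)^{\omega_{N-d+p+1}}$ (so $A_N=\sum_{X'_N}t_{X_1\cdots X_{N-1}X'_N}$ and $A^{(k)}_d=\sum_{X'_{N+kd}}t_{X_1\cdots X_{N+kd-1}X'_{N+kd}}$). *)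

(* Defs.v *)
From HB Require Import structures.
From mathcomp Require Import all_boot all_order all_algebra.
From mathcomp Require Import all_classical all_reals all_analysis.

Set Implicit Arguments.
Unset Strict Implicit.
Unset Printing Implicit Defensive.

Import Order.TTheory GRing.Theory Num.Theory.
Import numFieldTopology.Exports numFieldNormedType.Exports.

Local Open Scope classical_set_scope.
Local Open Scope ring_scope.

(* Hausdorff dimension of a set, relative to a distance function. *)
Section HausdorffDimension.
Context {R : realType} {T : Type} (dist : T -> T -> R).

Definition diam (U : set T) : \bar R :=
  ereal_sup [set (dist z.1 z.2)%:E | z in U `*` U].

(* diam(U)^s, where 0^0 = 1 but the empty set contributes 0 for all s >= 0 *)
Definition diam_pow (s : R) (U : set T) : \bar R :=
  if `[< U = set0 >] then 0%E else poweR (diam U) s.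

Definition hausdorff_premeasure (s delta : R) (E : set T) : \bar R :=
  ereal_inf [set (\sum_(0 <= i <oo) diam_pow s (U i))%E |
    U in [set U : nat -> set T | E `<=` \bigcup_i U i /\
                                 forall i, (diam (U i) <= delta%:E)%E]].

Definition hausdorff_measure (s : R) (E : set T) : \bar R :=
  ereal_sup [set hausdorff_premeasure s delta E | delta in [set x : R | 0 < x]].

Definition hausdorff_dim (E : set T) : \bar R :=
  ereal_inf [set s%:E | s in [set s : R | 0 <= s /\ hausdorff_measure s E = 0%E]].

End HausdorffDimension.

(* The indices k of the m_k run over 1, ..., d, so that the component k : 'I_d
   of a letter is its (k+1)-st one. 'I_(n.-1.+1) is 'I_n for n >= 1; written in
   this way it is nonempty, hence pointed, for all n. *)
Definition letter (d : nat) (m : nat -> nat) : Type :=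
  {dffun forall k : 'I_d, 'I_(m k.+1).-1.+1}.

HB.instance Definition _ d m := Finite.on (letter d m).
HB.instance Definition _ d m := isPointed.Build (letter d m)
  ([ffun k : 'I_d => ord0] : {dffun forall k : 'I_d, 'I_(m k.+1).-1.+1}).

(* Sigma, with the product topology. Positions are shifted by one: the entry
   x_i of the sequence x, for i >= 1, is x i.-1. *)
Definition Sigma (d : nat) (m : nat -> nat) : Type :=
  prod_topology (fun _ : nat => discrete_topology (letter d m)).

HB.instance Definition _ d m := Pointed.on (Sigma d m).
HB.instance Definition _ d m := Topological.on (Sigma d m).

(* Sigma with its Borel sigma-algebra *)
Notation SigmaB d m := (g_sigma_algebraType (@open (Sigma d m))).

Section Sequences.
Context {d : nat} (q : nat) {m : nat -> nat}.
Implicit Types (x u : Sigma d m) (Omega : set (Sigma d m)).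

(* x_i^k, for i >= 1 and 1 <= k <= d *)
Definition digit x (i k : nat) : nat :=
  oapp (fun k' : 'I_d => nat_of_ord (((x i.-1 : letter d m)
    : {dffun forall k : 'I_d, 'I_(m k.+1).-1.+1}) k')) 0%N (insub k.-1).

(* the sequence (x_{i q^l})_{l >= 0} *)
Definition subsequence x (i : nat) : Sigma d m :=
  fun l => x (i * q ^ l).-1.

Definition X_ Omega : set (Sigma d m) :=
  [set x | forall i, (1 <= i)%N -> ~~ (q %| i)%N -> Omega (subsequence x i)].

(* the sequences beginning with x_1 ... x_n *)
Definition cyl x (n : nat) : set (Sigma d m) :=
  [set u | forall i, (1 <= i <= n)%N -> u i.-1 = x i.-1].

(* Borel measures on a closed set Omega are regarded as Borel measures on Sigma
   that give mass 1 to Omega. The exponent r with q^r i <= n < q^(r+1) i is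
   trunc_log q (n %/ i). *)
Definition is_P_mu {R : realType} (mu P : probability (SigmaB d m) R) : Prop :=
  forall x n, P (cyl x n) =
    (\prod_(1 <= i < n.+1 | ~~ (q %| i)%N)
       mu (cyl (subsequence x i) (trunc_log q (n %/ i)).+1))%E.

End Sequences.

Section Construction.
Context (R : realType) (d q : nat) (m : nat -> nat).

Definition gamma (i : nat) : R := ln (m i)%:R / ln (m i.-1)%:R.

Definition L (i n : nat) : nat :=
  if (i <= 1)%N then n else `|Num.ceil (n%:R / gamma i)|%N.

(* Lcomp k n = (L_k o ... o L_1)(n) *)
Fixpoint Lcomp (k n : nat) : nat :=
  if k is k'.+1 then L k (Lcomp k' n) else n.

Definition cball (x : Sigma d m) (n : nat) : set (Sigma d m) :=
  [set u | forall k i, (1 <= k <= d)%N -> (1 <= i <= Lcomp k n)%N ->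
    digit u i k = digit x i k].

(* m_1^(- sup {n | u \in B_n(x)}), which is 0 when the supremum is infinite *)
Definition Sigma_dist (x u : Sigma d m) : R :=
  if ereal_sup [set (n%:R : R)%:E | n in [set n | cball x n u]] is r%:E
  then (m 1)%:R `^ (- r) else 0.

Definition p_ (k : nat) : nat :=
  get [set n : nat |
    (q%:R : R) ^+ n <= (\prod_(k.+1 <= i < d.+1) gamma i)^-1 < q%:R ^+ n.+1].

Definition a_ (k : nat) : R :=
  q%:R ^+ p_ k * \prod_(k.+1 <= i < d.+1) gamma i.

(* sigma_s(t), for s <= t <= d-1 *)
Definition sigma (s t : nat) : nat :=
  nth 0%N (sort (fun i j => (a_ i < a_ j) || (a_ i == a_ j) && (i <= j)%N)
                (iota s (d - s)))
      (t - s).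

(* weight p s t = delta_p^{s,t} *)
Definition weight (p s t : nat) : R :=
  if s == d then (q%:R - 1) ^+ 2 / q%:R ^+ p.+1
  else if t == s.-1 then
    (q%:R * a_ (sigma s s) - 1) * (q%:R - 1) / q%:R ^+ p.+1
  else if t == d.-1 then
    (1 - a_ (sigma s d.-1)) * (q%:R - 1) / q%:R ^+ p
  else (a_ (sigma s t.+1) - a_ (sigma s t)) * (q%:R - 1) / q%:R ^+ p.

(* s(p) *)
Definition s_ (p : nat) : nat :=
  if (p <= p_ d.-1)%N then d
  else if (p_ 1 < p)%N then 1
  else head 0%N [seq s <- iota 2 (d - 2) | (p_ s < p <= p_ s.-1)%N].

(* the pairs (p,t) with 1 <= p <= n, in the order of the enumeration *)
Definition pairs (n : nat) : seq (nat * nat) :=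
  flatten [seq [seq (p, t) | t <- rev (iota (s_ p).-1 (d - (s_ p).-1))]
          | p <- iota 1 n].

(* the i-th pair, for i >= 1: every p contributes at least one pair, so that
   it is already listed in pairs i *)
Definition pair_ (i : nat) : nat * nat := nth (0, 0)%N (pairs i) i.-1.

Definition chi (i : nat) (x : Sigma d m) : nat :=
  let: (p, t) := pair_ i in
  if t == d.-1 then digit x p d
  else let k := sigma (s_ p) t.+1 in digit x (p - p_ k) k.

Definition N_ : nat := p_ 1 + 1 + \sum_(1 <= k < d) (p_ 1 + 1 - p_ k).

Definition delta (i : nat) : R :=
  if i == N_ then
    weight (p_ 1).+1 1 0 +
    limn (series (fun j => \sum_(0 <= t < d) weight (p_ 1 + 2 + j) 1 t))
  else let: (p, t) := pair_ i in weight p (s_ p) t.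

Definition omega (k : nat) : R :=
  if k == 1%N then \sum_(1 <= i < N_.+1) delta i
  else if k == N_.+1 then (q%:R * delta N_)^-1
  else (\sum_(k <= i < N_.+1) delta i) / (\sum_(k.-1 <= i < N_.+1) delta i).

(* omega_1 ... omega_{N-d+1} *)
Definition omega_tilde : R := \prod_(1 <= k < (N_ - d).+2) omega k.

Section Prefixes.
Context (Omega : set (Sigma d m)).

Definition Pref (n : nat) : set (seq nat) :=
  [set [seq chi i x | i <- iota 1 n] | x in Omega].

Definition chi_cyl (w : seq nat) : set (Sigma d m) :=
  [set x | Omega x /\ forall i, (1 <= i <= size w)%N -> chi i x = nth 0%N w i.-1].

(* The nested sum over the j letters following w, in which the sum over the
   last k letters, 1 <= k < j, is raised to the power omega_{N-k+1}. All letters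
   of prefixes are less than m_1. *)
Fixpoint nested (t : seq nat -> R) (j : nat) (w : seq nat) : R :=
  if j is k.+1 then
    \sum_(0 <= X < m 1 | `[< Pref (size w).+1 (rcons w X) >])
      (if k == 0%N then nested t k (rcons w X)
       else nested t k (rcons w X) `^ omega (N_ - k + 1))
  else t w.

(* t matters only on the prefixes of length N + l d, l >= 0 *)
Definition is_t (t : seq nat -> R) : Prop :=
  forall l w, Pref (N_ + l * d) w ->
    1 <= t w <= (m d)%:R `^ (omega N_.+1 * d%:R) /\
    t w `^ (omega_tilde * omega N_.+1)^-1 = nested t d w.

Definition t_empty (t : seq nat -> R) : R := nested t N_ [::].

(* A_p(w), for w of length p - 1 *)
Definition A (t : seq nat -> R) (p : nat) (w : seq nat) : R :=
  nested t (N_ - p + 1) w.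

(* A^{(k)}_p(w), for w of length N + (k-1) d + p - 1 *)
Definition Ak (t : seq nat -> R) (p : nat) (w : seq nat) : R :=
  nested t (d - p + 1) w.

Definition mu_value (t : seq nat -> R) (l : nat) (w : seq nat) : R :=
  t (take N_ w) / t_empty t *
  \prod_(2 <= p < N_.+1) A t p (take p.-1 w) `^ (omega p - 1) *
  \prod_(1 <= k < l.+1)
    (t (take (N_ + k * d) w) *
     t (take (N_ + k.-1 * d) w) `^ (- (omega_tilde * omega N_.+1)^-1) *
     \prod_(2 <= p < d.+1)
       Ak t p (take (N_ + k.-1 * d + p - 1) w) `^ (omega (N_ - d + p) - 1)).

Definition is_mu (t : seq nat -> R) (mu : probability (SigmaB d m) R) : Prop :=
  mu Omega = 1%E /\
  forall l w, Pref (N_ + l * d) w -> mu (chi_cyl w) = (mu_value t l w)%:E.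

End Prefixes.

End Construction.

Definition logb {R : realType} (b x : R) : R := ln x / ln b.
Definition logbe {R : realType} (b : R) (x : \bar R) : \bar R :=
  (lne x * ((ln b)^-1)%:E)%E.

(* Main.v *)
(* List the coordinates (component k, position r) as chi_1, chi_2, ... On the chain
   (x_i, x_{qi}, x_{q^2 i}, ...) the ball B_n(x) fixes, up to an error bounded in n,
   the coordinates chi_j with i <= L theta_j, where L = L_d o ... o L_1 (n) and the
   numbers theta_j decrease to 0; moreover the weights are
   delta_j = (q - 1) / q * (theta_j - theta_{j+1}) and
   omega_{j+1} = theta_{j+1} / theta_j. The vector t extends to a function S on all
   words with S(w) = sum_X S(wX)^(theta_{j+2} / theta_{j+1}), |w| = j, and
   mu([w]) = prod_k S(w_1 ... w_k)^(theta_{k+1} / theta_k) / S(w_1 ... w_{k-1}).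

   Put f = ln S, and let g_k(u) be 1/u times the sum of f(chi_1, ..., chi_k) over the
   chains starting at i <= u. Summing over the chains gives
     - ln P_mu(B_n(x)) / L <= (q - 1) / q * ln t_empty
        + sum_k theta_{k+1} * (g_k(L theta_{k+1}) - g_k(L theta_k)) + o(1).
   Along L = rho^j with rho close to 1, the average over j of each difference is
   small, because g_k is bounded and varies slowly, so that the sum telescopes. Hence
   the upper bound on the lower limit, and on the dimension.

   For the lower bound on the dimension, P_mu(B_n(x)) is bounded by a product over the
   chains of masses of cylinders of bounded length. Its moments of small positive order
   factorize over the chains, and the entropies of the factors telescope to
   (q - 1) / q * L * ln t_empty up to a small error. By Markov's inequality the balls
   of radius m_1^-n that are too heavy have an exponentially small total mass, and the
   mass distribution principle applies to the others. *)

Require Import Defs.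
From HB Require Import structures.
From mathcomp Require Import all_boot all_order all_algebra.
From mathcomp Require Import all_classical all_reals all_analysis.
From mathcomp Require Import zify lra ring.

Import Order.TTheory GRing.Theory Num.Theory.
Import numFieldTopology.Exports numFieldNormedType.Exports.

Local Open Scope classical_set_scope.
Local Open Scope ring_scope.

(** Origin of the thresholds: digit [k] at position [r] of the chain of [i] stands at place
    [i * q^(r-1)] of the sequence, and B_n fixes it when this is at most L_k o ... o L_1 (n), about
    L * gamma_{k+1} ... gamma_d. So theta = gamma_{k+1} ... gamma_d / q^(r-1) = a_k / q^(p-1) with p
    = r + p_k. The integer p_k brings a_k above 1/q and to at most 1, so that different p do not
    interleave, and sigma_s sorts the coordinates with the same p. From p = p_1 + 1 on all
    components are present and the order repeats with period d, theta being divided by q.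

    The obstacle to the upper bound is that g_k(u) need not converge, so a scale chosen beforehand
    may fail. For the lower bound the means of f under mu replace g_k and cancel without averaging.
    Independence of the chains enters through sums over words of a fixed length. *)

Ltac nat_lia := repeat match goal with
  | H : is_true (Order.le _ _) |- _ => clear H
  | H : is_true (Order.lt _ _) |- _ => clear H
  end; lia.

(** * Cylinders and chains *)

Section Cylinders.
Context {d : nat} {m : nat -> nat}.
Local Notation seqs := (Sigma d m).
Local Notation alphabet := (letter d m).
Implicit Types (x y u v : seqs) (A : set seqs).

Definition upd x n (a : alphabet) : seqs := fun i => if i == n then a else x i.

Lemma cylP x n u : cyl x n u <-> forall i, (i < n)%N -> u i = x i.
Proof.
split=> [h i hi|h i hi]; first by have := h i.+1 ltac:(lia).
by apply: h; lia.
Qed.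

Lemma cyl0 x : cyl x 0 = setT.
Proof. by apply/seteqP; split=> // u _; apply/cylP. Qed.

Lemma cyl_updP x n a u : cyl (upd x n a) n.+1 u <-> cyl x n u /\ u n = a.
Proof.
rewrite !cylP; split=> [h|[h e] i hi].
  split=> [i hi|]; first by rewrite h /upd; [case: eqP => //; lia | lia].
  by rewrite h // /upd eqxx.
rewrite /upd; case: eqP => [-> //|ne]; apply: h; lia.
Qed.

Lemma nbhs_coord x i : nbhs x [set u : seqs | u i = x i].
Proof.
have := @proj_continuous nat (fun=> discrete_topology alphabet) i x.
by move=> /(_ [set x i]); apply; exact: discrete_set1.
Qed.

Lemma nbhs_cyl x n : nbhs x (cyl x n).
Proof.
elim: n => [|n IH]; first by rewrite cyl0; exact: filterT.
apply: filterS (filterI IH (nbhs_coord x n)) => u [/cylP h e].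
apply/cylP => i; rewrite ltnS leq_eqVlt => /orP[/eqP -> //|]; exact: h.
Qed.

Lemma open_of_prefix n A :
  (forall x y, (forall i, (i < n)%N -> y i = x i) -> A x -> A y) -> open A.
Proof.
move=> h; rewrite openE => x Ax; rewrite /interior; apply: filterS (nbhs_cyl x n).
by move=> u /cylP e; exact: h Ax.
Qed.

Lemma cvg_of_prefix x (y : nat -> seqs) : (forall n, cyl x n (y n)) -> y @ \oo --> x.
Proof.
move=> h; apply/cvg_sup => i B.
rewrite nbhsE => -[C [[D oD <-] Dx] CB].
exists i.+1 => // n /= hn; apply: CB => /=.
by have /cylP -> := h n.
Qed.

Lemma closed_cyl A x : closed A -> (forall n, exists2 y, A y & cyl x n y) -> A x.
Proof.
move=> cA h; pose y n := sval (cid2 (h n)).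
have yA n : A (y n) by rewrite /y; case: cid2.
have yx n : cyl x n (y n) by rewrite /y; case: cid2.
by apply: (closed_cvg A cA _ _ (cvg_of_prefix x y yx)); exact: nearW.
Qed.

Lemma measurable_of_open A : open A -> measurable (A : set (SigmaB d m)).
Proof. by move=> oA; exact: sub_sigma_algebra. Qed.

Lemma measurable_cyl x n : measurable (cyl x n : set (SigmaB d m)).
Proof.
apply: measurable_of_open; apply: (open_of_prefix n) => u v h /cylP h'.
by apply/cylP => i hi; rewrite h // h'.
Qed.

Lemma measurable_of_closed A : closed A -> measurable (A : set (SigmaB d m)).
Proof.
by move=> cA; rewrite -(setCK A); apply: measurableC; apply: measurable_of_open; exact: closed_openC.
Qed.

Section Measure.
Context {R : realType} (M : probability (SigmaB d m) R).

Definition mass (A : set seqs) : R := fine (M A).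

Lemma mass_fin A : measurable (A : set (SigmaB d m)) -> M A = (mass A)%:E.
Proof. by move=> mA; rewrite /mass fineK // fin_num_measure. Qed.

Lemma mass_ge0 A : 0 <= mass A.
Proof. by rewrite /mass fine_ge0. Qed.

Lemma mass_le A B : measurable (A : set (SigmaB d m)) -> measurable (B : set (SigmaB d m)) ->
  A `<=` B -> mass A <= mass B.
Proof.
move=> mA mB AB; rewrite -lee_fin -!mass_fin //.
by apply: le_measure; rewrite ?inE.
Qed.

Lemma mass_set0 : mass set0 = 0.
Proof. by rewrite /mass measure0. Qed.

Lemma massT : mass setT = 1.
Proof. by rewrite /mass probability_setT. Qed.

Lemma massU A B : measurable (A : set (SigmaB d m)) -> measurable (B : set (SigmaB d m)) ->
  A `&` B = set0 -> mass (A `|` B) = mass A + mass B.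
Proof.
move=> mA mB AB; apply: EFin_inj; rewrite EFinD -!mass_fin //; last exact: measurableU.
by rewrite measureU.
Qed.

Lemma mass_bigcup (I : eqType) (s : seq I) (F : I -> set seqs) : uniq s ->
  (forall i, i \in s -> measurable (F i : set (SigmaB d m))) ->
  (forall i j u, i \in s -> j \in s -> F i u -> F j u -> i = j) ->
  measurable (\bigcup_(i in [set` s]) F i : set (SigmaB d m)) /\
  mass (\bigcup_(i in [set` s]) F i) = \sum_(i <- s) mass (F i).
Proof.
elim: s => [|i s IH] /=; first by rewrite set_nil bigcup_set0 mass_set0 big_nil.
move=> /andP[is_ us] mF dF.
have [j h|j k u h h'|m1 e1] := IH us.
- by apply: mF; rewrite inE h orbT.
- by apply: dF; rewrite inE ?h ?h' orbT.
have -> : \bigcup_(j in [set` i :: s]) F j = F i `|` \bigcup_(j in [set` s]) F j.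
  apply/seteqP; split=> u.
    by case=> j /=; rewrite inE => /orP[/eqP ->|js] Fj; [left | right; exists j].
  by case=> [Fi|[j /= js Fj]]; [exists i | exists j]; rewrite //= inE ?eqxx ?js ?orbT.
have mi : measurable (F i : set (SigmaB d m)) by apply: mF; rewrite inE eqxx.
split; first exact: measurableU.
rewrite big_cons massU ?e1 //; apply/seteqP; split=> // u [Fi [j /= js Fj]].
by move: is_; rewrite (dF i j u) ?js // inE ?eqxx ?js ?orbT.
Qed.

Lemma mass_cylS A x n : measurable (A : set (SigmaB d m)) ->
  \sum_a mass (A `&` cyl (upd x n a) n.+1) = mass (A `&` cyl x n).
Proof.
move=> mA; have [||_ <-] := @mass_bigcup alphabet (index_enum _)
    (fun a => A `&` cyl (upd x n a) n.+1) (index_enum_uniq _).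
- by move=> a _; apply: measurableI => //; exact: measurable_cyl.
- by move=> a b u _ _ [_ /cyl_updP[_ <-]] [_ /cyl_updP[_ <-]].
congr mass; apply/seteqP; split=> [u [a _ [Au /cyl_updP[h _]]]|u [Au h]]; first by split.
by exists (u n); [rewrite /= mem_index_enum | split=> //; apply/cyl_updP].
Qed.

End Measure.

Section WordSum.
Context {R : realType}.
Implicit Types (F G : seqs -> R).

(* The sum of [F] over all words of length [n], extended by [point]. *)
Fixpoint word_sum n F : R :=
  if n is n'.+1 then word_sum n' (fun x => \sum_a F (upd x n' a)) else F point.

Lemma eq_word_sum n F G : F =1 G -> word_sum n F = word_sum n G.
Proof. by move=> /funext ->. Qed.

Lemma ler_word_sum n F G : (forall x, F x <= G x) -> word_sum n F <= word_sum n G.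
Proof.
elim: n F G => [|n IH] F G h /=; first exact: h.
by apply: IH => x; apply: ler_sum => a _; exact: h.
Qed.

Lemma word_sumZ n (c : R) F : word_sum n (fun x => c * F x) = c * word_sum n F.
Proof.
elim: n F => // n IH F /=; rewrite -IH; apply: eq_word_sum => x.
by rewrite mulr_sumr.
Qed.

Lemma mass_word_sum (M : probability (SigmaB d m) R) A n :
  measurable (A : set (SigmaB d m)) ->
  mass M A = word_sum n (fun x => mass M (A `&` cyl x n)).
Proof.
move=> mA; elim: n => [|n IH] /=; first by rewrite cyl0 setIT.
by rewrite IH; apply: eq_word_sum => x; rewrite mass_cylS.
Qed.

Lemma mass_prefix (M : probability (SigmaB d m) R) A n :
  (forall x y, (forall i, (i < n)%N -> y i = x i) -> A x -> A y) ->
  mass M A = word_sum n (fun x => if `[< A x >] then mass M (cyl x n) else 0).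
Proof.
move=> h; rewrite (mass_word_sum M A n); last first.
  by apply: measurable_of_open; exact: (open_of_prefix n).
apply: eq_word_sum => x; case: asboolP => Ax.
  by rewrite setIidr // => u /cylP hu; exact: h Ax.
rewrite (_ : A `&` _ = set0) ?mass_set0 //; apply/seteqP; split=> // u [Au /cylP hu].
by apply: Ax; apply: h Au => i hi; rewrite hu.
Qed.
End WordSum.

Section Chains.
Context (q : nat) (q_ge2 : (2 <= q)%N).

(** The number of members of the chain of [i] that are at most [n]. The value 0 for [i > n] lets a
    product run over the chains up to a bound [B >= n]. *)
Definition chain_depth n i : nat := if (i <= n)%N then (trunc_log q (n %/ i)).+1 else 0%N.

Definition chain_starts n : seq nat := [seq i <- index_iota 1 n.+1 | ~~ (q %| i)%N].

Lemma mem_chain_starts n i : (i \in chain_starts n) = [&& ~~ (q %| i)%N, (1 <= i)%N & (i <= n)%N].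
Proof. by rewrite mem_filter mem_index_iota ltnS. Qed.

Lemma chain_depthP n i l : (1 <= i)%N -> (l < chain_depth n i)%N = (i * q ^ l <= n)%N.
Proof.
move=> i1; rewrite /chain_depth; case: (leqP i n) => h.
  rewrite ltnS mulnC -leq_divRL //.
  have n0 : (0 < n %/ i)%N by rewrite divn_gt0.
  apply/idP/idP => [hl|]; last exact: trunc_log_max.
  by apply: leq_trans (trunc_logP q_ge2 n0); rewrite leq_exp2l.
have : (1 <= q ^ l)%N by rewrite expn_gt0; lia.
by nia.
Qed.

Lemma chain_decomp n : (1 <= n)%N -> exists i l, [/\ ~~ (q %| i)%N, (1 <= i)%N & n = (i * q ^ l)%N].
Proof.
elim/ltn_ind: n => n IH n1; have [/dvdnP[k e]|h] := boolP (q %| n)%N; last first.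
  by exists n, 0%N; rewrite expn0 muln1.
have [//||i [l [h1 h2 h3]]] := IH k; [nia | nia |].
by exists i, l.+1; split=> //; rewrite e h3 expnSr mulnA.
Qed.

Lemma chain_uniq i l i' l' : ~~ (q %| i)%N -> ~~ (q %| i')%N ->
  (i * q ^ l = i' * q ^ l')%N -> i = i' /\ l = l'.
Proof.
move=> h h'; wlog ll : i l i' l' h h' / (l <= l')%N.
  by move=> W e; have [/W|/ltnW /W] := leqP l l'; [exact | move=> /(_ i' i h' h (esym e)) []].
move=> e; have q0 : (0 < q ^ l)%N by rewrite expn_gt0; lia.
have e' : (i = i' * q ^ (l' - l))%N.
  by apply/eqP; rewrite -(eqn_pmul2r q0) e -mulnA -expnD subnK.
case: (l' - l)%N (subnK ll) e' => [|k] <- e'; first by rewrite e' expn0 muln1.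
by move: h; rewrite e' expnS mulnCA dvdn_mulr.
Qed.

(** The letter at place [n+1] belongs to exactly one chain, and is the next one there. Summing over
    it takes that factor back by one step and leaves the others alone; down at the empty word, each
    factor has its value at depth 0. *)
Lemma word_sum_prod {R : realType} (c : nat -> seqs -> nat -> R) B n :
  (forall i v r, \sum_a c i (upd v r a) r.+1 = c i v r) ->
  (forall i v w, c i v 0%N = c i w 0%N) -> (n <= B)%N ->
  word_sum n (fun x => \prod_(i <- chain_starts B) c i (subsequence q x i) (chain_depth n i))
  = \prod_(i <- chain_starts B) c i point 0%N.
Proof.
move=> cS c0; elim: n => [|n IH] nB /=.
  apply: eq_big_seq => i; rewrite mem_chain_starts => /and3P[_ i1 _].
  by rewrite /chain_depth leqNgt i1 /=; exact: c0.
rewrite -IH; last lia.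
apply: eq_word_sum => x.
have [i0 [l0 [h1 h2 e]]] := chain_decomp n.+1 isT.
have ql : (1 <= q ^ l0)%N by rewrite expn_gt0; lia.
have i0B : i0 \in chain_starts B by rewrite mem_chain_starts h1 h2 /=; nia.
have us : uniq (chain_starts B) by rewrite filter_uniq // iota_uniq.
have D0 : chain_depth n i0 = l0.
  apply/eqP; rewrite eqn_leq leqNgt chain_depthP // -e ltnn /=.
  case: l0 {ql i0B} e => // l e; rewrite chain_depthP //.
  have : (1 <= q ^ l)%N by rewrite expn_gt0; lia.
  by rewrite expnS in e; nia.
have D1 : chain_depth n.+1 i0 = l0.+1.
  apply/eqP; rewrite eqn_leq chain_depthP // -e leqnn andbT leqNgt chain_depthP // expnS; nia.
have key a i l : i \in chain_starts B ->
    subsequence q (upd x n a) i l = if (i == i0) && (l == l0) then a else subsequence q x i l.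
  rewrite mem_chain_starts => /and3P[g1 g2 g3]; rewrite /subsequence /upd.
  have gl : (1 <= q ^ l)%N by rewrite expn_gt0; lia.
  case: eqP => [e'|ne]; case: andP => //.
    by case; have [] := chain_uniq i l i0 l0 g1 h1 ltac:(nia) => -> ->.
  by move=> [/eqP ei /eqP el]; case: ne; rewrite ei el -e.
rewrite [RHS](bigD1_seq i0) //= D0 -cS mulr_suml; apply: eq_bigr => a _.
rewrite (bigD1_seq i0) //= D1; congr (c i0 _ _ * _).
  by apply/funext => l; rewrite key // eqxx /= /upd; case: eqP.
rewrite big_seq_cond [RHS]big_seq_cond; apply: eq_bigr => i /andP[iB ne].
have -> : subsequence q (upd x n a) i = subsequence q x i.
  by apply/funext => l; rewrite key // (negbTE ne).
congr c; move: iB; rewrite mem_chain_starts => /and3P[g1 g2 g3].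
have lt l : (l < chain_depth n i)%N = (l < chain_depth n.+1 i)%N.
  rewrite !chain_depthP // [RHS]leq_eqVlt ltnS; case: eqP => //= e'.
  by have [ei _] := chain_uniq i l i0 l0 g1 h1 ltac:(lia); move: ne; rewrite ei eqxx.
apply/eqP; rewrite eqn_leq; apply/andP; split; rewrite leqNgt; apply/negP.
  by rewrite -lt ltnn.
by rewrite lt ltnn.
Qed.
End Chains.
End Cylinders.

(** * Averages of slowly varying functions *)

Section Averages.
Context {R : realType}.
Implicit Types (s : nat -> R) (rho : R).

Lemma expr_unbounded rho (x : R) : 1 < rho -> exists n, forall j, (n <= j)%N -> x < rho ^+ j.
Proof.
move=> r1; have d0 : 0 < rho - 1 by rewrite subr_gt0.
have B n : n%:R * (rho - 1) <= rho ^+ n.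
  elim: n => [|n IH]; first by rewrite mul0r.
  have h : 1 <= rho ^+ n by rewrite exprn_ege1 // ltW.
  by rewrite exprS -natr1; nra.
exists (Num.bound (`|x| / (rho - 1))) => j hj.
have h : `|x| / (rho - 1) < (Num.bound (`|x| / (rho - 1)))%:R.
  by apply: archi_boundP; rewrite divr_ge0 // ltW.
apply: le_lt_trans (ler_norm x) _; apply: lt_le_trans (B j).
rewrite -ltr_pdivrMr //; apply: lt_le_trans h _; by rewrite ler_nat.
Qed.

(** Puts [x] on the grid of powers of [rho]: [rho^j * x] and [rho^(j-r)] differ at most by the
    factor [rho], so that passing from one threshold to another becomes a shift of [j]. *)
Lemma expr_bracket rho (x : R) : 1 < rho -> 0 < x <= 1 ->
  exists r, rho ^+ r * x <= 1 < rho ^+ r.+1 * x.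
Proof.
move=> r1 /andP[x0 x1].
have ex : exists n, 1 < rho ^+ n.+1 * x.
  have [n hn] := expr_unbounded rho x^-1 r1; exists n.
  by rewrite -ltr_pdivrMr // mul1r hn.
case: (ex_minnP ex) => n hn nmin; exists n; rewrite hn andbT.
case: n hn nmin => [|n] _ nmin; first by rewrite expr0 mul1r.
by rewrite leNgt; apply/negP => /nmin; rewrite ltnn.
Qed.

(** A bound on averages without limits: [C] depends neither on the position nor on the length of the
    window, so its share vanishes for long windows. In this form such bounds can be added and
    scaled. *)
Definition avg_le s (c : R) := exists j1 C, forall j0 J, (j1 <= j0)%N ->
  \sum_(j0 <= j < j0 + J) s j <= C + J%:R * c.

Lemma avg_leD s s' (c c' : R) : avg_le s c -> avg_le s' c' ->
  avg_le (fun j => s j + s' j) (c + c').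
Proof.
move=> [j1 [C h]] [j2 [C' h']]; exists (maxn j1 j2), (C + C') => j0 J hj.
rewrite big_split /= mulrDr addrACA; apply: lerD; [apply: h | apply: h']; lia.
Qed.

Lemma avg_le_scale s (c a : R) : 0 <= a -> avg_le s c -> avg_le (fun j => a * s j) (a * c).
Proof.
move=> a0 [j1 [C h]]; exists j1, (a * C) => j0 J hj.
by rewrite -mulr_sumr mulrCA -mulrDr ler_wpM2l // h.
Qed.

Lemma avg_le_sum (F : nat -> nat -> R) (c : nat -> R) m n :
  (forall k, (m <= k < n)%N -> avg_le (F k) (c k)) ->
  avg_le (fun j => \sum_(m <= k < n) F k j) (\sum_(m <= k < n) c k).
Proof.
elim: n => [|n IH] h.
  rewrite big_geq //; exists 0%N, 0 => j0 J _.
  by rewrite mulr0 addr0 big1 // => j _; rewrite big_geq.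
have [mn|nm] := leqP m n; last first.
  rewrite big_geq //; exists 0%N, 0 => j0 J _.
  by rewrite mulr0 addr0 big1 // => j _; rewrite big_geq.
rewrite big_nat_recr //=.
rewrite (_ : (fun j => _) = (fun j => \sum_(m <= k < n) F k j + F n j)); last first.
  by apply/funext => j; rewrite big_nat_recr.
by apply: avg_leD; [apply: IH => k hk|]; apply: h; lia.
Qed.

Lemma avg_le_often s (c c' : R) j0 : c < c' -> avg_le s c ->
  exists2 j, (j0 <= j)%N & s j <= c'.
Proof.
move=> cc [j1 [C h]]; pose j2 := maxn j0 j1.
pose J := (Num.bound (`|C| / (c' - c))).+1.
have d0 : 0 < c' - c by rewrite subr_gt0.
have hJ : C < J%:R * (c' - c).
  apply: le_lt_trans (ler_norm C) _; rewrite -ltr_pdivrMr //.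
  apply: (@lt_trans _ _ (Num.bound (`|C| / (c' - c)))%:R); last by rewrite ltr_nat.
  by apply: archi_boundP; rewrite divr_ge0 // ltW.
apply: contrapT => nex.
have : \sum_(j2 <= j < j2 + J) c' <= \sum_(j2 <= j < j2 + J) s j.
  rewrite big_nat [leRHS]big_nat; apply: ler_sum => j hj.
  rewrite leNgt; apply/negP => hs; apply: nex; exists j; last exact: ltW.
  by rewrite /j2 in hj; lia.
rewrite sumr_const_nat addKn -[_ *+ J]mulr_natl.
by have := h j2 J (leq_maxr _ _); nra.
Qed.

(** A shift by 1 telescopes to a difference of two values in [0, F]; a shift by [r] is made of [r]
    shifts by 1. *)
Lemma sum_shift_le (b : nat -> R) (F : R) r j0 J : (forall j, 0 <= b j <= F) ->
  \sum_(j0 <= j < j0 + J) (b j - b (j + r)%N) <= r%:R * F.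
Proof.
move=> hb; elim: r => [|r IH].
  by rewrite mul0r big1 // => j _; rewrite addn0 subrr.
rewrite (eq_bigr (fun j => (b j - b (j + r)%N) - (b (j.+1 + r)%N - b (j + r)%N))); last first.
  by move=> j _; rewrite addnS addSn; ring.
rewrite sumrB [X in _ - X](telescope_sumr (fun j => b (j + r)%N)) ?leq_addr // -natr1 mulrDl mul1r.
have := hb (j0 + J + r)%N; have := hb (j0 + r)%N; lra.
Qed.

Section SlowVariation.
Context (h : R -> R) (F : R).
Hypothesis h_bound : forall u : R, 0 <= u -> 0 <= h u <= F * u.
Hypothesis h_incr : forall u v : R, 0 <= u <= v -> 0 <= h v - h u <= F * (v - u + 1).

(** The numerator grows by at most [F * (v - u + 1)] and the denominator by a factor at most [rho].
    The 1 leaves room for the jumps of a step function; as [u >= 1/e], it costs at most [F * e]. *)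
Lemma slow_variation rho (e u v : R) : 0 <= F -> 1 < rho -> 0 < e -> e^-1 <= u ->
  u <= v <= rho * u -> `|h v / v - h u / u| <= F * (rho - 1 + e).
Proof.
move=> F0 r1 e0 ue /andP[uv vr].
have u0 : 0 < u by apply: lt_le_trans ue; rewrite invr_gt0.
have v0 : 0 < v by exact: lt_le_trans uv.
have /andP[hu0 huF] := h_bound u (ltW u0).
have /andP[d0 dF] := h_incr u v ltac:(by rewrite (ltW u0)).
have e1 : 1 <= e * v.
  rewrite -ler_pdivrMl // mulr1; exact: le_trans uv.
rewrite ler_norml; apply/andP; split.
  rewrite lerNl opprB lerBlDr ler_pdivrMr //.
  have -> : (F * (rho - 1 + e) + h v / v) * u = (F * (rho - 1 + e) * v * u + h v * u) / v.
    by field; rewrite gt_eqF.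
  rewrite ler_pdivlMr //.
  have A1 : h u * (v - u) <= F * u * (v - u) by rewrite ler_wpM2r // subr_ge0.
  have A2 : F * u * (v - u) <= F * u * ((rho - 1) * v).
    by rewrite ler_wpM2l ?mulr_ge0 ?(ltW u0) //; nra.
  have A3 : 0 <= (h v - h u) * u by rewrite mulr_ge0 // ltW.
  have A4 : 0 <= F * e * v * u by rewrite !mulr_ge0 // ltW.
  by nra.
rewrite lerBlDr ler_pdivrMr //.
have -> : (F * (rho - 1 + e) + h u / u) * v = (F * (rho - 1 + e) * v * u + h u * v) / u.
  by field; rewrite gt_eqF.
rewrite ler_pdivlMr //.
have : (h v - h u) * u <= F * (rho - 1 + e) * v * u.
  rewrite ler_pM2r //; apply: le_trans dF _; rewrite -mulrA ler_wpM2l //; nra.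
by nra.
Qed.

(** Both arguments are moved to powers of [rho], at a cost of [F * (rho - 1 + e)] each, whence the
    factor 2. What remains is the difference of one sequence and its shift by [r' - r], which
    telescopes. *)
Lemma avg_le_diff rho (e th th' : R) : 0 <= F -> 1 < rho -> 0 < e -> 0 < th' <= th -> th <= 1 ->
  avg_le (fun j => h (rho ^+ j * th') / (rho ^+ j * th') - h (rho ^+ j * th) / (rho ^+ j * th))
         (2 * F * (rho - 1 + e)).
Proof.
move=> F0 r1 e0 /andP[t'0 tt] t1.
have t0 : 0 < th by exact: lt_le_trans tt.
have [r /andP[r_1 r_2]] := expr_bracket rho th r1 ltac:(by rewrite t0).
have [r' /andP[r'1 r'2]] := expr_bracket rho th' r1 ltac:(by rewrite t'0 (le_trans tt)).
have rr : (r <= r')%N.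
  rewrite leqNgt; apply/negP => hr.
  have : rho ^+ r'.+1 * th' <= rho ^+ r * th.
    apply: ler_pM => //; rewrite ?exprn_ge0 ?(ltW t'0) //; try lra.
    by rewrite ler_weXn2l // ltW.
  lra.
have [n hn] := expr_unbounded rho (e * th')^-1 r1.
pose g u := h u / u.
have gb u : 0 < u -> 0 <= g u <= F.
  move=> u0; have /andP[h1 h2] := h_bound u (ltW u0).
  by rewrite /g divr_ge0 ?(ltW u0) //= ler_pdivrMr.
have rj j : 0 < rho ^+ j by rewrite exprn_gt0 //; lra.
exists (maxn n r'), ((r' - r)%:R * F) => j0 J hj0.
have r'j0 : (r' <= j0)%N by move: hj0; rewrite geq_max => /andP[].
have close (j s : nat) (x : R) : (maxn n r' <= j)%N -> (s <= r')%N -> th' <= x ->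
    rho ^+ s * x <= 1 < rho ^+ s.+1 * x ->
    `|g (rho ^+ (j - s)) - g (rho ^+ j * x)| <= F * (rho - 1 + e).
  rewrite geq_max => /andP[nj r'j] sr tx /andP[h1 h2]; apply: slow_variation => //.
    have := hn j nj; rewrite invfM => hh.
    apply: (@le_trans _ _ (rho ^+ j * th')); last by rewrite ler_pM2l.
    by rewrite -ler_pdivrMr // ltW.
  have ej : rho ^+ j = rho ^+ (j - s) * rho ^+ s by rewrite -exprD subnK // (leq_trans sr).
  rewrite ej; have := rj (j - s)%N; move: h1 h2; rewrite exprS.
  by move: (rho ^+ s) (rho ^+ (j - s)) => y z h1 h2 z0; apply/andP; split; nra.
have main (j : nat) : (maxn n r' <= j)%N ->
   g (rho ^+ j * th') - g (rho ^+ j * th) <=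
   2 * F * (rho - 1 + e) + (g (rho ^+ (j - r')) - g (rho ^+ (j - r' + (r' - r)))).
  move=> hj; have := close j r' th' hj (leqnn _) (lexx _) ltac:(by rewrite r'1 r'2).
  have := close j r th hj rr tt ltac:(by rewrite r_1 r_2).
  have -> : (j - r' + (r' - r) = j - r)%N.
    by rewrite addnBA // subnK //; move: hj; rewrite geq_max => /andP[].
  by rewrite !ler_norml; move=> /andP[]; lra.
apply: (@le_trans _ _ (\sum_(j0 <= j < j0 + J) (2 * F * (rho - 1 + e) +
   (g (rho ^+ (j - r')) - g (rho ^+ (j - r' + (r' - r))))))).
  by rewrite big_nat [leRHS]big_nat; apply: ler_sum => j /andP[hj _]; apply: main; exact: leq_trans hj.
rewrite big_split /= sumr_const_nat addKn -[_ *+ J]mulr_natl [leLHS]addrC lerD2r.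
have := sum_shift_le (fun j => g (rho ^+ j)) F (r' - r) (j0 - r') J (fun j => gb _ (rj j)).
rewrite -[X in _ -> \sum_(X <= _ < _) _ <= _](subnK r'j0).
rewrite big_addn.
have -> : (j0 + J - r' = j0 - r' + J)%N by rewrite addnBAC.
by move=> hs; rewrite (eq_bigr (fun j => g (rho ^+ j) - g (rho ^+ (j + (r' - r))))) // => j _; rewrite addnK.
Qed.
End SlowVariation.

Lemma nneseries_le (u : nat -> \bar R) (b : \bar R) : (forall i, (0 <= u i)%E) ->
  (forall M, (\sum_(0 <= i < M) u i <= b)%E) -> (\sum_(0 <= i <oo) u i <= b)%E.
Proof.
move=> u0 h; apply: lime_le; first exact: is_cvg_nneseries.
by apply: nearW => M; exact: h.
Qed.

Lemma ler_sum_subseq (T : eqType) (s1 s2 : seq T) (v : T -> R) : uniq s1 -> uniq s2 ->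
  {subset s1 <= s2} -> (forall x, 0 <= v x) -> \sum_(x <- s1) v x <= \sum_(x <- s2) v x.
Proof.
move=> u1 u2 s12 v0; have p : perm_eq s1 [seq x <- s2 | x \in s1].
  apply: uniq_perm => //; first exact: filter_uniq.
  by move=> x; rewrite mem_filter; case h : (x \in s1) => //=; rewrite s12.
rewrite (perm_big _ p) big_filter big_mkcond; apply: ler_sum => x _.
by case: ifP.
Qed.

(** Turns a family indexed by pairs (level, index in the level) into a sequence by way of [pickle];
    codes of no pair contribute 0. Any finite part of it lies in a square, which is summed level by
    level. *)
Lemma sum_pickle_le (v : nat * nat -> R) (c : nat -> R) (b : R) M :
  (forall p, 0 <= v p) -> (forall n J, \sum_(0 <= j < J) v (n, j) <= c n) ->
  (forall A, \sum_(0 <= n < A) c n <= b) ->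
  \sum_(0 <= i < M) oapp v 0 (pickle_inv i) <= b.
Proof.
move=> v0 vc cb; pose s := pmap (@pickle_inv (nat * nat)%type) (index_iota 0 M).
have -> : \sum_(0 <= i < M) oapp v 0 (pickle_inv i) = \sum_(p <- s) v p.
  rewrite /s; elim: (index_iota 0 M) => [|i l IH] /=; first by rewrite !big_nil.
  rewrite big_cons IH; case: (pickle_inv i) => [p|] /=; last by rewrite add0r.
  by rewrite big_cons.
have us : uniq s by apply: (pmap_uniq (@pickle_invK _)); exact: iota_uniq.
have [A hA] : exists A, forall p, p \in s -> (p.1 < A)%N && (p.2 < A)%N.
  elim: (s) => [|p l [A hA]]; first by exists 0%N.
  exists (maxn A (maxn p.1 p.2).+1) => x; rewrite inE => /orP[/eqP ->|/hA]; lia.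
apply: (@le_trans _ _ (\sum_(0 <= n < A) \sum_(0 <= j < A) v (n, j))); last first.
  by apply: le_trans (cb A); apply: ler_sum => n _; exact: vc.
rewrite -(big_allpairs (F := v)).
apply: ler_sum_subseq => //.
  by apply: allpairs_uniq; rewrite ?iota_uniq // => -[? ?] [? ?].
move=> [n j] /hA /= /andP[h1 h2]; apply/allpairsP; exists (n, j).
by rewrite !mem_index_iota.
Qed.

End Averages.

(** * The enumeration of the coordinate functions and its weights *)

Section Setting.
Context (R : realType) (d q : nat) (m : nat -> nat).
Hypothesis d_ge2 : (2 <= d)%N.
Hypothesis q_ge2 : (2 <= q)%N.
Hypothesis m_ge2 : forall k, (1 <= k <= d)%N -> (2 <= m k)%N.
Hypothesis m_noninc : forall k, (1 <= k < d)%N -> (m k.+1 <= m k)%N.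

Local Notation gamma := (gamma R m).
Local Notation p_ := (p_ R d q m).
Local Notation a_ := (a_ R d q m).
Local Notation sigma := (sigma R d q m).
Local Notation s_ := (s_ R d q m).
Local Notation pairs := (pairs R d q m).
Local Notation pair_ := (pair_ R d q m).
Local Notation N_ := (N_ R d q m).
Local Notation weight := (weight R d q m).
Local Notation delta := (delta R d q m).
Local Notation omega := (omega R d q m).
Local Notation qr := (q%:R : R).

Lemma q_gt1 : 1 < qr. Proof. by rewrite ltr1n. Qed.
Lemma q_gt0 : 0 < qr. Proof. by rewrite ltr0n ltnW. Qed.
Lemma qX_gt0 n : 0 < qr ^+ n. Proof. by rewrite exprn_gt0 // q_gt0. Qed.
Hint Resolve q_gt0 qX_gt0 : core.

Lemma ln_m_gt0 k : (1 <= k <= d)%N -> 0 < ln (m k)%:R :> R.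
Proof. by move=> /m_ge2 mk; rewrite ln_gt0 // ltr1n. Qed.

Lemma gamma_gt0 i : (2 <= i <= d)%N -> 0 < gamma i.
Proof. by move=> h; rewrite divr_gt0 // ln_m_gt0 //; lia. Qed.

Lemma gamma_le1 i : (2 <= i <= d)%N -> gamma i <= 1.
Proof.
move=> h; rewrite /Defs.gamma ler_pdivrMr ?ln_m_gt0 ?mul1r; [|lia..].
have := m_noninc i.-1 ltac:(lia); rewrite prednK; last lia.
have := m_ge2 i ltac:(lia); have := m_ge2 i.-1 ltac:(lia) => h1 h2 h3.
by rewrite ler_ln ?posrE ?ltr0n ?ler_nat //; lia.
Qed.

(** It telescopes to [ln m_d / ln m_k] (shown inside [gamma_prod1]), and is the asymptotic ratio of
    L_k o ... o L_1 (n) to L_d o ... o L_1 (n). *)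
Definition gamma_prod k : R := \prod_(k.+1 <= i < d.+1) gamma i.
Local Notation Gam := gamma_prod.

Lemma gamma_prodd : Gam d = 1. Proof. by rewrite /Gam big_geq. Qed.

Lemma gamma_prodS k : (k < d)%N -> Gam k = gamma k.+1 * Gam k.+1.
Proof. by move=> kd; rewrite /Gam big_ltn. Qed.

Lemma gamma_prod_gt0 k : (1 <= k)%N -> 0 < Gam k.
Proof.
move=> k1; rewrite /Gam big_nat; apply: prodr_gt0 => i /= h.
by apply: gamma_gt0; lia.
Qed.

Lemma gamma_prod_le k l : (1 <= k <= l)%N -> (l <= d)%N -> Gam k <= Gam l.
Proof.
move=> /andP[k1]; elim: l => [|l IH]; first by rewrite leqn0 => /eqP ->.
rewrite leq_eqVlt => /orP[/eqP -> //|kl] ld; apply: le_trans (IH kl _) _; first lia.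
rewrite gamma_prodS // ler_piMl //; first by apply/ltW/gamma_prod_gt0.
by apply: gamma_le1; lia.
Qed.

Lemma gamma_prod_le1 k : (1 <= k <= d)%N -> Gam k <= 1.
Proof. by move=> h; rewrite -gamma_prodd; apply: gamma_prod_le => //; lia. Qed.

(** [p_] is chosen by [get], so a witness has to be shown: the least [n] with [1 / Gam k < q^(n+1)].
    If it is 0, the lower bound is [Gam k <= 1]. *)
Lemma p_P k : (1 <= k <= d)%N -> qr ^+ p_ k <= (Gam k)^-1 < qr ^+ (p_ k).+1.
Proof.
move=> kd.
have G0 : 0 < Gam k by apply: gamma_prod_gt0; lia.
suff : [set n : nat | qr ^+ n <= (Gam k)^-1 < qr ^+ n.+1] !=set0 by case=> n /getI.
have ex : exists n, (Gam k)^-1 < qr ^+ n.+1.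
  have [n hn] : exists n : nat, (Gam k)^-1 < n%:R.
    by exists (Num.bound (Gam k)^-1); apply: archi_boundP; rewrite invr_ge0 ltW.
  exists n; apply: lt_le_trans hn _; rewrite -natrX ler_nat.
  by apply: leq_trans (ltnW (ltn_expl n q_ge2)) _; rewrite leq_exp2l.
case: (ex_minnP ex) => n hn nmin; exists n; apply/andP; split => //.
case: n hn nmin => [_ _|n _ nmin].
  by rewrite expr0 -[leLHS]invr1 lef_pV2 ?posrE // gamma_prod_le1.
by rewrite leNgt; apply/negP => /nmin; rewrite ltnn.
Qed.

Lemma p_d : p_ d = 0%N.
Proof.
have /andP[+ _] := p_P d ltac:(lia).
rewrite gamma_prodd invr1; case: (p_ d) => // n.
by rewrite leNgt exprn_egt1 // q_gt1.
Qed.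

Lemma p_noninc k l : (1 <= k <= l)%N -> (l <= d)%N -> (p_ l <= p_ k)%N.
Proof.
move=> kl ld; have k1 : (1 <= k)%N by case/andP: kl.
have /andP[h1 _] := p_P l ltac:(lia).
have /andP[_ h2] := p_P k ltac:(lia).
have : qr ^+ p_ l < qr ^+ (p_ k).+1.
  apply: le_lt_trans h1 (le_lt_trans _ h2).
  by rewrite lef_pV2 ?posrE ?gamma_prod_gt0 ?gamma_prod_le //; lia.
by rewrite ltr_eXn2l // q_gt1.
Qed.

Lemma a_E k : a_ k = qr ^+ p_ k * Gam k. Proof. by []. Qed.

Lemma a_d : a_ d = 1. Proof. by rewrite a_E p_d gamma_prodd expr0 mulr1. Qed.

Lemma a_gt0 k : (1 <= k)%N -> 0 < a_ k.
Proof. by move=> h; rewrite mulr_gt0 // gamma_prod_gt0. Qed.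

Lemma a_le1 k : (1 <= k <= d)%N -> a_ k <= 1.
Proof.
move=> h; have /andP[h1 _] := p_P k h.
by rewrite a_E -ler_pdivlMr ?gamma_prod_gt0 ?mul1r //; lia.
Qed.

Lemma qa_gt1 k : (1 <= k <= d)%N -> 1 < qr * a_ k.
Proof.
move=> h; have /andP[_ h1] := p_P k h.
by rewrite a_E mulrA -exprS -ltr_pdivrMr ?gamma_prod_gt0 ?mul1r //; lia.
Qed.

Definition a_before (i j : nat) := (a_ i < a_ j) || (a_ i == a_ j) && (i <= j)%N.
Definition sigma_seq s := sort a_before (iota s (d - s)).

Lemma a_before_total : total a_before.
Proof. by move=> i j; rewrite /a_before; case: ltgtP => //= _; exact: leq_total. Qed.

Lemma a_before_trans : transitive a_before.
Proof.
move=> j i k; rewrite /a_before => /orP[h|/andP[/eqP h h']] /orP[g|/andP[/eqP g g']].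
- by rewrite (lt_trans h g).
- by rewrite -g h.
- by rewrite h g.
- by rewrite h g eqxx (leq_trans h' g') orbT.
Qed.

Lemma size_sigma_seq s : size (sigma_seq s) = (d - s)%N.
Proof. by rewrite size_sort size_iota. Qed.

Lemma sigmaE s t : sigma s t = nth 0%N (sigma_seq s) (t - s). Proof. by []. Qed.

Lemma sigma_range s t : (s <= t < d)%N -> (s <= sigma s t < d)%N.
Proof.
move=> h; have : sigma s t \in sigma_seq s.
  by rewrite sigmaE mem_nth // size_sigma_seq; lia.
by rewrite mem_sort mem_iota; lia.
Qed.

Lemma sigma_surj s k : (s <= k < d)%N -> exists2 t, (s <= t < d)%N & sigma s t = k.
Proof.
move=> h; have ks : k \in sigma_seq s by rewrite mem_sort mem_iota; lia.
exists (s + index k (sigma_seq s))%N.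
  by move: (ks); rewrite -index_mem size_sigma_seq; lia.
by rewrite sigmaE addKn nth_index.
Qed.

Lemma a_sigma_le s t : (s <= t)%N -> (t.+1 < d)%N -> a_ (sigma s t) <= a_ (sigma s t.+1).
Proof.
move=> st td; rewrite !sigmaE subSn //.
have := sort_sorted a_before_total (iota s (d - s)).
move=> /(sorted_ltn_nth a_before_trans 0%N) /(_ (t - s)%N (t - s).+1).
rewrite !inE size_sort size_iota => /(_ ltac:(lia) ltac:(lia) ltac:(lia)).
by rewrite /a_before => /orP[/ltW|/andP[/eqP ->]].
Qed.

(** As [p_] is nonincreasing, the components with [p_k < p], which are those having a digit at a
    position [p - p_k >= 1], form a final segment; [s_ p] is its first index. *)
Lemma s_P p : (1 <= p)%N ->
  [/\ (1 <= s_ p <= d)%N, forall k, (s_ p <= k < d)%N -> (p_ k < p)%N &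
      forall k, (1 <= k < s_ p)%N -> (p <= p_ k)%N].
Proof.
move=> p1; rewrite /Defs.s_; case: (leqP p (p_ d.-1)) => pd.
  split=> [|k|k kd]; [lia | lia |].
  by apply: leq_trans pd _; apply: p_noninc; lia.
case: (leqP p (p_ 1)) => pp; last first.
  split=> [|k kd|k]; [lia | | lia].
  by apply: leq_ltn_trans pp; apply: p_noninc; lia.
set l := [seq _ <- _ | _].
(* The list is not empty: take the least [s] with [p_s < p]. Hence [head] returns a member of it
   rather than its default. *)
have [s hs /andP[h1 h2]] : exists2 s, (2 <= s < d)%N & (p_ s < p <= p_ s.-1)%N.
  have ex : exists s, (1 <= s < d)%N && (p_ s < p)%N by exists d.-1; lia.
  case: (ex_minnP ex) => s /andP[h1 h2] smin; exists s.
    case: s h1 h2 smin => [|[|s]] //; lia.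
  rewrite h2 /= leqNgt; apply/negP => h3.
  have : (s <= s.-1)%N.
    apply: smin; rewrite h3 andbT; case: s h1 h2 h3 => [|[|s]] //=; lia.
  by lia.
have sl : s \in l by rewrite mem_filter h1 h2 /= mem_iota; lia.
have : head 0%N l \in l by case: (l) sl => //= a l' _; rewrite inE eqxx.
rewrite mem_filter mem_iota => /andP[/andP[g1 g2] g3].
set s' := head 0%N l in g1 g2 g3 *; split=> [|k kd|k kd]; first lia.
  by apply: leq_ltn_trans g1; apply: p_noninc; lia.
by apply: leq_trans g2 _; apply: p_noninc; lia.
Qed.

(** The enumeration as the orbit of a successor map, so that monotonicity and weights are checked on
    one pair and its successor. A block starts at [d.-1] and ends at [(s_ p).-1]. *)
Definition next_pair (x : nat * nat) : nat * nat :=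
  if x.2 == (s_ x.1).-1 then (x.1.+1, d.-1) else (x.1, x.2.-1).

Definition wf_pair (x : nat * nat) := (1 <= x.1)%N && ((s_ x.1).-1 <= x.2 < d)%N.

Lemma wf_first p : (1 <= p)%N -> wf_pair (p, d.-1).
Proof. by move=> p1; rewrite /wf_pair /=; have [h _ _] := s_P p p1; lia. Qed.

Lemma wf_next x : wf_pair x -> wf_pair (next_pair x).
Proof.
case: x => p t /andP[/= p1 h]; rewrite /next_pair /=.
case: eqP => e; first by apply: wf_first.
by rewrite /wf_pair /=; lia.
Qed.

Lemma iter_next p r : (1 <= p)%N -> (r <= d - s_ p)%N ->
  iter r next_pair (p, d.-1) = (p, (d.-1 - r)%N).
Proof.
move=> p1; have [h _ _] := s_P p p1.
elim: r => [|r IH] rd; first by rewrite subn0.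
rewrite iterS IH ?(ltnW rd) // /next_pair /=; case: eqP => [|_]; first lia.
by rewrite -subnS.
Qed.

Lemma iter_next_block p : (1 <= p)%N ->
  iter (d - (s_ p).-1) next_pair (p, d.-1) = (p.+1, d.-1).
Proof.
move=> p1; have [h _ _] := s_P p p1.
have -> : (d - (s_ p).-1 = (d - s_ p).+1)%N by lia.
rewrite iterS iter_next // /next_pair /=; case: eqP => //; lia.
Qed.

Definition nb_pairs n := (\sum_(1 <= p < n.+1) (d - (s_ p).-1))%N.

Lemma nb_pairsS n : nb_pairs n.+1 = (nb_pairs n + (d - (s_ n.+1).-1))%N.
Proof. by rewrite /nb_pairs big_nat_recr. Qed.

Lemma iter_nb_pairs n : iter (nb_pairs n) next_pair (1%N, d.-1) = (n.+1, d.-1).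
Proof.
elim: n => [|n IH]; first by rewrite /nb_pairs big_geq.
by rewrite nb_pairsS addnC iterD IH iter_next_block.
Qed.

Lemma pairsE n : pairs n = traject next_pair (1%N, d.-1) (nb_pairs n).
Proof.
elim: n => [|n IH]; first by rewrite /nb_pairs big_geq.
have -> : pairs n.+1 = pairs n ++
    [seq (n.+1, t) | t <- rev (iota (s_ n.+1).-1 (d - (s_ n.+1).-1))].
  by rewrite /Defs.pairs -{1}[n.+1]addn1 iotaD map_cat flatten_cat /= cats0 add1n.
rewrite nb_pairsS trajectD IH iter_nb_pairs; congr (_ ++ _).
have [h _ _] := s_P n.+1 isT.
apply: (@eq_from_nth _ (0%N, 0%N)) => [|i]; rewrite size_map size_rev size_iota.
  by rewrite size_traject.
move=> hi; rewrite (nth_map 0%N) ?size_rev ?size_iota //.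
rewrite (set_nth_default (n.+1, d.-1)) ?size_traject // nth_traject // iter_next //; last lia.
by rewrite nth_rev ?size_iota // nth_iota; [congr pair; lia | lia].
Qed.

Lemma nb_pairs_ge n : (n <= nb_pairs n)%N.
Proof.
elim: n => // n IH; rewrite nb_pairsS -[X in (X <= _)%N]addn1.
apply: leq_add => //; have [h _ _] := s_P n.+1 isT; lia.
Qed.

Lemma pair_E i : (1 <= i)%N -> pair_ i = iter i.-1 next_pair (1%N, d.-1).
Proof.
move=> i1; have hi : (i.-1 < nb_pairs i)%N by have := nb_pairs_ge i; lia.
rewrite /Defs.pair_ pairsE (set_nth_default (1%N, d.-1)) ?size_traject //.
by rewrite nth_traject.
Qed.

Lemma pair_1 : pair_ 1 = (1%N, d.-1). Proof. by rewrite pair_E. Qed.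

Lemma pair_S i : (1 <= i)%N -> pair_ i.+1 = next_pair (pair_ i).
Proof. by case: i => // i _; rewrite !pair_E. Qed.

Lemma wf_pair_ i : (1 <= i)%N -> wf_pair (pair_ i).
Proof.
case: i => // i _; elim: i => [|i IH]; first by rewrite pair_1 wf_first.
by rewrite pair_S // wf_next.
Qed.

Lemma pair_surj x : wf_pair x -> exists2 i, (1 <= i)%N & pair_ i = x.
Proof.
case: x => p t /andP[/= p1 ht]; have [h _ _] := s_P p p1.
exists (nb_pairs p.-1 + (d.-1 - t)).+1 => //.
rewrite pair_E //= addnC iterD iter_nb_pairs prednK // iter_next //; last lia.
by congr pair; lia.
Qed.

(* The pair [x] stands for the coordinate function [digit _ (pos_of x) (comp_of x)],
   where [p_ d = 0] and [a_ d = 1] allow a uniform treatment of the component [d]. *)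
Definition comp_of (x : nat * nat) : nat :=
  if x.2 == d.-1 then d else sigma (s_ x.1) x.2.+1.
Definition pos_of (x : nat * nat) : nat := (x.1 - p_ (comp_of x))%N.
Definition theta_of (x : nat * nat) : R := a_ (comp_of x) / qr ^+ x.1.-1.
Definition theta i := theta_of (pair_ i).

Lemma chiE i (x : Sigma d m) :
  chi R q i x = digit x (pos_of (pair_ i)) (comp_of (pair_ i)).
Proof.
rewrite /chi /pos_of /comp_of; case: (pair_ i) => p t /=.
by case: ifP; rewrite ?p_d ?subn0.
Qed.

Lemma comp_range x : wf_pair x -> (1 <= comp_of x <= d)%N.
Proof.
case: x => p t /andP[/= p1 ht]; have [h _ _] := s_P p p1.
rewrite /comp_of /=; case: eqP => e; first lia.
have := sigma_range (s_ p) t.+1; lia.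
Qed.

Lemma p_comp_lt x : wf_pair x -> (p_ (comp_of x) < x.1)%N.
Proof.
case: x => p t /andP[/= p1 ht]; have [h h' _] := s_P p p1.
rewrite /comp_of /=; case: eqP => e; first by rewrite p_d.
apply: h'; have := sigma_range (s_ p) t.+1; lia.
Qed.

(** Digit [r] of component [k] occurs in the block [p = r + p_k]: as [r >= 1], one has [p_k < p], so
    [k] is among the components of that block. *)
Lemma key_surj k r : (1 <= k <= d)%N -> (1 <= r)%N ->
  exists i, [/\ (1 <= i)%N, comp_of (pair_ i) = k & pos_of (pair_ i) = r].
Proof.
move=> kd r1; pose p := (r + p_ k)%N.
have p1 : (1 <= p)%N by lia.
have [h h1 h2] := s_P p p1.
have [t wft ct] : exists2 t, wf_pair (p, t) & comp_of (p, t) = k.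
  have [->|kd'] := eqVneq k d.
    by exists d.-1; [exact: wf_first | rewrite /comp_of eqxx].
  have sk : (s_ p <= k < d)%N.
    apply/andP; split; last lia.
    by rewrite leqNgt; apply/negP => ks; have := h2 k; lia.
  have [u hu <-] := sigma_surj _ _ sk.
  exists u.-1; first by rewrite /wf_pair /=; lia.
  rewrite /comp_of /=; case: eqP => e; first lia.
  by rewrite prednK //; lia.
have [i i1 ei] := pair_surj _ wft; exists i; split=> //; first by rewrite ei.
by rewrite ei /pos_of ct /= /p addnK.
Qed.

Lemma theta_of_gt0 x : wf_pair x -> 0 < theta_of x.
Proof. by move=> wfx; rewrite divr_gt0 // a_gt0 //; have := comp_range _ wfx; lia. Qed.

Lemma theta_gt0 i : (1 <= i)%N -> 0 < theta i.
Proof. by move=> i1; apply/theta_of_gt0/wf_pair_. Qed.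

Lemma theta_of_first p : theta_of (p, d.-1) = (qr ^+ p.-1)^-1.
Proof. by rewrite /theta_of /comp_of eqxx a_d mul1r. Qed.

Lemma theta_1 : theta 1 = 1.
Proof. by rewrite /theta pair_1 theta_of_first expr0 invr1. Qed.

(** Inside a block [t] decreases while [sigma] sorts [a_] increasingly, after the largest value
    [a_d = 1]. From one block to the next, [a_k / q^(p-1)] is compared with [1 / q^p], by
    [qa_gt1]. *)
Lemma theta_of_next x : wf_pair x -> theta_of (next_pair x) <= theta_of x.
Proof.
case: x => p t wfx; move: (wfx) => /andP[/= p1 ht]; have [h h' _] := s_P p p1.
rewrite /next_pair /=; case: eqP => e.
  rewrite theta_of_first /theta_of /= -{1}(prednK p1) exprS invfM ler_pM2r ?invr_gt0 //.
  by rewrite -[leLHS]mulr1 ler_pdivrMl //; apply/ltW/qa_gt1/comp_range.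
rewrite /theta_of /= ler_pM2r ?invr_gt0 // /comp_of /=.
have -> : (t.-1 == d.-1) = false by lia.
rewrite prednK; last lia.
case: eqP => e'; last by apply: a_sigma_le; lia.
rewrite a_d; apply: a_le1; have := sigma_range (s_ p) t; lia.
Qed.

Lemma theta_S i : (1 <= i)%N -> theta i.+1 <= theta i.
Proof. by move=> i1; rewrite /theta pair_S // theta_of_next // wf_pair_. Qed.

Lemma theta_noninc i j : (1 <= i <= j)%N -> theta j <= theta i.
Proof.
move=> /andP[i1]; elim: j => [|j IH]; first by rewrite leqn0 => /eqP ->.
rewrite leq_eqVlt => /orP[/eqP -> //|ij]; apply: le_trans (IH ij).
by apply: theta_S; lia.
Qed.

Lemma theta_le1 i : (1 <= i)%N -> theta i <= 1.
Proof. by move=> i1; rewrite -theta_1; apply: theta_noninc. Qed.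

(** The cases in the formulas for the weights only reflect the place of the pair in its block: at
    the end the successor opens the next block with [1 / q^p], at the start [a_d = 1], and for
    [s = d] both hold. *)
Lemma weightE x : wf_pair x ->
  weight x.1 (s_ x.1) x.2 = (qr - 1) / qr * (theta_of x - theta_of (next_pair x)).
Proof.
case: x => p t wfx; move: (wfx) => /andP[/= p1 ht]; have [h h' _] := s_P p p1.
have q0 : qr != 0 by rewrite gt_eqF.
have qn0 n : qr ^+ n != 0 by rewrite gt_eqF.
have ep : p = p.-1.+1 by lia.
rewrite /Defs.weight /next_pair /=; case: eqP => esd.
  have -> : t = d.-1 by lia.
  rewrite esd eqxx !theta_of_first /= ep /= !exprS; field.
  by rewrite q0 qn0.
case: eqP => et.
  rewrite theta_of_first /theta_of /comp_of /=.
  have -> : (t == d.-1) = false by lia.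
  have -> : t.+1 = s_ p by lia.
  rewrite ep /= !exprS; field.
  by rewrite q0 qn0.
rewrite /theta_of /comp_of /=.
have -> : (t.-1 == d.-1) = false by lia.
rewrite prednK; last lia.
case: eqP => et'; first rewrite a_d et'.
  rewrite ep /= !exprS; field.
  by rewrite q0 qn0.
rewrite ep /= !exprS; field.
by rewrite q0 qn0.
Qed.

Lemma s_eq1 p : (p_ 1 < p)%N -> s_ p = 1%N.
Proof.
move=> hp; have [h _ h2] := s_P p ltac:(lia).
have [//|s1] := eqVneq (s_ p) 1%N.
by have := h2 1%N ltac:(lia); lia.
Qed.

Lemma sum_ltn a n : (\sum_(1 <= p < n.+1) (a < p) = n - a)%N.
Proof.
elim: n => [|n IH]; first by rewrite big_geq.
by rewrite big_nat_recr //= IH; case: leqP => /=; lia.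
Qed.

Lemma size_block p : (1 <= p)%N ->
  (d - (s_ p).-1 = 1 + \sum_(1 <= k < d) (p_ k < p))%N.
Proof.
move=> p1; have [h h1 h2] := s_P p p1.
rewrite (@big_cat_nat _ _ _ (s_ p)) /=; [|lia|lia].
rewrite [X in (1 + (X + _))%N]big_nat big1 => [|k /h2]; last by lia.
rewrite [X in (1 + (0 + X))%N]big_nat (eq_bigr (fun=> 1%N)) => [|k /h1 ->] //.
by rewrite -big_nat sum_nat_const_nat muln1; lia.
Qed.

(** Counts the pairs with [p <= p_1 + 1] by components instead of by blocks: component [d] occurs in
    each block, component [k] for [p_k < p <= p_1 + 1]. *)
Lemma nb_pairs_N : nb_pairs (p_ 1).+1 = N_.
Proof.
rewrite /nb_pairs big_nat (eq_bigr _ (fun p hp => size_block p (proj1 (andP hp)))).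
rewrite -big_nat big_split /= sum_nat_const_nat muln1 exchange_big /=.
rewrite /Defs.N_; congr (_ + _)%N; first lia.
by apply: eq_bigr => k _; rewrite sum_ltn addn1.
Qed.

Lemma nb_pairs_tail l : (nb_pairs (p_ 1 + l) = nb_pairs (p_ 1) + l * d)%N.
Proof.
elim: l => [|l IH]; first by rewrite addn0 mul0n addn0.
by rewrite addnS nb_pairsS IH s_eq1; lia.
Qed.

Lemma N_E : N_ = (nb_pairs (p_ 1) + d)%N.
Proof. by rewrite -nb_pairs_N -addn1 nb_pairs_tail mul1n. Qed.

Lemma N_ge_d : (d <= N_)%N. Proof. by rewrite N_E; lia. Qed.

Lemma pair_tail l r : (r < d)%N ->
  pair_ (N_ - d + l * d + r).+1 = ((p_ 1 + l).+1, (d.-1 - r)%N).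
Proof.
move=> rd; rewrite pair_E //= N_E addnK -nb_pairs_tail addnC iterD iter_nb_pairs.
by rewrite iter_next // s_eq1; lia.
Qed.

(** For [p > p_1] each block has all [d] components, in the same order, so [d] steps only raise [p]
    by 1. This starts at [N - d], where the last block of the first [N] pairs begins. *)
Lemma theta_period i : (N_ - d < i)%N -> theta (i + d) = theta i / qr.
Proof.
move=> hi; pose j := (i - (N_ - d)).-1.
have ei : i = (N_ - d + (j %/ d) * d + j %% d).+1.
  by rewrite -addnA -divn_eq /j; lia.
have rd : (j %% d < d)%N by rewrite ltn_mod; lia.
have eid : (i + d)%N = (N_ - d + (j %/ d).+1 * d + j %% d).+1 by rewrite {1}ei; lia.
rewrite eid ei /theta !pair_tail // /theta_of /comp_of /= !s_eq1 ?ltnS ?leq_addr //.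
by rewrite addnS exprS invfM [qr^-1 * _]mulrC mulrA.
Qed.

Lemma theta_tail_le l i : (N_ - d + l * d < i)%N -> theta i <= (qr ^+ l)^-1.
Proof.
elim: l i => [|l IH] i hi; first by rewrite expr0 invr1 theta_le1; lia.
have -> : i = (i - d + d)%N by lia.
rewrite theta_period; last lia.
rewrite exprSr invfM ler_pM2r ?invr_gt0 //; apply: IH; lia.
Qed.

Lemma theta_small (e : R) : 0 < e -> exists2 K, (1 <= K)%N & theta K < e.
Proof.
move=> e0; pose l := Num.bound e^-1.
have hl : e^-1 < l%:R by apply: archi_boundP; rewrite invr_ge0 ltW.
exists (N_ - d + l * d).+1 => //; apply: le_lt_trans (theta_tail_le l _ _) _ => //.
rewrite -[e]invrK ltf_pV2 ?posrE ?invr_gt0 //; apply: lt_trans hl _.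
by rewrite -natrX ltr_nat ltn_expl.
Qed.

Lemma sum_theta_tail l n :
  \sum_((N_ - d + l * d).+1 <= k < (N_ - d + (l + n) * d).+1) theta k
    <= 2 * d%:R / qr ^+ l.
Proof.
elim: n l => [|n IH] l.
  by rewrite addn0 big_geq // divr_ge0 // ltW.
rewrite (@big_cat_nat _ _ _ (N_ - d + l.+1 * d).+1) /=; [|lia|lia].
have -> : (l + n.+1 = l.+1 + n)%N by lia.
apply: (@le_trans _ _ (d%:R / qr ^+ l + 2 * d%:R / qr ^+ l.+1)).
  apply: lerD (IH _); rewrite big_nat.
  apply: (@le_trans _ _ (\sum_((N_ - d + l * d).+1 <= i < (N_ - d + l.+1 * d).+1)
     (qr ^+ l)^-1)).
    rewrite [leRHS]big_nat; apply: ler_sum => i hi; apply: theta_tail_le; lia.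
  rewrite sumr_const_nat mulrC -[leLHS]mulr_natr.
  by have -> : ((N_ - d + l.+1 * d).+1 - (N_ - d + l * d).+1 = d)%N by lia.
rewrite exprSr invfM !mulrA.
have -> : 2 * d%:R / qr ^+ l = d%:R / qr ^+ l + d%:R / qr ^+ l by field; rewrite gt_eqF.
have : 0 <= d%:R / qr ^+ l by rewrite divr_ge0 // ltW.
have : 2 <= qr by rewrite (ler_nat _ 2).
move: (_ / _) => x hq hx; rewrite lerD2l ler_pdivrMr //; nra.
Qed.

Lemma sum_theta_small (e : R) : 0 < e ->
  exists2 K, (1 <= K)%N & forall M, \sum_(K <= k < M) theta k <= e.
Proof.
move=> e0; pose l := Num.bound (2 * d%:R / e).
have hl : 2 * d%:R / e < l%:R by apply: archi_boundP; rewrite divr_ge0 // ltW.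
exists (N_ - d + l * d).+1 => // M.
apply: (@le_trans _ _ (\sum_((N_ - d + l * d).+1 <= k < (N_ - d + (l + M) * d).+1) theta k)).
  have [h|h] := leqP (N_ - d + l * d).+1 M; last first.
    rewrite big_geq ?(ltnW h) // big_nat; apply: sumr_ge0 => i hi.
    by apply/ltW/theta_gt0; lia.
  rewrite [leRHS](@big_cat_nat _ _ _ M) //=; last nia.
  rewrite lerDl big_nat; apply: sumr_ge0 => i hi.
  by apply/ltW/theta_gt0; lia.
apply: le_trans (sum_theta_tail _ _) _.
rewrite ler_pdivrMr // [e * _]mulrC -ler_pdivrMr //; apply/ltW; apply: lt_trans hl _.
by rewrite -natrX ltr_nat ltn_expl.
Qed.

(** The density of the integers not divisible by [q], hence of the starts of chains; it is also
    [omega_1]. *)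
Let cq : R := (qr - 1) / qr.

Lemma delta_E i : (1 <= i < N_)%N -> delta i = cq * (theta i - theta i.+1).
Proof.
move=> hi; rewrite /Defs.delta; case: eqP => [|_]; first lia.
have := weightE (pair_ i) (wf_pair_ i ltac:(lia)).
by rewrite /theta pair_S; [case: (pair_ i) => p t /= -> | lia].
Qed.

Lemma sum_weight p n : (p_ 1 < p)%N -> (n < d)%N ->
  \sum_(0 <= t < n.+1) weight p 1 t = cq * (theta_of (p, n) - (qr ^+ p)^-1).
Proof.
move=> hp; elim: n => [|n IH] hn.
  rewrite big_nat1.
  have := weightE (p, 0%N); rewrite /wf_pair /= s_eq1 // => ->; last lia.
  by rewrite /next_pair /= s_eq1 // eqxx theta_of_first.
rewrite big_nat_recr //= IH; last lia.
have := weightE (p, n.+1); rewrite /wf_pair /= s_eq1 // => ->; last lia.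
by rewrite /next_pair /= s_eq1 //= -mulrDr; congr (_ * _); ring.
Qed.

Lemma pair_N : pair_ N_ = ((p_ 1).+1, 0%N).
Proof.
have := pair_tail 0 d.-1; rewrite mul0n !addn0 subnn => <-; last lia.
by congr pair_; rewrite N_E; lia.
Qed.

(** [delta N_] collects all the weights from the [N]-th pair on. Each block telescopes
    ([sum_weight]), and [theta] tends to 0, so that nothing is subtracted from [theta N_]. *)
Lemma delta_N : delta N_ = cq * theta N_.
Proof.
rewrite /Defs.delta eqxx.
have -> : weight (p_ 1).+1 1 0 = cq * (theta N_ - (qr ^+ (p_ 1).+1)^-1).
  have := sum_weight (p_ 1).+1 0 (leqnn _) ltac:(lia).
  by rewrite big_nat1 => ->; rewrite /theta pair_N.
set u := (X in series X).
have su n : series u n = cq * ((qr ^+ (p_ 1).+1)^-1 - (qr ^+ (p_ 1 + 1 + n))^-1).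
  elim: n => [|n IH]; first by rewrite /series /= big_geq // addn0 addn1 subrr mulr0.
  rewrite seriesSr IH /u.
  have := sum_weight (p_ 1 + 2 + n) d.-1 ltac:(lia) ltac:(lia).
  rewrite prednK; last lia.
  move=> ->; rewrite -mulrDr theta_of_first; congr (_ * _).
  have -> : (p_ 1 + 2 + n).-1 = (p_ 1 + 1 + n)%N by lia.
  have -> : (p_ 1 + 1 + n.+1 = p_ 1 + 2 + n)%N by lia.
  by ring.
have cu : series u @ \oo --> cq * (qr ^+ (p_ 1).+1)^-1.
  have -> : series u = fun n =>
      cq * ((qr ^+ (p_ 1).+1)^-1 - (qr ^+ (p_ 1).+1)^-1 * (qr^-1) ^+ n).
    by apply/funext => n; rewrite su exprD addn1 invfM exprVn.
  rewrite -[X in _ --> cq * X]subr0 -[X in _ --> cq * (_ - X)](mulr0 (qr ^+ (p_ 1).+1)^-1).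
  apply: cvgZr; apply: cvgB; first exact: cvg_cst.
  apply: cvgZr; apply: cvg_expr.
  by rewrite ger0_norm ?invr_ge0 ?ler0n // invf_lt1 // q_gt1.
by rewrite (cvg_lim _ cu) // -mulrDr subrK.
Qed.

Lemma sum_delta k : (1 <= k <= N_)%N -> \sum_(k <= i < N_.+1) delta i = cq * theta k.
Proof.
move=> /andP[k1 kN]; rewrite big_nat_recr //= delta_N.
rewrite big_nat (eq_bigr (fun i => - (cq * theta i.+1 - cq * theta i))); last first.
  by move=> i hi; rewrite delta_E; [ring | lia].
by rewrite -big_nat sumrN telescope_sumr //; ring.
Qed.

Lemma cq_gt0 : 0 < cq.
Proof. by rewrite divr_gt0 // subr_gt0 q_gt1. Qed.

Lemma omega_1 : omega 1 = cq.
Proof.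
by rewrite /Defs.omega eqxx sum_delta ?theta_1 ?mulr1 //; have := N_ge_d; lia.
Qed.

Definition ratio k : R := theta k.+1 / theta k.

Lemma ratio_gt0 k : (1 <= k)%N -> 0 < ratio k.
Proof. by move=> k1; rewrite divr_gt0 // theta_gt0. Qed.

Lemma ratio_le1 k : (1 <= k)%N -> ratio k <= 1.
Proof.
by move=> k1; rewrite ler_pdivrMr ?mul1r ?theta_gt0 //; apply: theta_S.
Qed.

Lemma ratio_period k : (N_ - d < k)%N -> ratio (k + d) = ratio k.
Proof.
move=> hk; rewrite /ratio -addSn !theta_period //; last lia.
have := theta_gt0 k ltac:(lia) => h; field.
by rewrite !gt_eqF.
Qed.

Lemma ratio_periodM k l : (N_ - d < k)%N -> ratio (k + l * d) = ratio k.
Proof.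
move=> hk; elim: l => [|l IH]; first by rewrite addn0.
by rewrite mulSn addnCA addnC ratio_period //; lia.
Qed.

Lemma omega_E k : (2 <= k <= N_)%N -> omega k = ratio k.-1.
Proof.
move=> hk; rewrite /Defs.omega.
have -> : (k == 1%N) = false by lia.
have -> : (k == N_.+1) = false by lia.
rewrite !sum_delta; [|lia..].
rewrite /ratio prednK; last lia.
have h := theta_gt0 k.-1 ltac:(lia); have h' := cq_gt0.
by field; rewrite !gt_eqF //; have := q_gt1; lra.
Qed.

Lemma prod_omega n : (1 <= n <= N_)%N -> \prod_(1 <= k < n.+1) omega k = cq * theta n.
Proof.
case: n => // n; elim: n => [|n IH] hn.
  by rewrite big_nat1 omega_1 theta_1 mulr1.
rewrite big_nat_recr //= IH ?omega_E; [|lia..].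
rewrite /ratio /= mulrA -mulrA mulrAC -mulrA.
by rewrite divfK // gt_eqF // theta_gt0.
Qed.

(** The product is [theta_{N-d+1} / (q * theta_N)], since the constants [cq] cancel, and dividing by
    [q] shifts the index by the period [d]. So the exponent in the equations for [t] fits into the
    sequence [ratio]. *)
Lemma omega_N1 : omega_tilde R d q m * omega N_.+1 = ratio N_.
Proof.
have dN := N_ge_d.
have -> : omega_tilde R d q m = cq * theta (N_ - d).+1.
  by rewrite /omega_tilde prod_omega //; lia.
have -> : omega N_.+1 = (qr * delta N_)^-1.
  by rewrite /Defs.omega eqxx; case: eqP => //; lia.
rewrite delta_N /ratio -[in RHS](subnK dN) -addSn theta_period; last lia.
rewrite (subnK dN).
have h := theta_gt0 N_ ltac:(lia); have h' := cq_gt0.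
by field; rewrite !gt_eqF //; have := q_gt1; lra.
Qed.

(** * The recursion for [t] and the masses of cylinders *)

Lemma powR_ge1 (x r : R) : 1 <= x -> 0 <= r -> 1 <= x `^ r.
Proof. by move=> x1 r0; rewrite -[leLHS](powRr0 x) ler_powR. Qed.

Context (Omega : set (Sigma d m)).
Local Notation chi := (@chi R d q m).
Local Notation Pref := (Pref R q Omega).
Local Notation chi_cyl := (chi_cyl R q Omega).
Local Notation nested := (nested q Omega).

Lemma digit_lt (x : Sigma d m) i k : (1 <= k <= d)%N -> (digit x i k < m k)%N.
Proof.
move=> hk; rewrite /digit; case: insubP => [u _ eu|]; last by case/negP; lia.
have hm := m_ge2 k hk; rewrite /=; set v := (X in nat_of_ord X).
have := ltn_ord v; move: (nat_of_ord v) => n.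
have -> : nat_of_ord u = k.-1 by [].
by rewrite !prednK //; lia.
Qed.

Definition chi_word j (y : Sigma d m) : seq nat := [seq chi i y | i <- iota 1 j].

Lemma size_chi_word j y : size (chi_word j y) = j.
Proof. by rewrite size_map size_iota. Qed.

Lemma chi_wordS j y : chi_word j.+1 y = rcons (chi_word j y) (chi j.+1 y).
Proof. by rewrite /chi_word -{1}[j.+1]addn1 iotaD map_cat /= add1n cats1. Qed.

Lemma take_chi_word k j y : (k <= j)%N -> take k (chi_word j y) = chi_word k y.
Proof. by move=> kj; rewrite -map_take take_iota (minn_idPl kj). Qed.

Lemma nth_chi_word j i y : (1 <= i <= j)%N -> nth 0%N (chi_word j y) i.-1 = chi i y.
Proof.
move=> h; rewrite (nth_map 0%N) ?size_iota; last lia.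
by rewrite nth_iota ?add1n ?prednK //; lia.
Qed.

Lemma Pref_chi_word j y : Omega y -> Pref j (chi_word j y).
Proof. by move=> Oy; exists y. Qed.

Lemma Pref_size j w : Pref j w -> size w = j.
Proof. by move=> [y _ <-]; rewrite size_chi_word. Qed.

Lemma Pref_take j k w : (k <= j)%N -> Pref j w -> Pref k (take k w).
Proof. by move=> kj [y Oy <-]; rewrite (take_chi_word k j) //; exact: Pref_chi_word. Qed.

Lemma chi_cylE w y : chi_cyl w y <-> Omega y /\ chi_word (size w) y = w.
Proof.
split=> [[Oy h]|[Oy h]]; split=> //.
  apply: (@eq_from_nth _ 0%N); rewrite size_chi_word // => i hi.
  by rewrite -[i]/(i.+1.-1) nth_chi_word ?h //; lia.
by move=> i hi; rewrite -[in RHS]h nth_chi_word.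
Qed.

Lemma m_le1 k : (1 <= k <= d)%N -> (m k <= m 1)%N.
Proof.
case: k => // k; elim: k => // k IH hk.
by apply: leq_trans (IH _); [apply: m_noninc|]; lia.
Qed.

Lemma chi_lt i (x : Sigma d m) : (1 <= i)%N -> (chi i x < m 1)%N.
Proof.
move=> i1; rewrite chiE; have h := comp_range _ (wf_pair_ i i1).
by apply: leq_trans (m_le1 _ h); apply: digit_lt.
Qed.

Lemma Pref_letter j w X : Pref j.+1 (rcons w X) -> (X < m 1)%N.
Proof.
by move=> [y _]; rewrite -/(chi_word _ _) chi_wordS => /rcons_inj[_ <-]; exact: chi_lt.
Qed.

Lemma Pref_ext j w : Pref j w -> exists2 X, (X < m 1)%N & Pref j.+1 (rcons w X).
Proof.
move=> [y Oy <-]; exists (chi j.+1 y); first exact: chi_lt.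
by exists y => //; rewrite -/(chi_word _ _) chi_wordS.
Qed.

Definition ext_sum (F : seq nat -> R) (w : seq nat) : R :=
  \sum_(0 <= X < m 1 | `[< Pref (size w).+1 (rcons w X) >]) F (rcons w X).

Lemma eq_ext_sum (F G : seq nat -> R) w :
  (forall X, Pref (size w).+1 (rcons w X) -> F (rcons w X) = G (rcons w X)) ->
  ext_sum F w = ext_sum G w.
Proof. by move=> h; apply: eq_bigr => X /asboolP /h. Qed.

Lemma ler_ext_sum (F G : seq nat -> R) w :
  (forall X, Pref (size w).+1 (rcons w X) -> F (rcons w X) <= G (rcons w X)) ->
  ext_sum F w <= ext_sum G w.
Proof. by move=> h; apply: ler_sum => X /asboolP /h. Qed.

Lemma ext_sum_ge (F : seq nat -> R) w X :
  (forall Y, Pref (size w).+1 (rcons w Y) -> 0 <= F (rcons w Y)) ->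
  Pref (size w).+1 (rcons w X) -> F (rcons w X) <= ext_sum F w.
Proof.
move=> F0 hX; have Xm : X \in index_iota 0 (m 1) by rewrite mem_index_iota /=; apply: Pref_letter hX.
rewrite /ext_sum big_mkcond (bigD1_seq X) ?iota_uniq //= asboolT // lerDl.
by apply: sumr_ge0 => Y _; case: asboolP => // /F0.
Qed.

Lemma ext_sum_le (F : seq nat -> R) w (c : R) : 0 <= c ->
  (forall X, Pref (size w).+1 (rcons w X) -> F (rcons w X) <= c) ->
  ext_sum F w <= (m 1)%:R * c.
Proof.
move=> c0 h; apply: (@le_trans _ _ (\sum_(0 <= X < m 1) c)).
  rewrite /ext_sum big_mkcond /=; apply: ler_sum => X _.
  by case: asboolP => // /h.
by rewrite sumr_const_nat subn0 mulr_natl.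
Qed.

Context (t : seq nat -> R).
Hypothesis tP : is_t q Omega t.

(** The number of letters to be summed before the next length [N + l d], where [t] is given. At such
    a length it is [d], not 0, so that [S_] is then the right-hand side of the equation for [t]. *)
Definition block_depth j : nat := if (j < N_)%N then (N_ - j)%N else (d - (j - N_) %% d)%N.
(* On words of length [N + l d], the function [S_] is not [t] itself, but the power
   of [t] that makes the recursion [S_rec] hold at all lengths. *)
Definition S_ w : R := nested t (block_depth (size w)) w.

Lemma S_0 : S_ [::] = t_empty q Omega t.
Proof. by rewrite /S_ /block_depth /= subn0; case: ltnP => //; have := N_ge_d; lia. Qed.

Lemma nestedS k w : nested t k.+1 w =
  ext_sum (fun v => if k == 0%N then nested t k v else nested t k v `^ omega (N_ - k + 1)) w.
Proof. by []. Qed.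

Lemma t_E l w : Pref (N_ + l * d) w ->
  [/\ 1 <= S_ w, S_ w <= ((m d)%:R `^ (omega N_.+1 * d%:R)) `^ (ratio N_)^-1
    & S_ w `^ ratio N_ = t w].
Proof.
move=> Pw; have [/andP[t1 t2] t3] := tP l w Pw.
have sw := Pref_size _ _ Pw.
have r0 : 0 < ratio N_ by apply: ratio_gt0; have := N_ge_d; lia.
have Sw : S_ w = t w `^ (ratio N_)^-1.
  rewrite /S_ /block_depth sw ltnNge leq_addr /= addKn modnMl subn0 -t3.
  by rewrite omega_N1.
split; rewrite Sw.
- by rewrite powR_ge1 // invr_ge0 ltW.
- by rewrite ge0_ler_powR ?nnegrE ?invr_ge0 ?(ltW r0) ?(le_trans _ t1) ?powR_ge0.
- by rewrite -powRrM mulVf ?gt_eqF // powRr1 // (le_trans _ t1).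
Qed.

(** One nested sum is peeled off. If the extended word ends a block, the summand is [t], which is
    [S_] to the power [ratio N_]; otherwise it carries [omega_{N-k+1}], the ratio at [j+1] up to a
    multiple of the period. *)
Lemma S_rec j w : Pref j w -> S_ w = ext_sum (fun v => S_ v `^ ratio j.+1) w.
Proof.
move=> Pw; have sw := Pref_size _ _ Pw.
have dN := N_ge_d.
have [k [Ek hk]] : exists k, block_depth (size w) = k.+1 /\
   ((k = 0%N /\ exists l, j.+1 = (N_ + l * d)%N) \/
    ((0 < k)%N /\ block_depth j.+1 = k /\ omega (N_ - k + 1) = ratio j.+1)).
  rewrite sw /block_depth; have [jN|jN] := ltnP j N_.
    exists (N_ - j).-1; split; first lia.
    have [e|e] := eqVneq j.+1 N_.
      by left; split; [lia | exists 0%N; lia].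
    right; split; first lia.
    have -> : (j.+1 < N_)%N by lia.
    split; first lia.
    have -> : (N_ - (N_ - j).-1 + 1 = j.+2)%N by lia.
    by rewrite omega_E //; lia.
  set i := (j - N_)%N; have hr : (i %% d < d)%N by rewrite ltn_mod; lia.
  have ej : j = (N_ + (i %/ d) * d + i %% d)%N by rewrite -addnA -divn_eq /i; lia.
  exists (d - i %% d).-1; split; first lia.
  move: (i %/ d)%N (i %% d)%N ej hr => l r ej hr.
  have [e|e] := eqVneq r.+1 d.
    by left; split; [lia | exists l.+1; rewrite ej mulSn; lia].
  right; split; first lia.
  have -> : (j.+1 < N_)%N = false by lia.
  have ej1 : (j.+1 - N_ = l * d + r.+1)%N by lia.
  rewrite ej1 modnMDl modn_small; last lia.
  split; first lia.
  have -> : (N_ - (d - r).-1 + 1 = (N_ - d + r.+1).+1)%N by lia.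
  rewrite omega_E; last lia.
  have -> : j.+1 = ((N_ - d + r.+1) + l.+1 * d)%N by rewrite ej mulSn; lia.
  by rewrite ratio_periodM //; lia.
rewrite /S_ Ek nestedS; apply: eq_ext_sum => X; rewrite sw => PX.
case: hk => [[-> [l el]]|[k0 [Ek' ew]]].
  rewrite /=; move: PX; rewrite el => PX; have [_ _ <-] := t_E l _ PX.
  rewrite /S_; congr (_ `^ _).
  have := ratio_periodM N_ l; rewrite addnC [(l * d + _)%N]addnC => -> //; lia.
have -> : (k == 0%N) = false by lia.
by rewrite size_rcons sw Ek' ew.
Qed.

Definition S_max : R :=
  (m 1)%:R ^+ N_ * ((m d)%:R `^ (omega N_.+1 * d%:R)) `^ (ratio N_)^-1.

(** Going back from the next length [N + l d], at most [N] letters away: each step sums at most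
    [m_1] terms, and since [S_ >= 1] and the ratios are at most 1, the powers do not exceed [S_]. *)
Lemma S_bounds j w : Pref j w -> 1 <= S_ w <= S_max.
Proof.
set K := ((m d)%:R `^ (omega N_.+1 * d%:R)) `^ (ratio N_)^-1.
have K1 : 0 <= K by exact: powR_ge0.
have m1 : 1 <= (m 1)%:R :> R by rewrite ler1n; have := m_ge2 1%N ltac:(lia); lia.
have main r l j' w' : (j' + r = N_ + l * d)%N -> Pref j' w' ->
    1 <= S_ w' <= (m 1)%:R ^+ r * K.
  elim: r j' w' => [|r IH] j' w' e Pw.
    rewrite addn0 in e; rewrite e in Pw; have [h1 h2 _] := t_E l _ Pw.
    by rewrite h1 expr0 mul1r.
  have sw := Pref_size _ _ Pw; rewrite (S_rec j') //.
  have H X : Pref j'.+1 (rcons w' X) ->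
      1 <= S_ (rcons w' X) `^ ratio j'.+1 <= (m 1)%:R ^+ r * K.
    move=> PX; have /andP[h1 h2] := IH j'.+1 _ ltac:(lia) PX.
    apply/andP; split; first by rewrite powR_ge1 // ltW // ratio_gt0.
    by apply: le_trans h2; rewrite -[leRHS]powRr1 ?(le_trans _ h1) // ler_powR // ratio_le1.
  apply/andP; split.
    have [X _ PX] := Pref_ext _ _ Pw.
    apply: (@le_trans _ _ (S_ (rcons w' X) `^ ratio j'.+1)); first by case/andP: (H X PX).
    apply: (ext_sum_ge (fun v => S_ v `^ ratio j'.+1)); last by rewrite sw.
    by move=> Y _; exact: powR_ge0.
  rewrite exprS -mulrA; apply: ext_sum_le; first by rewrite mulr_ge0 // exprn_ge0 // (le_trans _ m1).
  by move=> X; rewrite sw => /H /andP[].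
have dN := N_ge_d.
have [r [l [hr e]]] : exists r l, (r <= N_)%N /\ (j + r = N_ + l * d)%N.
  have [jN|jN] := ltnP j N_; first by exists (N_ - j)%N, 0%N; lia.
  set i := (j - N_)%N; have hr : (i %% d < d)%N by rewrite ltn_mod; lia.
  have ej : j = (N_ + (i %/ d) * d + i %% d)%N by rewrite -addnA -divn_eq /i; lia.
  by exists (d - i %% d)%N, (i %/ d).+1; rewrite mulSn; lia.
move=> Pw; have /andP[h1 h2] := main r l j w e Pw; rewrite h1 /=.
by apply: le_trans h2 _; rewrite ler_wpM2r // ler_weXn2l.
Qed.
Lemma next_block j : exists r l, (r <= N_)%N /\ (j + r = N_ + l * d)%N.
Proof.
have dN := N_ge_d.
have [jN|jN] := ltnP j N_; first by exists (N_ - j)%N, 0%N; lia.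
set i := (j - N_)%N; have hr : (i %% d < d)%N by rewrite ltn_mod; lia.
have ej : j = (N_ + (i %/ d) * d + i %% d)%N by rewrite -addnA -divn_eq /i; lia.
by exists (d - i %% d)%N, (i %/ d).+1; rewrite mulSn; lia.
Qed.

Definition f_ w : R := ln (S_ w).
Definition Z_ w : R :=
  \sum_(1 <= k < (size w).+1) (f_ (take k.-1 w) - ratio k * f_ (take k w)).

Lemma S_gt0 j w : Pref j w -> 0 < S_ w.
Proof. by move=> /S_bounds /andP[h _]; apply: lt_le_trans h. Qed.

Lemma f_bounds j w : Pref j w -> 0 <= f_ w <= ln S_max.
Proof.
move=> Pw; have /andP[h1 h2] := S_bounds _ _ Pw; rewrite ln_ge0 //=.
by rewrite ler_ln // posrE ?(S_gt0 _ _ Pw) // (lt_le_trans _ h2) // (S_gt0 _ _ Pw).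
Qed.

Lemma S_E j w : Pref j w -> S_ w = expR (f_ w).
Proof. by move=> /S_gt0 h; rewrite lnK. Qed.

Lemma powR_S j w (r : R) : Pref j w -> S_ w `^ r = expR (r * f_ w).
Proof. by move=> /S_gt0 h; rewrite /powR gt_eqF. Qed.

Lemma Z_rcons w X : Z_ (rcons w X) = Z_ w + (f_ w - ratio (size w).+1 * f_ (rcons w X)).
Proof.
rewrite /Z_ size_rcons big_nat_recr //=; congr (_ + _).
  rewrite big_nat [RHS]big_nat; apply: eq_bigr => k hk.
  by rewrite -cats1 !takel_cat //; lia.
by rewrite -{1}cats1 take_size_cat // take_oversize // size_rcons.
Qed.

(** Summation by parts: the terms are grouped by [a k] instead of by letter. This is the grouping in
    the definition of mu, with [t] at the ends of a block and powers [omega - 1] inside it. *)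
Lemma sum_Z_block (a : nat -> R) i n : (i < n)%N ->
  \sum_(i.+1 <= k < n.+1) (a k.-1 - ratio k * a k) =
  a i - ratio n * a n - \sum_(i.+1 <= k < n) (ratio k - 1) * a k.
Proof.
elim: n => // n IH; rewrite ltnS leq_eqVlt => /orP[/eqP <-|hi].
  by rewrite big_nat1 [\sum_(i.+1 <= _ < i.+1) _]big_geq // subr0.
rewrite big_nat_recr; last by lia.
rewrite IH // [in RHS]big_nat_recr /=; last by lia.
by ring.
Qed.

(** The sums [A] and [Ak] are the values of [S_] at the intermediate lengths, and [t] is [S_] to the
    power [ratio] at the ends of blocks; each block is then the regrouped sum of [sum_Z_block]. *)
Lemma mu_valueE l w : Pref (N_ + l * d) w -> mu_value q Omega t l w = expR (- Z_ w).
Proof.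
move=> Pw; have sw := Pref_size _ _ Pw; have dN := N_ge_d.
have Pt k : (k <= N_ + l * d)%N -> Pref k (take k w) by move=> hk; apply: Pref_take hk Pw.
pose a k := f_ (take k w).
have tE k : (k <= l)%N -> t (take (N_ + k * d) w) = expR (ratio (N_ + k * d) * a (N_ + k * d)%N).
  move=> hk; have Pk := Pt (N_ + k * d)%N ltac:(nia).
  have [_ _ <-] := t_E _ _ Pk.
  by rewrite ratio_periodM ?(powR_S _ _ _ Pk) //; lia.
rewrite /mu_value -/S_0 -S_0.
have t0 := tE 0%N isT; rewrite mul0n addn0 in t0; rewrite t0.
have -> : S_ [::] = expR (a 0%N) by rewrite /a take0 (S_E 0%N) //; have := Pt 0%N isT; rewrite take0.
rewrite -expRN -expRD.
rewrite [X in _ * X * _]big_nat [X in _ * X * _]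
  (eq_bigr (fun p => expR ((ratio p.-1 - 1) * a p.-1))); last first.
  move=> p hp; rewrite /A omega_E; last by lia.
  rewrite /a -(powR_S _ _ _ (Pt p.-1 ltac:(lia))); congr (_ `^ _).
  rewrite /S_ size_takel; last by lia.
  have h : (p.-1 < N_)%N by lia.
  by rewrite /block_depth h; congr nested; lia.
rewrite -big_nat -expR_sum -expRD.
rewrite [X in _ * X]big_nat [X in _ * X]
  (eq_bigr (fun k => expR (- \sum_((N_ + k.-1 * d).+1 <= i < (N_ + k * d).+1)
    (a i.-1 - ratio i * a i)))); last first.
  move=> k hk; rewrite sum_Z_block; last by nia.
  rewrite !tE; [|lia..].
  have -> : expR (ratio (N_ + k.-1 * d) * a (N_ + k.-1 * d)%N) `^ (- (omega_tilde R d q m * omega N_.+1)^-1)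
     = expR (- a (N_ + k.-1 * d)%N).
    rewrite omega_N1 ratio_periodM; last by lia.
    rewrite /powR gt_eqF ?expR_gt0 // expRK mulrA mulNr mulVf ?mulN1r //.
    by rewrite gt_eqF // ratio_gt0; lia.
  rewrite [X in _ * X]big_nat [X in _ * X](eq_bigr (fun p =>
    expR ((ratio (N_ + k.-1 * d + p - 1) - 1) * a (N_ + k.-1 * d + p - 1)%N))); last first.
    move=> p hp; rewrite /Ak omega_E; last by lia.
    have hl : (N_ + k.-1 * d + p - 1 <= N_ + l * d)%N by nia.
    have -> : ratio (N_ - d + p).-1 = ratio (N_ + k.-1 * d + p - 1).
      have -> : (N_ + k.-1 * d + p - 1 = (N_ - d + p).-1 + k.-1.+1 * d)%N.
        by rewrite mulSn; move: (k.-1 * d)%N => x; lia.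
      by rewrite ratio_periodM //; lia.
    rewrite /a -(powR_S _ _ _ (Pt _ hl)); congr (_ `^ _).
    rewrite /S_ size_takel ?sw // /block_depth.
    have -> : (N_ + k.-1 * d + p - 1 < N_)%N = false by move: (k.-1 * d)%N => x; lia.
    have -> : (N_ + k.-1 * d + p - 1 - N_ = k.-1 * d + p.-1)%N by move: (k.-1 * d)%N => x; lia.
    by rewrite modnMDl modn_small; [congr nested; lia | lia].
  rewrite -big_nat -expR_sum -!expRD; congr expR.
  have -> : \sum_(2 <= p < d.+1) (ratio (N_ + k.-1 * d + p - 1) - 1) * a (N_ + k.-1 * d + p - 1)%N
     = \sum_((N_ + k.-1 * d).+1 <= i < N_ + k * d) (ratio i - 1) * a i.
    rewrite -[(N_ + k.-1 * d).+1]add1n big_addn !big_add1 /=.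
    have -> : (N_ + k * d - (N_ + k.-1 * d) = d)%N by nia.
    by apply: eq_bigr => p _; have -> : (N_ + k.-1 * d + p.+2 - 1 = p.+1 + (N_ + k.-1 * d))%N
      by move: (k.-1 * d)%N => x; lia.
  by ring.
rewrite -big_nat -expR_sum -expRD; congr expR.
rewrite sumrN /Z_ sw [\sum_(1 <= k < (N_ + _).+1) _](@big_cat_nat _ _ _ N_.+1) /=; [|lia|lia].
rewrite opprD sum_Z_block; last by lia.
have -> : \sum_(1 <= k < l.+1) \sum_((N_ + k.-1 * d).+1 <= i < (N_ + k * d).+1)
    (a i.-1 - ratio i * a i) = \sum_(N_.+1 <= i < (N_ + l * d).+1) (a i.-1 - ratio i * a i).
  elim: (l) => [|l' IH]; first by rewrite mul0n addn0 !big_geq.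
  rewrite big_nat_recr //= IH [RHS](@big_cat_nat _ _ _ (N_ + l' * d).+1) //=; nia.
have -> : \sum_(2 <= i < N_.+1) (ratio i.-1 - 1) * a i.-1 = \sum_(1 <= i < N_) (ratio i - 1) * a i.
  by rewrite big_add1.
by rewrite /a; ring.
Qed.

Hypothesis Omega_closed : closed Omega.
Context (mu : probability (SigmaB d m) R).
Hypothesis muP : is_mu q Omega t mu.
Local Notation msr A := (measurable (A : set (SigmaB d m))).
Local Notation mmu := (mass mu).

Lemma pair_fst_le i : (1 <= i)%N -> ((pair_ i).1 <= i)%N.
Proof.
case: i => // i _; elim: i => [|i IH]; first by rewrite pair_1.
rewrite pair_S // /next_pair; case: ifP => _ /=; lia.
Qed.

Lemma pos_range i : (1 <= i)%N -> (1 <= pos_of (pair_ i) <= i)%N.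
Proof.
move=> i1; have := p_comp_lt _ (wf_pair_ i i1); have := pair_fst_le i i1.
by rewrite /pos_of; lia.
Qed.

Lemma eq_digit (x y : Sigma d m) i j k : x i.-1 = y j.-1 -> digit x i k = digit y j k.
Proof. by rewrite /digit => ->. Qed.

Lemma eq_chi_word j (x y : Sigma d m) :
  (forall i, (i < j)%N -> y i = x i) -> chi_word j y = chi_word j x.
Proof.
move=> h; apply/eq_in_map => i; rewrite mem_iota => hi; rewrite !chiE.
by apply: eq_digit; apply: h; have := pos_range i ltac:(lia); lia.
Qed.

Lemma measurable_Omega : msr Omega. Proof. exact: measurable_of_closed. Qed.

Lemma measurable_chi_cyl w : msr (chi_cyl w).
Proof.
have -> : chi_cyl w = Omega `&` [set y | chi_word (size w) y = w].
  by apply/seteqP; split=> y /chi_cylE.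
apply: measurableI; first exact: measurable_Omega.
apply: measurable_of_open; apply: (open_of_prefix (size w)) => x y h /= {2}<-.
exact: eq_chi_word.
Qed.
Hint Resolve measurable_Omega measurable_chi_cyl : core.

Lemma chi_cyl_Pref w y : chi_cyl w y -> Pref (size w) w.
Proof. by move=> /chi_cylE[Oy <-]; rewrite size_chi_word; exact: Pref_chi_word. Qed.

Lemma chi_cyl_nil : chi_cyl [::] = Omega.
Proof. by apply/seteqP; split=> [y /chi_cylE[]|y Oy] //; apply/chi_cylE. Qed.

Lemma chi_cyl_rcons w X y : chi_cyl (rcons w X) y <-> chi_cyl w y /\ chi (size w).+1 y = X.
Proof.
rewrite !chi_cylE size_rcons chi_wordS; split=> [[Oy /rcons_inj[-> ->]] //|[[Oy ->] ->]] //.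
Qed.

Lemma mass_OmegaC A : msr A -> A `&` Omega = set0 -> mmu A = 0.
Proof.
move=> mA AO; have [mO _] := muP; apply/eqP; rewrite eq_le mass_ge0 andbT.
have := @massU _ _ _ mu A Omega mA measurable_Omega AO.
have : mmu Omega = 1 by rewrite /mass mO.
move=> -> e; have : mmu (A `|` Omega) <= mmu setT.
  by apply: mass_le => //; apply: measurableU.
by rewrite massT e gerDr.
Qed.

Lemma mass_Omega A : msr A -> mmu (A `&` Omega) = mmu A.
Proof.
move=> mA; have mAO : msr (A `&` Omega) by exact: measurableI.
have mAD : msr (A `\` Omega) by exact: measurableD.
have e : A = (A `&` Omega) `|` (A `\` Omega).
  by rewrite setUIDK.
rewrite [in RHS]e massU // ?(mass_OmegaC (A `\` Omega)) ?addr0 //.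
  by apply/seteqP; split=> // y [[_ ?] ?].
by apply/seteqP; split=> // y [[_ ?] [_ ?]].
Qed.

Lemma mass_chi_cylS A w : msr A ->
  mmu (A `&` chi_cyl w) = ext_sum (fun v => mmu (A `&` chi_cyl v)) w.
Proof.
move=> mA.
have [|||_] := @mass_bigcup _ _ _ mu _ (index_iota 0 (m 1))
    (fun X => A `&` chi_cyl (rcons w X)).
- exact: iota_uniq.
- by move=> X _; exact: measurableI.
- by move=> X Y u _ _ [_ /chi_cyl_rcons[_ <-]] [_ /chi_cyl_rcons[_ <-]].
have -> : \bigcup_(X in [set` index_iota 0 (m 1)]) (A `&` chi_cyl (rcons w X)) = A `&` chi_cyl w.
  apply/seteqP; split=> [u [X _ [Au /chi_cyl_rcons[]]] //|u [Au wu]].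
  exists (chi (size w).+1 u); first by rewrite /= mem_index_iota chi_lt.
  by split=> //; apply/chi_cyl_rcons.
move=> ->; rewrite /ext_sum [RHS]big_mkcond; apply: eq_bigr => X _ /=.
case: asboolP => // nP; rewrite (_ : _ `&` _ = set0) ?mass_set0 //.
by apply/seteqP; split=> // u [_ /chi_cyl_Pref]; rewrite size_rcons.
Qed.

(** The values of mu are given for lengths [N + l d] only. Descending from the next such length,
    additivity sums the powers of [S_] at the extensions of [w], and by [S_rec] their sum cancels
    the denominator [S_ w]. *)
Lemma mass_chi_cyl j w : Pref j w -> mmu (chi_cyl w) = expR (- Z_ w).
Proof.
have [r [l [_ e]]] := next_block j.
elim: r j w e => [|r IH] j w e Pw.
  rewrite addn0 in e; rewrite e in Pw.
  by have [_ h] := muP; rewrite /mass (h _ _ Pw) /= mu_valueE.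
have sw := Pref_size _ _ Pw.
have := mass_chi_cylS setT w (@measurableT _ _); rewrite setTI => ->.
rewrite (eq_ext_sum _ (fun v => expR (- Z_ w) / S_ w * S_ v `^ ratio j.+1)); last first.
  move=> X; rewrite sw => PX; rewrite setTI (IH j.+1) //; last by lia.
  rewrite Z_rcons (powR_S _ _ _ PX) (S_E _ _ Pw) sw -expRN -!expRD; congr expR.
  by ring.
rewrite /ext_sum -mulr_sumr -[\sum_(_ <= _ < _ | _) _]/(ext_sum (fun v => S_ v `^ ratio j.+1) w).
by rewrite -S_rec // divfK // gt_eqF // (S_gt0 _ _ Pw).
Qed.

Lemma Z_chi_word j y : Z_ (chi_word j y) =
  \sum_(1 <= k < j.+1) (f_ (chi_word k.-1 y) - ratio k * f_ (chi_word k y)).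
Proof.
rewrite /Z_ size_chi_word big_nat [RHS]big_nat; apply: eq_bigr => k hk.
by rewrite !take_chi_word //; lia.
Qed.

Lemma Z_ge0 j w : Pref j w -> 0 <= Z_ w.
Proof.
move=> Pw; rewrite -oppr_le0 -(ler_expR _ 0) expR0 -(mass_chi_cyl _ _ Pw) -(massT mu).
exact: mass_le.
Qed.

Lemma Z_le j w : Pref j w -> Z_ w <= j%:R * ln S_max.
Proof.
move=> Pw; have sw := Pref_size _ _ Pw.
rewrite /Z_ sw; apply: (@le_trans _ _ (\sum_(1 <= k < j.+1) ln S_max)).
  rewrite big_nat [leRHS]big_nat; apply: ler_sum => k hk.
  have P1 : Pref k.-1 (take k.-1 w) by apply: Pref_take Pw; lia.
  have P2 : Pref k (take k w) by apply: Pref_take Pw; lia.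
  have /andP[_ h1] := f_bounds _ _ P1; have /andP[h2 _] := f_bounds _ _ P2.
  have := ratio_gt0 k ltac:(lia); nra.
by rewrite sumr_const_nat subn1 mulr_natl.
Qed.
(** * Balls and chains *)

Local Notation Lcomp := (Lcomp R m).
(* [L_k o ... o L_1 (n)] lies between [scale n * gamma_prod k] and
   [(scale n + scale_err) * gamma_prod k]. *)
Definition scale n : R := n%:R / gamma_prod 1.
Definition scale_err : R := d%:R / gamma_prod 1.

Lemma scale_ge0 n : 0 <= scale n.
Proof. by rewrite divr_ge0 // ltW // gamma_prod_gt0. Qed.

Lemma L_bounds k n : (2 <= k <= d)%N ->
  n%:R / gamma k <= (L R m k n)%:R <= n%:R / gamma k + 1.
Proof.
move=> hk; have g0 := gamma_gt0 k hk; rewrite /L leqNgt ifF; last by lia.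
have x0 : 0 <= n%:R / gamma k by rewrite divr_ge0 // ltW.
have c0 : 0 <= Num.ceil (n%:R / gamma k) by rewrite -(ler_int R) (le_trans x0) // ceil_ge.
rewrite natr_absz ger0_norm // ceil_ge /= -lerBlDr; apply/ltW.
by have := ceilB1_lt (n%:R / gamma k); rewrite rmorphB.
Qed.

Lemma LcompS k n : Lcomp k.+1 n = L R m k.+1 (Lcomp k n). Proof. by []. Qed.

Lemma Lcomp1 n : Lcomp 1 n = n. Proof. by []. Qed.

Lemma Lcomp_ge k n : (1 <= k <= d)%N -> scale n * gamma_prod k <= (Lcomp k n)%:R.
Proof.
case: k => // k; elim: k => [|k IH] hk.
  by rewrite Lcomp1 divfK // gt_eqF // gamma_prod_gt0.
have /andP[h _] := L_bounds k.+2 (Lcomp k.+1 n) ltac:(lia).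
have g0 := gamma_gt0 k.+2 ltac:(lia).
rewrite LcompS; apply: le_trans h; rewrite ler_pdivlMr //.
by rewrite -mulrA [_ * gamma _]mulrC -gamma_prodS; [apply: IH|]; lia.
Qed.

(** Each rounding adds at most 1, which is at most [gamma_prod k / gamma_prod 1], while earlier
    errors are divided by the next [gamma] along with the main term. *)
Lemma Lcomp_le k n : (1 <= k <= d)%N ->
  (Lcomp k n)%:R <= (scale n + k%:R / gamma_prod 1) * gamma_prod k.
Proof.
have G1 : 0 < gamma_prod 1 by rewrite gamma_prod_gt0.
case: k => // k; elim: k => [|k IH] hk.
  by rewrite Lcomp1 mulrDl !divfK ?gt_eqF // lerDl.
have /andP[_ h] := L_bounds k.+2 (Lcomp k.+1 n) ltac:(lia).
have g0 := gamma_gt0 k.+2 ltac:(lia).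
have G0 : 0 < gamma_prod k.+2 by rewrite gamma_prod_gt0.
rewrite LcompS; apply: le_trans h _.
have : (Lcomp k.+1 n)%:R / gamma k.+2 <= (scale n + k.+1%:R / gamma_prod 1) * gamma_prod k.+2.
  by rewrite ler_pdivrMr // -mulrA [_ * gamma _]mulrC -gamma_prodS; [apply: IH|]; lia.
move=> h; apply: le_trans (lerD h (lexx _)) _.
rewrite -[k.+2%:R]natr1 [(_ + 1) / _]mulrDl mul1r addrA [leRHS]mulrDl lerD2l.
by rewrite mulrC ler_pdivlMr // mul1r gamma_prod_le //; lia.
Qed.

Lemma L_homo k n n' : (2 <= k <= d)%N -> (n <= n')%N -> (L R m k n <= L R m k n')%N.
Proof.
move=> hk nn; have g0 := gamma_gt0 k hk; rewrite /L (_ : (k <= 1)%N = false); last by lia.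
have h0 j : 0 <= Num.ceil (j%:R / gamma k : R).
  by rewrite -(ler_int R) (@le_trans _ _ (j%:R / gamma k)) ?ceil_ge // divr_ge0 // ltW.
rewrite -lez_nat !gez0_abs // le_ceil //.
by rewrite ler_pM2r ?invr_gt0 // ler_nat.
Qed.

Lemma Lcomp_homo k n n' : (k <= d)%N -> (n <= n')%N -> (Lcomp k n <= Lcomp k n')%N.
Proof.
move=> + nn; elim: k => // k IH kd; rewrite !LcompS.
case: k IH kd => [//|k] IH kd; apply: L_homo; [lia | apply: IH; lia].
Qed.

Lemma Lcomp_leS k n : (k < d)%N -> (Lcomp k n <= Lcomp k.+1 n)%N.
Proof.
case: k => // k kd; rewrite -(ler_nat R) LcompS.
have /andP[h _] := L_bounds k.+2 (Lcomp k.+1 n) ltac:(lia).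
apply: le_trans h; rewrite ler_pdivlMr ?gamma_gt0 ?ler_piMr ?gamma_le1 //; lia.
Qed.

Lemma Lcomp_le_d k n : (k <= d)%N -> (Lcomp k n <= Lcomp d n)%N.
Proof.
move=> kd; rewrite -(subnKC kd); move: (d - k)%N (subnKC kd) => j; elim: j => [|j IH] e.
  by rewrite addn0.
rewrite addnS; apply: leq_trans (Lcomp_leS _ _ _); last by lia.
have : forall i, (k + i <= d)%N -> (Lcomp k n <= Lcomp (k + i) n)%N; last by apply; lia.
elim=> [|i IHi] hi; first by rewrite addn0.
rewrite addnS; apply: leq_trans (Lcomp_leS _ _ _); [apply: IHi|]; lia.
Qed.

Lemma thetaE j : (1 <= j)%N ->
  theta j = gamma_prod (comp_of (pair_ j)) / qr ^+ (pos_of (pair_ j)).-1.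
Proof.
move=> j1; have := p_comp_lt _ (wf_pair_ j j1).
rewrite /theta /theta_of /pos_of a_E; move: (comp_of _) (pair_ j).1 => k p kp.
have -> : p.-1 = (p_ k + (p - p_ k).-1)%N by lia.
have h n : qr ^+ n != 0 by rewrite gt_eqF.
by rewrite exprD invfM mulrACA divff // mul1r.
Qed.

(** The ball fixes coordinate [j] of the chain of [i] whenever [i] is below the threshold at
    [scale n]; by [le_of_known] it fixes none beyond the threshold at [scale n + scale_err]. *)
Lemma known_of_le n i j : (1 <= j)%N -> i%:R <= scale n * theta j ->
  (i * q ^ (pos_of (pair_ j)).-1 <= Lcomp (comp_of (pair_ j)) n)%N.
Proof.
move=> j1; have hc := comp_range _ (wf_pair_ j j1).
rewrite thetaE // mulrA ler_pdivlMr // => h.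
by rewrite -(ler_nat R) natrM natrX (le_trans h) // Lcomp_ge.
Qed.

Lemma le_of_known n i j : (1 <= j)%N ->
  (i * q ^ (pos_of (pair_ j)).-1 <= Lcomp (comp_of (pair_ j)) n)%N ->
  i%:R <= (scale n + scale_err) * theta j.
Proof.
move=> j1; have hc := comp_range _ (wf_pair_ j j1).
have G1 : 0 < gamma_prod 1 by rewrite gamma_prod_gt0.
rewrite thetaE // mulrA ler_pdivlMr // -(ler_nat R) natrM natrX => h.
apply: le_trans h _; apply: le_trans (Lcomp_le _ _ hc) _.
rewrite ler_pM2r ?gamma_prod_gt0 //; last by lia.
by rewrite lerD2l ler_pM2r ?invr_gt0 // ler_nat; lia.
Qed.

(* Since [theta] is nonincreasing, this is also the largest [j <= K] such that
   [i <= l * theta j], or [0] if there is none. *)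
Definition known (l : R) K i : nat := \sum_(1 <= j < K.+1) (i%:R <= l * theta j)%R.

Lemma known_le (l : R) K i : (known l K i <= K)%N.
Proof.
rewrite /known; apply: (@leq_trans (\sum_(1 <= j < K.+1) 1)).
  by apply: leq_sum => j _; case: (_ <= _).
by rewrite sum_nat_const_nat; lia.
Qed.

Lemma knownP (l : R) K i j : 0 <= l -> (1 <= j <= K)%N ->
  (j <= known l K i)%N = (i%:R <= l * theta j).
Proof.
move=> l0 hj.
have mono j1 j2 : (1 <= j1 <= j2)%N -> i%:R <= l * theta j2 -> i%:R <= l * theta j1.
  by move=> h h2; apply: le_trans h2 _; rewrite ler_wpM2l // theta_noninc.
apply/idP/idP => h.
  rewrite leNgt; apply/negP => hn; move: h; rewrite leqNgt => /negP; apply.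
  rewrite /known (@big_cat_nat _ _ _ j) /=; [|lia|lia].
  rewrite [X in (_ + X)%N]big_nat [X in (_ + X)%N]big1 ?addn0; last first.
    move=> k hk; case: (boolP (_ <= _)) => // /(mono j k); rewrite leNgt hn.
    by move=> /(_ ltac:(lia)).
  apply: (@leq_ltn_trans (\sum_(1 <= k < j) 1)%N).
    by apply: leq_sum => k _; case: (_ <= _).
  by rewrite sum_nat_const_nat; lia.
rewrite /known (@big_cat_nat _ _ _ j.+1) /=; [|lia|lia].
rewrite [X in (X + _)%N]big_nat [X in (X + _)%N](eq_bigr (fun=> 1%N)); last first.
  by move=> k hk; rewrite (mono k j) //; lia.
by rewrite -big_nat sum_nat_const_nat; lia.
Qed.

Context (P : probability (SigmaB d m) R).
Hypothesis PP : is_P_mu q mu P.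
Local Notation mP := (mass P).

Lemma mass_P_cyl u B : mP (cyl u B) =
  \prod_(i <- chain_starts q B) mmu (cyl (subsequence q u i) (chain_depth q B i)).
Proof.
transitivity (fine (\prod_(i <- chain_starts q B)
    mu (cyl (subsequence q u i) (trunc_log q (B %/ i)).+1))%E).
  by rewrite /mass PP /chain_starts big_filter.
have -> : (\prod_(i <- chain_starts q B)
     mu (cyl (subsequence q u i) (trunc_log q (B %/ i)).+1))%E =
   (\prod_(i <- chain_starts q B)
     mmu (cyl (subsequence q u i) (chain_depth q B i)))%:E.
  rewrite -prodEFin big_seq [RHS]big_seq; apply: eq_bigr => i.
  rewrite mem_chain_starts => /and3P[_ _ iB].
  by rewrite -mass_fin ?/chain_depth ?iB //; exact: measurable_cyl.
by [].
Qed.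

Definition chain_cyl (l : R) K (x : Sigma d m) i : set (Sigma d m) :=
  chi_cyl (chi_word (known l K i) (subsequence q x i)).

Lemma measurable_chain_cyl l K x i : msr (chain_cyl l K x i).
Proof. exact: measurable_chi_cyl. Qed.
Hint Resolve measurable_chain_cyl measurable_cyl : core.

Lemma prod_mass_word_sum (C : nat -> set (Sigma d m)) B : (forall i, msr (C i)) ->
  \prod_(i <- chain_starts q B) mmu (C i) = word_sum B (fun u =>
   \prod_(i <- chain_starts q B) mmu (C i `&` cyl (subsequence q u i) (chain_depth q B i))).
Proof.
move=> mC; rewrite (word_sum_prod q q_ge2 (fun i v r => mmu (C i `&` cyl v r))) //.
- by apply: eq_bigr => i _; rewrite cyl0 setIT.
- by move=> i v r; rewrite mass_cylS.
- by move=> i v w; rewrite !cyl0.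
Qed.

Lemma cball_prefix x n B : (Lcomp d n <= B)%N -> forall u v : Sigma d m,
  (forall i, (i < B)%N -> v i = u i) -> cball R x n u -> cball R x n v.
Proof.
move=> nB u v h hu k i hk hi; rewrite -(hu k i hk hi); apply: eq_digit; apply: h.
by have := Lcomp_le_d k n ltac:(lia); lia.
Qed.

(** For a word in the ball each factor is at most the one in [mass_P_cyl]. A word outside differs
    from [x] in some digit, which [key_surj] finds among the coordinates of its chain; there the
    factor vanishes. [l * theta K.+1 < 1] says that no chain has more than [K] coordinates at this
    scale, so that cutting at [K] drops none. *)
Lemma mass_P_ball_ge x n l K B : scale n + scale_err <= l -> l * theta K.+1 < 1 ->
  (Lcomp d n <= B)%N ->
  \prod_(i <- chain_starts q B) mmu (chain_cyl l K x i) <= mP (cball R x n).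
Proof.
move=> hl lK nB; rewrite prod_mass_word_sum //.
rewrite (mass_prefix P _ B (cball_prefix x n B nB)); apply: ler_word_sum => u.
have se0 : 0 <= scale_err by rewrite divr_ge0 // ltW // gamma_prod_gt0.
have l0 : 0 <= l by apply: le_trans hl; rewrite addr_ge0 // scale_ge0.
case: asboolP => [_|nu].
  rewrite mass_P_cyl; apply: ler_prod => i _; rewrite mass_ge0 /=.
  by apply: mass_le => //; exact: measurableI.
have [k [i [hk hi ne]]] : exists k i, [/\ (1 <= k <= d)%N, (1 <= i <= Lcomp k n)%N &
    digit u i k <> digit x i k].
  apply: contrapT => h; apply: nu => k i hk hi; apply: contrapT => ne.
  by apply: h; exists k, i.
have [i0 [l0' [h1 h2 e]]] := chain_decomp q q_ge2 i ltac:(lia).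
have [j [j1 jk jp]] := key_surj k l0'.+1 hk isT.
have kn : i0%:R <= l * theta j.
  apply: (@le_trans _ _ ((scale n + scale_err) * theta j)).
    by apply: le_of_known => //; rewrite jk jp /= -e; lia.
  by rewrite ler_pM2r // theta_gt0.
have jK : (j <= K)%N.
  rewrite leqNgt; apply/negP => Kj.
  have : 1 <= i0%:R :> R by rewrite ler1n.
  rewrite leNgt => /negP; apply; apply: le_lt_trans lK; apply: le_trans kn _.
  by rewrite ler_wpM2l // theta_noninc //; lia.
have jkn : (j <= known l K i0)%N by rewrite knownP // j1.
have iB : i0 \in chain_starts q B.
  rewrite mem_chain_starts h1 h2 /=; have := Lcomp_le_d k n ltac:(lia).
  have : (1 <= q ^ l0')%N by rewrite expn_gt0; lia.
  by nia.
rewrite (bigD1_seq i0) //=; last by rewrite filter_uniq // iota_uniq.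
rewrite (_ : _ `&` _ = set0) ?mass_set0 ?mul0r //; apply/seteqP; split=> // y [].
move=> /chi_cylE[_]; rewrite size_chi_word => ey /cylP hy; apply: ne.
have := congr1 (fun w => nth 0%N w j.-1) ey.
rewrite /= !nth_chi_word ?j1 // !chiE jk jp => ed.
have := hy l0'; rewrite chain_depthP // -e => hy'.
rewrite -(_ : digit y l0'.+1 k = digit u i k); last first.
  apply: eq_digit => /=; rewrite hy' /subsequence -?e //.
  by have := Lcomp_le_d k n ltac:(lia); lia.
by rewrite ed; apply: eq_digit; rewrite /subsequence /= -e.
Qed.

Lemma chain_cyl_ball x n K u i y B : cball R x n u -> (Lcomp d n <= B)%N ->
  (1 <= i)%N -> Omega y -> cyl (subsequence q u i) (chain_depth q B i) y ->
  chain_cyl (scale n) K x i y.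
Proof.
move=> xu nB i1 Oy /cylP hy; apply/chi_cylE; split=> //; rewrite size_chi_word.
apply/eq_in_map => j; rewrite mem_iota => hj; rewrite !chiE.
have j1 : (1 <= j)%N by lia.
have hc := comp_range _ (wf_pair_ j j1).
have hr := pos_range j j1.
have kn := known_of_le n i j j1.
have := knownP (scale n) K i j (scale_ge0 n).
have jK : (j <= K)%N by have := known_le (scale n) K i; lia.
rewrite j1 jK => /(_ isT) e; have {}kn := kn ltac:(rewrite -e; lia).
have Lk := Lcomp_le_d (comp_of (pair_ j)) n ltac:(lia).
have -> : digit y (pos_of (pair_ j)) (comp_of (pair_ j)) =
   digit u (i * q ^ (pos_of (pair_ j)).-1) (comp_of (pair_ j)).
  apply: eq_digit; rewrite hy // chain_depthP //; lia.
rewrite xu //; last first.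
by rewrite kn andbT muln_gt0 i1 expn_gt0; lia.
Qed.

(** Words outside the ball contribute nonnegative terms, and for those inside, the cylinder fixed by
    the word lies in [chain_cyl] up to a null set. Cutting at [K] only enlarges [chain_cyl], so [K]
    is arbitrary. *)
Lemma mass_P_ball_le x n K B : (Lcomp d n <= B)%N ->
  mP (cball R x n) <= \prod_(i <- chain_starts q B) mmu (chain_cyl (scale n) K x i).
Proof.
move=> nB; rewrite prod_mass_word_sum //.
rewrite (mass_prefix P _ B (cball_prefix x n B nB)); apply: ler_word_sum => u.
case: asboolP => [xu|_]; last by apply: prodr_ge0 => i _; exact: mass_ge0.
rewrite mass_P_cyl big_seq [leRHS]big_seq; apply: ler_prod => i.
rewrite mem_chain_starts => /and3P[_ i1 _]; rewrite mass_ge0 /=.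
rewrite -mass_Omega //; apply: mass_le; [exact: measurableI | exact: measurableI|].
by move=> y [hy Oy]; split=> //; exact: chain_cyl_ball hy.
Qed.
(** * Lower bounds for masses of balls *)

Definition chain_sum (x : Sigma d m) k (u : R) : R :=
  \sum_(i <- chain_starts q (Num.truncn u)) f_ (chi_word k (subsequence q x i)).

Lemma le_truncn (u : R) i : 0 <= u -> (i%:R <= u) = (i <= Num.truncn u)%N.
Proof. by move=> u0; rewrite truncn_ge_nat. Qed.

Lemma truncn_bounds (u : R) : 0 <= u -> (Num.truncn u)%:R <= u < (Num.truncn u)%:R + 1.
Proof. by move=> u0; rewrite natr1; exact: truncn_itv. Qed.

Lemma chain_starts_le (F : nat -> R) B (u : R) : 0 <= u -> (Num.truncn u <= B)%N ->
  \sum_(i <- chain_starts q B | i%:R <= u) F i =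
  \sum_(i <- chain_starts q (Num.truncn u)) F i.
Proof.
move=> u0 uB; rewrite /chain_starts big_filter_cond [RHS]big_filter.
rewrite [RHS](big_nat_widen _ _ B.+1); last by lia.
by apply: eq_bigl => i; rewrite le_truncn // ltnS.
Qed.

Lemma size_chain_starts M : (size (chain_starts q M) + M %/ q = M)%N.
Proof.
rewrite divn_count_dvd size_filter -sum1_count.
rewrite big_mkcond -big_split /= (eq_bigr (fun=> 1%N)).
  by rewrite sum_nat_const_nat muln1 subn1.
by move=> i _; case: (q %| i)%N.
Qed.

Lemma size_chain_starts_bounds M :
  cq * M%:R <= (size (chain_starts q M))%:R <= cq * M%:R + 1.
Proof.
have e : (size (chain_starts q M))%:R = M%:R - (M %/ q)%:R :> R.
  by rewrite -[in M%:R](size_chain_starts M) natrD addrK.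
have e1 : cq * M%:R = M%:R - M%:R / qr by rewrite /cq; field; rewrite gt_eqF.
have h1 : (M %/ q)%:R <= M%:R / qr by rewrite ler_pdivlMr // -natrM ler_nat leq_trunc_div.
have h2 : M%:R / qr <= (M %/ q)%:R + 1.
  rewrite ler_pdivrMr // natr1 -natrM ler_nat ltnW // ltn_ceil //; lia.
rewrite e e1; lra.
Qed.

Lemma size_chain_starts_real (u : R) : 0 <= u ->
  cq * u - 1 <= (size (chain_starts q (Num.truncn u)))%:R <= cq * u + 1.
Proof.
move=> u0; have /andP[h1 h2] := truncn_bounds u u0.
have /andP[h3 h4] := size_chain_starts_bounds (Num.truncn u).
have c0 := cq_gt0; have c1 : cq <= 1.
  by rewrite /cq ler_pdivrMr // mul1r gerBl.
by apply/andP; split; nra.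
Qed.

Lemma sum_known (a : nat -> R) l K i : 0 <= l ->
  \sum_(1 <= k < (known l K i).+1) a k =
  \sum_(1 <= k < K.+1) (if i%:R <= l * theta k then a k else 0).
Proof.
move=> l0; rewrite [RHS](@big_cat_nat _ _ _ (known l K i).+1) /=; [|lia| by rewrite ltnS known_le].
rewrite [X in _ = _ + X]big_nat [X in _ = _ + X]big1 ?addr0.
  rewrite big_nat [RHS]big_nat; apply: eq_bigr => k hk.
  by rewrite -(knownP l K) //; [case: leqP => //; lia | have := known_le l K i; lia].
move=> k hk; rewrite -(knownP l K) //; last by lia.
by case: leqP => //; lia.
Qed.

Lemma sum_Z_chains x l K B : 0 <= l -> (Num.truncn l <= B)%N ->
  \sum_(i <- chain_starts q B) Z_ (chi_word (known l K i) (subsequence q x i)) =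
  \sum_(1 <= k < K.+1) (chain_sum x k.-1 (l * theta k) - ratio k * chain_sum x k (l * theta k)).
Proof.
move=> l0 lB.
under eq_bigr => i _ do rewrite Z_chi_word sum_known //.
rewrite exchange_big /=; rewrite big_nat [RHS]big_nat; apply: eq_bigr => k hk.
have t0 := theta_gt0 k ltac:(lia); have t1 := theta_le1 k ltac:(lia).
rewrite -big_mkcond chain_starts_le ?(mulr_ge0 l0 (ltW t0)) //; last first.
  apply: leq_trans lB; rewrite -le_truncn //.
  by have /andP[h _] := truncn_bounds _ (mulr_ge0 l0 (ltW t0)); nra.
by rewrite sumrB -mulr_sumr.
Qed.

Section GoodPoint.
Context (x : Sigma d m).
Hypothesis xX : X_ q Omega x.
Local Notation F := (ln S_max).

Lemma f_chain_bounds i k M : i \in chain_starts q M ->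
  0 <= f_ (chi_word k (subsequence q x i)) <= F.
Proof.
rewrite mem_chain_starts => /and3P[h1 h2 _].
by apply: (f_bounds k); apply: Pref_chi_word; exact: xX.
Qed.

Lemma F_ge0 : 0 <= F.
Proof.
have /andP[h1 h2] := f_chain_bounds 1 0 1 ltac:(by rewrite mem_chain_starts dvdn1; lia).
exact: le_trans h2.
Qed.

Lemma chain_sum_bound k (u : R) : 0 <= u -> 0 <= chain_sum x k u <= F * u.
Proof.
move=> u0; have /andP[h1 h2] := truncn_bounds u u0; apply/andP; split.
  by rewrite /chain_sum big_seq; apply: sumr_ge0 => i /(f_chain_bounds i k) /andP[].
apply: (@le_trans _ _ (\sum_(i <- chain_starts q (Num.truncn u)) F)).
  by rewrite /chain_sum big_seq [leRHS]big_seq; apply: ler_sum => i /(f_chain_bounds i k) /andP[].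
rewrite big_const_seq count_predT iter_addr_0 -mulr_natr ler_wpM2l ?F_ge0 //.
apply: le_trans h1; rewrite ler_nat.
by rewrite -[leqRHS](size_chain_starts (Num.truncn u)) leq_addr.
Qed.

Lemma chain_sum_incr k (u v : R) : 0 <= u <= v ->
  0 <= chain_sum x k v - chain_sum x k u <= F * (v - u + 1).
Proof.
move=> /andP[u0 uv]; have v0 := le_trans u0 uv.
have /andP[h1 h2] := truncn_bounds u u0; have /andP[h3 h4] := truncn_bounds v v0.
have uvn : (Num.truncn u <= Num.truncn v)%N by rewrite -le_truncn // (le_trans h1).
have -> : chain_sum x k v - chain_sum x k u = \sum_(i <- chain_starts q (Num.truncn v) |
    ~~ (i%:R <= u)) f_ (chi_word k (subsequence q x i)).
  rewrite /chain_sum -(chain_starts_le _ (Num.truncn v) u) //.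
  by rewrite (bigID (fun i => i%:R <= u)) /= addrC addrK.
apply/andP; split.
  by rewrite big_seq_cond; apply: sumr_ge0 => i /andP[/(f_chain_bounds i k) /andP[]].
apply: (@le_trans _ _ (\sum_(i <- chain_starts q (Num.truncn v) | ~~ (i%:R <= u)) F)).
  rewrite big_seq_cond [leRHS]big_seq_cond.
  by apply: ler_sum => i /andP[/(f_chain_bounds i k) /andP[]].
rewrite big_const_seq iter_addr_0 -mulr_natr ler_wpM2l ?F_ge0 //.
apply: (@le_trans _ _ (Num.truncn v - Num.truncn u)%:R); last first.
  by rewrite natrB //; lra.
rewrite ler_nat /chain_starts count_filter.
apply: (@leq_trans (count (fun i => Num.truncn u < i)%N (index_iota 1 (Num.truncn v).+1))).
  by apply: sub_count => i /= /andP[]; rewrite le_truncn // -ltnNge.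
rewrite -sum1_count (@big_cat_nat _ _ _ (Num.truncn u).+1) //=.
rewrite big_nat_cond big1 ?add0n; last by move=> i; lia.
apply: (@leq_trans (\sum_((Num.truncn u).+1 <= i < (Num.truncn v).+1) 1)).
  by rewrite big_mkcond /=; apply: leq_sum => i _; case: ifP.
by rewrite sum_nat_const_nat; lia.
Qed.

(** Averaging is applied to the sum over [k <= K], not to each [k], so that one scale [l = rho^j]
    serves all of them. [avg_le_often] yields arbitrarily large such scales, which is what a lower
    limit calls for. *)
Lemma ball_mass_often (e : R) n0 : 0 < e -> exists2 n, (n0 <= n)%N &
  expR (- ((cq * f_ [::] + e) * (Lcomp d n)%:R)) <= mP (cball R x n).
Proof.
move=> e0.
have F0 := F_ge0.
have G1 : 0 < gamma_prod 1 by rewrite gamma_prod_gt0.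
have se0 : 0 <= scale_err by rewrite divr_ge0 // ltW.
(* Of the allowance [e], one sixth goes to the terms beyond [K], one sixth to the averaged ones, and
   a half to the constants [f_ [::]] and [X * c1]; [F + 1] avoids division by 0. *)
have [K K1 hK] := sum_theta_small (e / (6 * (F + 1))) ltac:(rewrite divr_gt0 //; lra).
pose eta : R := e / (48 * (F + 1) * K%:R).
have K0 : 0 < K%:R :> R by rewrite ltr0n.
have eta0 : 0 < eta by rewrite divr_gt0 // !mulr_gt0 //; lra.
pose rho := 1 + eta.
have rho1 : 1 < rho by rewrite ltrDl.
pose D k j := theta k.+1 *
  (chain_sum x k (rho ^+ j * theta k.+1) / (rho ^+ j * theta k.+1) -
   chain_sum x k (rho ^+ j * theta k) / (rho ^+ j * theta k)).
have avgD : avg_le (fun j => \sum_(1 <= k < K.+1) D k j)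
   (\sum_(1 <= k < K.+1) theta k.+1 * (2 * F * (rho - 1 + eta))).
  apply: avg_le_sum => k hk; have t0 := theta_gt0 k.+1 isT.
  apply: avg_le_scale; first exact: ltW.
  apply: (avg_le_diff _ F (chain_sum_bound k) (chain_sum_incr k)) => //.
    by rewrite t0 theta_S //; nat_lia.
  by apply: theta_le1; nat_lia.
have cD : \sum_(1 <= k < K.+1) theta k.+1 * (2 * F * (rho - 1 + eta)) < e / 6.
  apply: (@le_lt_trans _ _ (\sum_(1 <= k < K.+1) 2 * F * (rho - 1 + eta))).
    apply: ler_sum => k _; rewrite ler_piMl ?theta_le1 // !mulr_ge0 //.
    by rewrite /rho; lra.
  rewrite sumr_const_nat subn1 -[_ *+ K]mulr_natl /rho.
  have -> : K%:R * (2 * F * (1 + eta - 1 + eta)) = (F / (F + 1)) * (e / 12).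
    by rewrite /eta; field; rewrite !gt_eqF //; lra.
  have : F / (F + 1) <= 1 by rewrite ler_pdivrMr; lra.
  by nra.
pose c1 := scale_err + (gamma_prod 1)^-1.
pose X := cq * f_ [::] + e.
have f0 : 0 <= f_ [::].
  have /andP[] := f_chain_bounds 1 0 1 ltac:(by rewrite mem_chain_starts dvdn1; nat_lia).
  by rewrite /chi_word.
have X0 : 0 <= X by apply: addr_ge0 (ltW e0); apply: mulr_ge0 f0; exact: ltW cq_gt0.
have [j0 hj0] := expr_unbounded rho (c1 + n0%:R / gamma_prod 1 + (f_ [::] + X * c1) / (e / 2)) rho1.
have [j jj0 hj] := avg_le_often _ _ _ j0 cD avgD.
have {hj0} hl := hj0 j jj0; set l := rho ^+ j in hl hj.
have c10 : 0 <= c1 by rewrite addr_ge0 // invr_ge0 ltW.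
have Y0 : 0 <= (f_ [::] + X * c1) / (e / 2) by rewrite divr_ge0 ?addr_ge0 ?mulr_ge0 //; lra.
have n00 : 0 <= n0%:R / gamma_prod 1 by rewrite divr_ge0 // ltW.
have l0 : 0 < l by lra.
pose v := (l - scale_err) * gamma_prod 1.
have c1E : c1 = scale_err + (gamma_prod 1)^-1 by [].
have iG : 0 <= (gamma_prod 1)^-1 by rewrite invr_ge0 ltW.
have v0 : 0 <= v by apply: mulr_ge0 (ltW G1); rewrite subr_ge0; lra.
pose n := Num.truncn v.
have /andP[nv1 nv2] := truncn_bounds v v0.
have sn1 : scale n + scale_err <= l by rewrite -lerBrDr /scale ler_pdivrMr.
have sn2 : l - c1 <= scale n.
  rewrite /scale ler_pdivlMr // /c1.
  have -> : (l - (scale_err + (gamma_prod 1)^-1)) * gamma_prod 1 = v - 1.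
    by rewrite /v; field; rewrite gt_eqF.
  by rewrite lerBlDr ltW.
have nn0 : (n0 <= n)%N.
  rewrite -(ler_nat R) -(ler_pM2r (x := (gamma_prod 1)^-1)) ?invr_gt0 //.
  apply: le_trans sn2; lra.
exists n => //.
(* The number [K2] of coordinates grows with [l], while [K] was fixed beforehand; hence a bound on
   the tail that is uniform in its upper end. *)
have [K' K'1 hK'] := theta_small l^-1 ltac:(by rewrite invr_gt0).
have [K2 [KK2 K'K2]] : exists K2, (K < K2)%N /\ (K' <= K2)%N.
  by exists (maxn K K').+1; rewrite ltnS leq_maxl (leq_trans (leq_maxr K K')).
have lK2 : l * theta K2.+1 < 1.
  rewrite -ltr_pdivlMl // mulr1; apply: le_lt_trans hK'; by apply: theta_noninc; rewrite K'1 leqW.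
pose B := maxn (Lcomp d n) (Num.truncn l).
apply: le_trans (mass_P_ball_ge x n l K2 B sn1 lK2 (leq_maxl _ _)).
have -> : \prod_(i <- chain_starts q B) mmu (chain_cyl l K2 x i) =
   expR (- \sum_(i <- chain_starts q B) Z_ (chi_word (known l K2 i) (subsequence q x i))).
  rewrite -sumrN expR_sum big_seq [RHS]big_seq; apply: eq_bigr => i.
  rewrite mem_chain_starts => /and3P[h1 h2 _].
  apply: (mass_chi_cyl (known l K2 i)); apply: Pref_chi_word; exact: xX.
rewrite ler_expR lerN2 sum_Z_chains ?(ltW l0) //; last exact: leq_maxr.
have sB k u : 0 <= u -> 0 <= chain_sum x k u by move=> /(chain_sum_bound k) /andP[].
have tl k : (1 <= k)%N -> 0 < l * theta k by move=> k1; rewrite mulr_gt0 // theta_gt0.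
(* Shifting the index pairs the sums of the same [f] over the ranges [l * theta k.+1] and
   [l * theta k]; the added term [k = K2] is nonnegative. *)
have step1 : \sum_(1 <= k < K2.+1) (chain_sum x k.-1 (l * theta k) - ratio k * chain_sum x k (l * theta k))
   <= chain_sum x 0 l + \sum_(1 <= k < K2.+1)
      (chain_sum x k (l * theta k.+1) - ratio k * chain_sum x k (l * theta k)).
  have e1 : \sum_(1 <= k < K2.+1) chain_sum x k.-1 (l * theta k) =
      chain_sum x 0 l + \sum_(1 <= k < K2) chain_sum x k (l * theta k.+1).
    by rewrite big_ltn; [rewrite theta_1 mulr1 big_add1 | nat_lia].
  rewrite !sumrB addrA lerD2r e1 lerD2l [leRHS]big_nat_recr /=; last by nat_lia.
  by rewrite lerDl; apply: sB; apply/ltW/tl; nat_lia.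
have step2 : \sum_(K.+1 <= k < K2.+1) (chain_sum x k (l * theta k.+1) - ratio k * chain_sum x k (l * theta k))
    <= l * (e / 6).
  apply: (@le_trans _ _ (\sum_(K.+1 <= k < K2.+1) F * l * theta k)).
    rewrite big_nat [leRHS]big_nat; apply: ler_sum => k hk.
    have /andP[_ h1] := chain_sum_bound k (l * theta k.+1) ltac:(by apply/ltW/tl; nat_lia).
    have h2 := sB k (l * theta k) ltac:(by apply/ltW/tl; nat_lia).
    have h3 := ratio_gt0 k ltac:(nat_lia); have h4 := theta_S k ltac:(nat_lia).
    have : F * (l * theta k.+1) <= F * l * theta k by rewrite mulrA ler_wpM2l // mulr_ge0 // ltW.
    have : 0 <= ratio k * chain_sum x k (l * theta k) by rewrite mulr_ge0 // ltW.
    by lra.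
  rewrite -mulr_sumr.
  have h1 : \sum_(K.+1 <= k < K2.+1) theta k <= e / (6 * (F + 1)).
    apply: le_trans (hK K2.+1); rewrite [leRHS]big_ltn ?lerDr; last by nat_lia.
    by apply/ltW/theta_gt0; nat_lia.
  apply: le_trans (ler_wpM2l _ h1) _; first by rewrite mulr_ge0 // ltW.
  have -> : F * l * (e / (6 * (F + 1))) = (F / (F + 1)) * (l * (e / 6)).
    by field; rewrite gt_eqF //; lra.
  rewrite ler_piMl ?mulr_ge0 ?(ltW l0) ?ler_pdivrMr //; lra.
have step3 : \sum_(1 <= k < K.+1) (chain_sum x k (l * theta k.+1) - ratio k * chain_sum x k (l * theta k))
    = l * \sum_(1 <= k < K.+1) D k j.
  rewrite mulr_sumr big_nat [RHS]big_nat; apply: eq_bigr => k hk.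
  have h1 := theta_gt0 k ltac:(nat_lia); have h2 := theta_gt0 k.+1 ltac:(nat_lia).
  rewrite /D -/l /ratio; move: (chain_sum _ _ _) (chain_sum _ _ _) => y z.
  by field; rewrite !gt_eqF.
have step4 : chain_sum x 0 l <= f_ [::] * (cq * l + 1).
  rewrite /chain_sum (eq_bigr (fun=> f_ [::])) // big_const_seq count_predT iter_addr_0.
  rewrite -mulr_natr ler_wpM2l //; have := size_chain_starts_real l (ltW l0); lra.
have hL : l - c1 <= (Lcomp d n)%:R.
  by apply: le_trans sn2 _; have := Lcomp_ge d n ltac:(nat_lia); rewrite gamma_prodd mulr1.
apply: le_trans step1 _; rewrite (@big_cat_nat _ _ _ K.+1) /=; [|nat_lia|nat_lia].
rewrite step3.
apply: (@le_trans _ _ (X * (l - c1))); last by rewrite ler_wpM2l.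
have : l * \sum_(1 <= k < K.+1) D k j <= l * (e / 6) by rewrite ler_pM2l.
have : (f_ [::] + X * c1) / (e / 2) <= l by lra.
rewrite ler_pdivrMr; last by lra.
rewrite /X; move: (\sum_(1 <= k < K.+1) D k j) step2 step4 => S1.
move: (\sum_(_ <= _ < _) _) => S2 step2 step4 h1 h2.
by nra.
Qed.
End GoodPoint.
(** * The mass of heavy balls *)

Fixpoint pref_sum j (F : seq nat -> R) : R :=
  if j is j'.+1 then pref_sum j' (ext_sum F) else F [::].

Lemma ler_pref_sum j (F G : seq nat -> R) :
  (forall w, Pref j w -> F w <= G w) -> Omega !=set0 -> pref_sum j F <= pref_sum j G.
Proof.
move=> + [y0 Oy0]; elim: j F G => [|j IH] F G h /=; first by apply: h; exists y0.
apply: IH => w Pw; apply: ler_ext_sum => X; rewrite (Pref_size _ _ Pw); exact: h.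
Qed.

Lemma eq_pref_sum j (F G : seq nat -> R) : Omega !=set0 ->
  (forall w, Pref j w -> F w = G w) -> pref_sum j F = pref_sum j G.
Proof.
by move=> O0 h; apply/eqP; rewrite eq_le !ler_pref_sum // => w /h ->.
Qed.

Lemma pref_sumD j (F G : seq nat -> R) :
  pref_sum j (fun w => F w + G w) = pref_sum j F + pref_sum j G.
Proof.
elim: j F G => //= j IH F G; rewrite -IH; congr pref_sum.
by apply/funext => w; rewrite /ext_sum big_split.
Qed.

Lemma pref_sumZ j (c : R) (F : seq nat -> R) :
  pref_sum j (fun w => c * F w) = c * pref_sum j F.
Proof.
elim: j F => //= j IH F; rewrite -IH; congr pref_sum.
by apply/funext => w; rewrite /ext_sum mulr_sumr.
Qed.

Lemma pref_sum_exchange j (I : finType) (F : I -> seq nat -> R) :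
  \sum_a pref_sum j (F a) = pref_sum j (fun w => \sum_a F a w).
Proof.
elim: j F => //= j IH F; rewrite IH; congr pref_sum.
by apply/funext => w; rewrite /ext_sum exchange_big.
Qed.

Lemma pref_sum_ge j (F : seq nat -> R) w : (forall v, Pref j v -> 0 <= F v) ->
  Pref j w -> F w <= pref_sum j F.
Proof.
elim: j F w => [|j IH] F w F0 Pw /=; first by rewrite (size0nil (Pref_size _ _ Pw)).
have [y Oy ew] := Pw.
have {}ew : w = rcons (chi_word j y) (chi j.+1 y) by rewrite -chi_wordS -ew.
have Pv := Pref_chi_word j y Oy.
apply: (@le_trans _ _ (ext_sum F (chi_word j y))).
  rewrite ew; apply: ext_sum_ge; rewrite size_chi_word; first by move=> Y; exact: F0.
  by rewrite -ew.
apply: IH => // v Pv'; apply: sumr_ge0 => X /asboolP.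
by rewrite (Pref_size _ _ Pv'); exact: F0.
Qed.

Lemma pref_sum_mass j A : msr A -> pref_sum j (fun w => mmu (A `&` chi_cyl w)) = mmu A.
Proof.
move=> mA; elim: j => [|j IH] /=; first by rewrite chi_cyl_nil mass_Omega.
rewrite -[RHS]IH; congr pref_sum; apply/funext => w; by rewrite mass_chi_cylS.
Qed.

Hypothesis Omega_neq0 : Omega !=set0.
Local Notation F := (ln S_max).

(** [Z_] being minus the logarithm of the mass, this is the Shannon entropy of the partition of
    [Omega] into cylinders of [j] coordinates. *)
Definition entropy j := pref_sum j (fun w => mmu (chi_cyl w) * Z_ w).
Definition mean_f j := pref_sum j (fun w => mmu (chi_cyl w) * f_ w).

Lemma entropy0 : entropy 0 = 0.
Proof. by rewrite /entropy /= /Z_ /= big_geq // mulr0. Qed.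

Lemma mean_f0 : mean_f 0 = f_ [::].
Proof. by have [mO _] := muP; rewrite /mean_f /= chi_cyl_nil /mass mO /= mul1r. Qed.

Lemma pref_sum_mu j : pref_sum j (fun w => mmu (chi_cyl w)) = 1.
Proof.
rewrite -(massT mu) -(pref_sum_mass j setT (@measurableT _ _)); congr pref_sum.
by apply/funext => w; rewrite setTI.
Qed.

Lemma mean_f_bounds j : 0 <= mean_f j <= F.
Proof.
have h w : Pref j w -> 0 <= mmu (chi_cyl w) * f_ w <= F * mmu (chi_cyl w).
  move=> /f_bounds /andP[h1 h2]; rewrite mulr_ge0 ?mass_ge0 //= mulrC.
  by rewrite ler_wpM2r ?mass_ge0.
apply/andP; split.
  rewrite -[leLHS](mul0r (pref_sum j (fun=> 0))) -pref_sumZ.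
  by apply: ler_pref_sum => // w /h /andP[h1 _]; rewrite mul0r.
rewrite -[leRHS]mulr1 -(pref_sum_mu j) -pref_sumZ.
by apply: ler_pref_sum => // w /h /andP[].
Qed.

Lemma entropyS j : entropy j.+1 = entropy j + (mean_f j - ratio j.+1 * mean_f j.+1).
Proof.
rewrite /entropy /mean_f /= -mulNr -!pref_sumZ -!pref_sumD; apply: eq_pref_sum => // w Pw.
have mw : ext_sum (fun v => mmu (chi_cyl v)) w = mmu (chi_cyl w).
  have := mass_chi_cylS setT w (@measurableT _ _); rewrite setTI => ->.
  by apply: eq_ext_sum => X _; rewrite setTI.
rewrite (eq_ext_sum _ (fun v => mmu (chi_cyl v) * (Z_ w + f_ w)
   - ratio j.+1 * (mmu (chi_cyl v) * f_ v))); last first.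
  by move=> X PX; rewrite Z_rcons (Pref_size _ _ Pw); ring.
rewrite /ext_sum sumrB -mulr_suml -mulr_sumr.
rewrite -/(ext_sum (fun v => mmu (chi_cyl v)) w) mw.
by rewrite -/(ext_sum (fun v => mmu (chi_cyl v) * f_ v) w); ring.
Qed.

(** From [expR z >= 1 + z] and [(1 - z + z^2) * (1 + z) = 1 + z^3]. *)
Lemma expR_quadratic (z : R) : 0 <= z -> expR (- z) <= 1 - z + z ^+ 2.
Proof.
move=> z0; rewrite expRN -[leLHS]mul1r ler_pdivrMr ?expR_gt0 //.
have h := expR_ge1Dx z; have h2 : 0 <= 1 - z + z ^+ 2 by nra.
apply: le_trans (ler_wpM2l h2 h); nra.
Qed.

(** Second-order expansion: the linear term gives the entropy, and the quadratic one is bounded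
    because at most [K] coordinates keep [Z_] below [K * F]. This is the use of the cut-off [K]. *)
Lemma moment_le j K (l : R) : (j <= K)%N -> 0 <= l ->
  pref_sum j (fun w => expR (- (l * Z_ w)) * mmu (chi_cyl w)) <=
  expR (- (l * entropy j) + l ^+ 2 * (K%:R * F) ^+ 2).
Proof.
move=> jK l0; apply: le_trans (expR_ge1Dx _).
pose C := (K%:R * F) ^+ 2.
apply: (@le_trans _ _ (pref_sum j (fun w => (1 + l ^+ 2 * C) * mmu (chi_cyl w)
   + (- l) * (mmu (chi_cyl w) * Z_ w)))); last first.
  by rewrite pref_sumD !pref_sumZ pref_sum_mu -/(entropy j) /C; lra.
apply: ler_pref_sum => // w Pw.
have z0 := Z_ge0 j w Pw.
have F0 : 0 <= F by have := mean_f_bounds 0; lra.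
have zK : Z_ w <= K%:R * F.
  by apply: le_trans (Z_le j w Pw) _; rewrite ler_wpM2r // ler_nat.
have h := expR_quadratic (l * Z_ w) (mulr_ge0 l0 z0).
have h2 : (l * Z_ w) ^+ 2 <= l ^+ 2 * C.
  by rewrite exprMn ler_wpM2l ?sqr_ge0 // /C lerXn2r ?nnegrE // mulr_ge0.
have m0 := mass_ge0 mu (chi_cyl w).
have : expR (- (l * Z_ w)) * mmu (chi_cyl w) <=
       (1 - l * Z_ w + l ^+ 2 * C) * mmu (chi_cyl w) by rewrite ler_wpM2r //; lra.
by move=> {}h; apply: le_trans h _; lra.
Qed.

(** Here the mean of [f] is the same for all chains, so the main terms telescope without averaging
    over scales. Each of the [K] counts of chains differs by at most 1 from [cq * l * theta k] and
    multiplies a number between [-F] and [F]. *)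
Lemma sum_entropy_ge l K B : 0 <= l -> (Num.truncn l <= B)%N ->
  cq * l * (f_ [::] - theta K.+1 * F) - K%:R * F <=
  \sum_(i <- chain_starts q B) entropy (known l K i).
Proof.
move=> l0 lB.
have tele i : entropy (known l K i) =
    \sum_(1 <= k < (known l K i).+1) (mean_f k.-1 - ratio k * mean_f k).
  move: (known l K i); elim=> [|j IH]; first by rewrite entropy0 big_geq.
  by rewrite entropyS IH [RHS]big_nat_recr.
under eq_bigr => i _ do rewrite tele sum_known //.
rewrite exchange_big /=.
have F0 : 0 <= F by have := mean_f_bounds 0; lra.
have term k : (1 <= k < K.+1)%N ->
   cq * l * (theta k * mean_f k.-1 - theta k.+1 * mean_f k) - F <=
   \sum_(i <- chain_starts q B) (if i%:R <= l * theta k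
       then mean_f k.-1 - ratio k * mean_f k else 0).
  move=> hk; have t0 := theta_gt0 k ltac:(nat_lia); have t1 := theta_le1 k ltac:(nat_lia).
  have lt0 : 0 <= l * theta k := mulr_ge0 l0 (ltW t0).
  rewrite -big_mkcond chain_starts_le //; last first.
    apply: leq_trans lB; rewrite -le_truncn //.
    by have /andP[h _] := truncn_bounds _ lt0; nra.
  rewrite big_const_seq count_predT iter_addr_0 -mulr_natr.
  have /andP[s1 s2] := size_chain_starts_real _ lt0.
  have r0 := ratio_gt0 k ltac:(nat_lia); have r1 := ratio_le1 k ltac:(nat_lia).
  have e : theta k.+1 = ratio k * theta k by rewrite /ratio divfK // gt_eqF.
  rewrite e; have := mean_f_bounds k.-1; have := mean_f_bounds k.
  move: (size _)%:R s1 s2 (mean_f k) (mean_f k.-1) => s s1 s2 a b /andP[a0 aF] /andP[b0 bF].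
  have -> : cq * l * (theta k * b - ratio k * theta k * a) =
     (cq * (l * theta k)) * (b - ratio k * a) by ring.
  move: (cq * (l * theta k)) s1 s2 => c s1 s2.
  have h1 : - F <= b - ratio k * a by nra.
  have h2 : b - ratio k * a <= F by have := mulr_ge0 (ltW r0) a0; lra.
  move: (b - ratio k * a) h1 h2 => y h1 h2.
  have : (s - c) * y >= - F.
    have : `|(s - c) * y| <= F.
      rewrite normrM -[leRHS]mul1r ler_pM //; rewrite ler_norml; lra.
    by rewrite ler_norml => /andP[].
  by lra.
apply: (@le_trans _ _ (\sum_(1 <= k < K.+1)
   (cq * l * (theta k * mean_f k.-1 - theta k.+1 * mean_f k) - F))); last first.
  by rewrite [leLHS]big_nat [leRHS]big_nat; apply: ler_sum => k hk; exact: term.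
rewrite sumrB sumr_const_nat subn1 /= -[F *+ K]mulr_natl -mulr_sumr lerD2r.
have -> : \sum_(1 <= i < K.+1) (theta i * mean_f i.-1 - theta i.+1 * mean_f i) =
    f_ [::] - theta K.+1 * mean_f K.
  elim: (K) => [|j IH]; first by rewrite big_geq // theta_1 mean_f0 mul1r subrr.
  by rewrite big_nat_recr //= IH; ring.
apply: ler_wpM2l; first exact: mulr_ge0 (ltW cq_gt0) l0.
rewrite lerD2l lerN2; apply: ler_wpM2l; first exact: ltW (theta_gt0 _ _).
by have /andP[] := mean_f_bounds K.
Qed.

Definition bad_set (c : R) n : set (Sigma d m) :=
  [set u | expR (- (c * (Lcomp d n)%:R)) < mP (cball R u n)].

Lemma cball_eq (u v : Sigma d m) n : cball R u n v -> cball R v n = cball R u n.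
Proof.
move=> uv; apply/seteqP; split=> y h k i hk hi; first by rewrite h // uv.
by rewrite h // uv.
Qed.

Lemma cball_refl (u : Sigma d m) n : cball R u n u. Proof. by []. Qed.

Lemma bad_set_prefix c n (u v : Sigma d m) :
  (forall i, (i < Lcomp d n)%N -> v i = u i) -> bad_set c n u -> bad_set c n v.
Proof.
move=> h; rewrite /bad_set /= (cball_eq u v) //.
exact: (cball_prefix u n _ (leqnn _) u v h).
Qed.

(* Markov's inequality for the moment of order [l] of the product over the chains of
   the masses [mmu (chain_cyl (scale n) K u i)], which bounds [mP (cball R u n)]. *)
Lemma mass_bad_le c n K (l : R) : 0 <= l ->
  mP (bad_set c n) <= expR (l * (c * (Lcomp d n)%:R)
   - l * (\sum_(i <- chain_starts q (Lcomp d n)) entropy (known (scale n) K i))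
   + (l ^+ 2 * (K%:R * F) ^+ 2) * (Lcomp d n)%:R).
Proof.
move=> l0; set B := Lcomp d n; pose J i := known (scale n) K i.
(* The moment for one chain restricted to a cylinder: additive in the next letter, so that
   [word_sum_prod] applies. *)
pose nu i (v : Sigma d m) r :=
  pref_sum (J i) (fun w => expR (- (l * Z_ w)) * mmu (chi_cyl w `&` cyl v r)).
have nu0 i v w : nu i v 0%N = nu i w 0%N by rewrite /nu !cyl0.
have nuS i v r : \sum_a nu i (upd v r a) r.+1 = nu i v r.
  rewrite pref_sum_exchange; congr pref_sum; apply/funext => w.
  by rewrite -mulr_sumr mass_cylS.
have C0 : 0 <= l ^+ 2 * (K%:R * F) ^+ 2 by rewrite mulr_ge0 // sqr_ge0.
have step : mP (bad_set c n) <= expR (l * (c * B%:R)) *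
    \prod_(i <- chain_starts q B) nu i point 0%N.
  rewrite -(word_sum_prod q q_ge2 nu B B) // -word_sumZ.
  rewrite (mass_prefix P _ B (bad_set_prefix c n)); apply: ler_word_sum => u.
  have nu_ge0 i v r : 0 <= nu i v r.
    rewrite -[leLHS](mul0r (pref_sum (J i) (fun=> 0))) -pref_sumZ.
    by apply: ler_pref_sum => // w _; rewrite mul0r mulr_ge0 ?expR_ge0 ?mass_ge0.
  case: asboolP => [bu|_]; last by rewrite mulr_ge0 ?expR_ge0 // prodr_ge0.
  have bq := lt_le_trans bu (mass_P_ball_le u n K B (leqnn _)).
  pose w i := chi_word (J i) (subsequence q u i).
  (* A bad [u] need not lie in [X_Omega], but its product of masses is positive, so that no factor
     vanishes and the words are prefixes of [Omega]. *)
  have Pw i : i \in chain_starts q B -> Pref (J i) (w i).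
    move=> iB; have : chain_cyl (scale n) K u i !=set0.
      apply/set0P/negP => /eqP e; move: bq.
      rewrite (bigD1_seq i) //=; last by rewrite filter_uniq // iota_uniq.
      by rewrite e mass_set0 mul0r ltNge expR_ge0.
    by move=> [y /chi_cyl_Pref]; rewrite size_chi_word.
  have ez : \prod_(i <- chain_starts q B) mmu (chain_cyl (scale n) K u i) =
      expR (- \sum_(i <- chain_starts q B) Z_ (w i)).
    rewrite -sumrN expR_sum big_seq [RHS]big_seq; apply: eq_bigr => i iB.
    exact: mass_chi_cyl (Pw i iB).
  rewrite ez ltr_expR ltrN2 in bq.
  rewrite mass_P_cyl.
  (* On the bad set the sum of the [Z_] is below [c * B], so the exponential weight is at least
     1. *)
  apply: (@le_trans _ _ (expR (l * (c * B%:R)) * \prod_(i <- chain_starts q B)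
     (expR (- (l * Z_ (w i))) * mmu (cyl (subsequence q u i) (chain_depth q B i))))).
    rewrite big_split /= -expR_sum [leRHS]mulrA -expRD -[leLHS]mul1r ler_wpM2r //.
      by apply: prodr_ge0 => i _; exact: mass_ge0.
    apply: le_trans (expR_ge1Dx _); rewrite lerDl sumrN -mulr_sumr -mulrBr mulr_ge0 //.
    by rewrite subr_ge0 ltW.
  rewrite ler_wpM2l ?expR_ge0 // big_seq [leRHS]big_seq; apply: ler_prod => i iB.
  rewrite mulr_ge0 ?expR_ge0 ?mass_ge0 //=.
  have i1 : (1 <= i)%N by move: iB; rewrite mem_chain_starts => /and3P[].
  apply: (@le_trans _ _ (expR (- (l * Z_ (w i))) *
     mmu (chi_cyl (w i) `&` cyl (subsequence q u i) (chain_depth q B i)))).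
    rewrite ler_wpM2l ?expR_ge0 // -mass_Omega //.
    apply: mass_le; [exact: measurableI | exact: measurableI|].
    move=> y [hy Oy]; split=> //.
    exact: (chain_cyl_ball u n K u i y B (cball_refl u n) (leqnn _) i1 Oy hy).
  apply: (pref_sum_ge (J i) (fun w => expR (- (l * Z_ w)) *
     mmu (chi_cyl w `&` cyl (subsequence q u i) (chain_depth q B i)))).
    by move=> v _; rewrite mulr_ge0 ?expR_ge0 ?mass_ge0.
  exact: Pw.
apply: le_trans step _; rewrite -addrA expRD ler_wpM2l ?expR_ge0 //.
apply: (@le_trans _ _ (\prod_(i <- chain_starts q B)
   expR (- (l * entropy (J i)) + l ^+ 2 * (K%:R * F) ^+ 2))).
  apply: ler_prod => i _; apply/andP; split.
    rewrite -[leLHS](mul0r (pref_sum (J i) (fun=> 0))) -pref_sumZ.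
    by apply: ler_pref_sum => // w _; rewrite mul0r mulr_ge0 ?expR_ge0 ?mass_ge0.
  apply: le_trans (moment_le (J i) K l (known_le _ _ _) l0).
  apply: ler_pref_sum => // w _; by rewrite cyl0 setIT.
rewrite -expR_sum ler_expR big_split /= sumrN -mulr_sumr lerD2l.
rewrite big_const_seq count_predT iter_addr_0 -[_ *+ size _]mulr_natr ler_wpM2l // ler_nat.
by rewrite -[leqRHS](size_chain_starts B) leq_addr.
Qed.

Lemma bad_mass (e : R) : 0 < e -> exists a C, [/\ 0 < a, 0 <= C &
  forall n, mP (bad_set (cq * f_ [::] - e) n) <= C * expR (- (a * n%:R))].
Proof.
move=> e0.
have F0 : 0 <= F by have := mean_f_bounds 0; lra.
have c0 := cq_gt0.
have c1 : cq <= 1 by rewrite /cq ler_pdivrMr // mul1r gerBl.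
have f0 : 0 <= f_ [::] by have := mean_f_bounds 0; rewrite mean_f0; lra.
(* [K] makes [theta K.+1 * F], and [l] below makes [l * D], at most [e / 4]; half of [e] is left for
   the decay, and [C] collects what does not grow with [n]. *)
have [K1 K11 hK1] := theta_small (e / (4 * (F + 1))) ltac:(rewrite divr_gt0 //; lra).
have [K eK] : exists K, K1 = K.+1 by exists K1.-1; lia.
rewrite {}eK in K11 hK1.
pose D := (K%:R * F) ^+ 2.
have D0 : 0 <= D by exact: sqr_ge0.
pose l := e / (4 * (D + 1)).
have l0 : 0 < l by rewrite divr_gt0 //; lra.
have se0 : 0 <= scale_err by rewrite divr_ge0 // ltW // gamma_prod_gt0.
pose C := K%:R * F + cq * f_ [::] * scale_err.
exists (l * e / 2), (expR (l * C)); split; [nra | exact: expR_ge0 |] => n.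
apply: le_trans (mass_bad_le _ n K l (ltW l0)) _; rewrite -expRD ler_expR.
set B := Lcomp d n.
have hB1 : scale n <= B%:R.
  by have := Lcomp_ge d n ltac:(nat_lia); rewrite gamma_prodd mulr1.
have hB2 : B%:R <= scale n + scale_err.
  by have := Lcomp_le d n ltac:(nat_lia); rewrite gamma_prodd mulr1.
have nB : n%:R <= B%:R :> R.
  apply: le_trans hB1; rewrite /scale ler_pdivlMr ?gamma_prod_gt0 //.
  by rewrite ler_piMr // gamma_prod_le1 //; nat_lia.
have s0 := scale_ge0 n.
have tB : (Num.truncn (scale n) <= B)%N.
  by rewrite -(ler_nat R); have /andP[h _] := truncn_bounds _ s0; exact: le_trans hB1.
have := sum_entropy_ge (scale n) K B s0 tB.
move: (\sum_(i <- _) _) => H hH.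
have t0 := theta_gt0 K.+1 isT.
have tF : theta K.+1 * F <= e / 4.
  apply: (@le_trans _ _ (e / (4 * (F + 1)) * F)); first by rewrite ler_wpM2r // ltW.
  have -> : e / (4 * (F + 1)) * F = (F / (F + 1)) * (e / 4) by field; rewrite gt_eqF //; lra.
  rewrite ler_piMl ?ler_pdivrMr //; lra.
have lD : l * D <= e / 4.
  have -> : l * D = (D / (D + 1)) * (e / 4) by rewrite /l; field; rewrite gt_eqF //; lra.
  rewrite ler_piMl ?ler_pdivrMr //; lra.
have B0 : 0 <= B%:R :> R by [].
have h1 : cq * scale n * (theta K.+1 * F) <= B%:R * (e / 4).
  apply: ler_pM => //; [exact: mulr_ge0 (ltW c0) s0 | exact: mulr_ge0 (ltW t0) F0 |].
  by apply: le_trans hB1; rewrite ler_piMl.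
have h2 : cq * f_ [::] * B%:R <= cq * f_ [::] * (scale n + scale_err).
  by rewrite ler_wpM2l // mulr_ge0 // ltW.
have h3 : l * D * B%:R <= e / 4 * B%:R by rewrite ler_wpM2r.
have h4 : (e / 2) * n%:R <= (e / 2) * B%:R by rewrite ler_wpM2l //; lra.
rewrite -/D.
have -> : l * ((cq * f_ [::] - e) * B%:R) - l * H + l ^+ 2 * D * B%:R =
  l * ((cq * f_ [::] - e) * B%:R - H + l * D * B%:R) by ring.
have -> : l * C + - (l * e / 2 * n%:R) = l * (C - (e / 2) * n%:R) by field.
rewrite ler_pM2l // /C; lra.
Qed.
(** * Hausdorff dimension *)

Local Notation dist := (@Sigma_dist R d m).
Local Notation Lam := (ln (m 1)%:R : R).

Lemma Lam_gt0 : 0 < Lam. Proof. by apply: ln_m_gt0; lia. Qed.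

Lemma Lcomp0 k : Lcomp k 0 = 0%N.
Proof.
elim: k => // k IH; rewrite LcompS IH /L.
by case: ifP => // _; rewrite mul0r ceil0.
Qed.

Lemma cball0 (x u : Sigma d m) : cball R x 0 u.
Proof. by move=> k i hk; rewrite Lcomp0; lia. Qed.

Lemma cball_homo (x u : Sigma d m) n n' : (n <= n')%N -> cball R x n' u -> cball R x n u.
Proof.
move=> nn h k i hk hi; apply: h => //; have := Lcomp_homo k n n' ltac:(lia) nn; lia.
Qed.

Lemma m1_powR (r : R) : (m 1)%:R `^ (- r) = expR (- (r * Lam)).
Proof.
rewrite /powR gt_eqF ?mulNr // ltr0n; have := m_ge2 1%N ltac:(lia); lia.
Qed.

Lemma dist_ge0 (x u : Sigma d m) : 0 <= dist x u.
Proof. by rewrite /Sigma_dist; case: ereal_sup => // r; exact: powR_ge0. Qed.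

Lemma dist_le (x u : Sigma d m) n : cball R x n u -> dist x u <= expR (- (n%:R * Lam)).
Proof.
move=> h; rewrite /Sigma_dist; case e : ereal_sup => [r||]; rewrite ?expR_ge0 //.
rewrite m1_powR ler_expR lerN2 ler_wpM2r ?(ltW Lam_gt0) // -lee_fin -e.
by apply: ereal_sup_ubound; exists n.
Qed.

Lemma cball_of_dist (x u : Sigma d m) n : dist x u <= expR (- (n%:R * Lam)) -> cball R x n u.
Proof.
apply: contraPP => nb.
have lt_n k : cball R x k u -> (k < n)%N.
  by move=> h; rewrite ltnNge; apply/negP => nk; apply: nb; exact: cball_homo nk h.
have n0 := lt_n _ (cball0 x u).
have sup_le : (ereal_sup [set (k%:R : R)%:E | k in [set k | cball R x k u]] <= (n.-1%:R : R)%:E)%E.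
  apply: ge_ereal_sup => _ [k /= /lt_n hk <-]; rewrite lee_fin ler_nat; lia.
have sup_ge : ((0%:R : R)%:E <= ereal_sup [set (k%:R : R)%:E | k in [set k | cball R x k u]])%E.
  by apply: ereal_sup_ubound; exists 0%N => //; exact: cball0.
apply/negP; rewrite -ltNge /Sigma_dist; move: sup_le sup_ge.
case: ereal_sup => [r||] //; rewrite !lee_fin => h _.
rewrite m1_powR ltr_expR ltrN2 ltr_pM2r ?Lam_gt0 //.
by apply: le_lt_trans h _; rewrite ltr_nat; lia.
Qed.

Lemma diam_ge (U : set (Sigma d m)) x u : U x -> U u -> ((dist x u)%:E <= diam dist U)%E.
Proof. by move=> Ux Uu; apply: ereal_sup_ubound; exists (x, u). Qed.

Lemma diam_cball x n : (diam dist (cball R x n) <= (expR (- (n%:R * Lam)))%:E)%E.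
Proof.
apply: ge_ereal_sup => _ [[y z] /= [hy hz] <-]; rewrite lee_fin.
by apply: dist_le; rewrite (cball_eq x).
Qed.

(** The [s]-th power of the radius [m_1^-n]. *)
Definition level_weight (s : R) n : R := expR (- (s * n%:R * Lam)).

Lemma level_weight_gt0 s n : 0 < level_weight s n. Proof. exact: expR_gt0. Qed.

Lemma level_weightD s s' n : level_weight (s + s') n = level_weight s n * level_weight s' n.
Proof. by rewrite /level_weight -expRD; congr expR; ring. Qed.

Lemma level_weight_small s (e : R) : 0 < s -> 0 < e ->
  exists n0, forall n, (n0 <= n)%N -> level_weight s n < e.
Proof.
move=> s0 e0; have L0 := Lam_gt0.
exists (Num.bound (`|ln e| / (s * Lam))) => n hn.
have h : `|ln e| / (s * Lam) < (Num.bound (`|ln e| / (s * Lam)))%:R.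
  by apply: archi_boundP; rewrite divr_ge0 // ltW // mulr_gt0.
have hn' : `|ln e| / (s * Lam) < n%:R by apply: lt_le_trans h _; rewrite ler_nat.
rewrite ltr_pdivrMr ?mulr_gt0 // in hn'.
rewrite -[e]lnK ?posrE // ltr_expR.
have := ler_norm (- ln e); rewrite normrN; have -> : s * n%:R * Lam = n%:R * (s * Lam) by ring.
lra.
Qed.

Lemma diam_pow_ge0 s (U : set (Sigma d m)) : (0 <= diam_pow dist s U)%E.
Proof. by rewrite /diam_pow; case: ifP => // _; exact: poweR_ge0. Qed.

Lemma diam_pow_cball s x n : 0 <= s ->
  (diam_pow dist s (cball R x n) <= (level_weight s n)%:E)%E.
Proof.
move=> s0; rewrite /diam_pow; case: ifP => _; first by rewrite lee_fin ltW ?level_weight_gt0.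
have -> : (level_weight s n)%:E = ((expR (- (n%:R * Lam)))%:E `^ s)%E.
  rewrite poweR_EFin /powR gt_eqF ?expR_gt0 // expRK /level_weight; congr (expR _)%:E; ring.
have dg : (0 <= diam dist (cball R x n))%E.
  by apply: le_trans (diam_ge _ x x (cball_refl _ _) (cball_refl _ _)); rewrite lee_fin dist_ge0.
apply: (gt0_ler_poweR s0); last exact: diam_cball.
  by rewrite in_itv /= dg leey.
by rewrite in_itv /= lee_fin expR_ge0 leey.
Qed.

Definition dimension : R := cq * f_ [::] / ln (m d)%:R.

Lemma gamma_prod1 : gamma_prod 1 = ln (m d)%:R / Lam.
Proof.
have h k : (1 <= k <= d)%N -> gamma_prod k = ln (m d)%:R / ln (m k)%:R.
  move=> hk; have [j ej] : exists j, d = (k + j)%N by exists (d - k)%N; lia.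
  elim: j k hk ej => [|j IH] k hk ej.
    have -> : k = d by lia.
    by rewrite gamma_prodd divff // gt_eqF // ln_m_gt0 //; lia.
  rewrite gamma_prodS; last by lia.
  rewrite IH; [|lia|lia].
  have h1 := ln_m_gt0 k ltac:(lia); have h2 := ln_m_gt0 k.+1 ltac:(lia).
  by rewrite /Defs.gamma /=; field; rewrite !gt_eqF.
by apply: h; lia.
Qed.

Lemma ln_md_gt0 : 0 < ln (m d)%:R :> R. Proof. by apply: ln_m_gt0; lia. Qed.

Lemma scale_ln n : scale n * ln (m d)%:R = n%:R * Lam.
Proof.
have h1 := Lam_gt0; have h2 := ln_md_gt0.
by rewrite /scale gamma_prod1; field; rewrite !gt_eqF.
Qed.

Lemma dimensionE : cq * f_ [::] = dimension * ln (m d)%:R.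
Proof. by rewrite /dimension divfK // gt_eqF // ln_md_gt0. Qed.

Lemma dimension_ge0 : 0 <= dimension.
Proof.
apply: divr_ge0 (ltW ln_md_gt0); apply: mulr_ge0 (ltW cq_gt0) _.
by have := mean_f_bounds 0; rewrite mean_f0 => /andP[].
Qed.

Lemma Lcomp_d_bounds n : scale n <= (Lcomp d n)%:R <= scale n + scale_err.
Proof.
have := Lcomp_le d n ltac:(lia); have := Lcomp_ge d n ltac:(lia).
by rewrite gamma_prodd !mulr1 => -> ->.
Qed.

(** * Upper bound on the dimension *)

(** The scales are related by [scale n * ln m_d = n * ln m_1]. Half of the gap [s - dimension] goes
    to the error in [ball_mass_often], the other half absorbs the constant [c] that comes from the
    roundings in [Lcomp]. *)
Lemma level_mass_often x s n0 : X_ q Omega x -> dimension < s ->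
  exists2 n, (n0 <= n)%N & level_weight s n <= mP (cball R x n).
Proof.
move=> xX Ds; have l0 := ln_md_gt0; have L0 := Lam_gt0; have D0 := dimension_ge0.
pose e := (s - dimension) / 2 * ln (m d)%:R.
have e0 : 0 < e by rewrite mulr_gt0 // divr_gt0 // subr_gt0.
have se0 : 0 <= scale_err by rewrite divr_ge0 // ltW // gamma_prod_gt0.
pose c := (cq * f_ [::] + e) * scale_err.
pose n1 := Num.bound (`|c| / ((s - dimension) / 2 * Lam)).
have sD : 0 < (s - dimension) / 2 * Lam by rewrite mulr_gt0 // divr_gt0 // subr_gt0.
have [n hn hm] := ball_mass_often x xX e (maxn n0 n1) e0.
exists n; first by apply: leq_trans hn; exact: leq_maxl.
apply: le_trans hm; rewrite ler_expR lerN2.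
have nn1 : c <= n%:R * ((s - dimension) / 2 * Lam).
  apply: le_trans (ler_norm c) _; rewrite -ler_pdivrMr //; apply: ltW.
  apply: (@lt_le_trans _ _ n1%:R); last by rewrite ler_nat (leq_trans _ hn) // leq_maxr.
  by apply: archi_boundP; rewrite divr_ge0 // ltW.
have /andP[_ h2] := Lcomp_d_bounds n.
have X0 : 0 <= cq * f_ [::] + e.
  by rewrite dimensionE; apply: addr_ge0 (ltW e0); apply: mulr_ge0 D0 (ltW l0).
apply: le_trans (ler_wpM2l X0 h2) _; rewrite mulrDr -/c.
have -> : (cq * f_ [::] + e) * scale n = ((s + dimension) / 2) * (n%:R * Lam).
  by rewrite dimensionE -scale_ln /e; field.
have -> : s * n%:R * Lam =
    ((s + dimension) / 2) * (n%:R * Lam) + n%:R * ((s - dimension) / 2 * Lam) by field.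
by rewrite lerD2l.
Qed.

Lemma measurable_cball x n : msr (cball R x n).
Proof.
apply: measurable_of_open; apply: (open_of_prefix (Lcomp d n)).
exact: (cball_prefix x n _ (leqnn _)).
Qed.

Lemma measurable_bad_set c n : msr (bad_set c n).
Proof.
apply: measurable_of_open; apply: (open_of_prefix (Lcomp d n)); exact: bad_set_prefix.
Qed.
Hint Resolve measurable_cball measurable_bad_set : core.

(* A maximal family of disjoint balls of radius [m_1^-n] and mass at least [c]. *)
Lemma heavy_balls n (c : R) : 0 < c -> exists r : seq (Sigma d m),
  (size r)%:R * c <= 1 /\
  forall x, c <= mP (cball R x n) -> exists2 y, y \in r & cball R y n x.
Proof.
move=> c0.
pose good (r : seq (Sigma d m)) := [/\ uniq r, forall x y, x \in r -> y \in r -> cball R x n y -> x = y &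
  forall x, x \in r -> c <= mP (cball R x n)].
have small r : good r -> (size r)%:R * c <= 1.
  move=> [u dj hc].
  have [||mU e] := @mass_bigcup _ _ _ P _ r (fun x => cball R x n) u.
  - by move=> x _; exact: measurable_cball.
  - move=> x y z xr yr xz yz; apply: dj => //.
    by rewrite -(cball_eq x z n xz) (cball_eq y z n yz); exact: cball_refl.
  rewrite -[leRHS](massT P); apply: (@le_trans _ _ (mP (\bigcup_(x in [set` r]) cball R x n))).
    rewrite e mulr_natl -iter_addr_0 -(count_predT r) -big_const_seq big_seq [leRHS]big_seq.
    exact: ler_sum.
  exact: mass_le.
have ex : exists k, `[< exists r, size r = k /\ good r >].
  by exists 0%N; apply/asboolP; exists [::].
have bd k : `[< exists r, size r = k /\ good r >] -> (k <= Num.bound c^-1)%N.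
  move=> /asboolP[r [<- /small h]]; rewrite -(ler_nat R); apply: ltW.
  apply: (@le_lt_trans _ _ c^-1); first by rewrite -ler_pdivlMr // mul1r in h.
  by apply: archi_boundP; rewrite invr_ge0 ltW.
case: (ex_maxnP ex bd) => k /asboolP[r [sr gr]] kmax.
exists r; split; first exact: small.
move=> x hx; apply: contrapT => nx.
have [u dj hc] := gr.
suff /kmax : `[< exists r', size r' = k.+1 /\ good r' >] by rewrite ltnn.
apply/asboolP; exists (x :: r); split; first by rewrite /= sr.
split=> [|y z|y].
- rewrite /= u andbT; apply/negP => xr; apply: nx; exists x => //; exact: cball_refl.
- rewrite !inE => /orP[/eqP ->|yr] /orP[/eqP ->|zr] h //; last exact: dj.
    by case: nx; exists z => //; rewrite (cball_eq x) //; exact: cball_refl.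
  by case: nx; exists y.
- by rewrite inE => /orP[/eqP -> //|]; exact: hc.
Qed.
Lemma level_weightS s n : level_weight s n.+1 = level_weight s n * level_weight s 1.
Proof. by rewrite /level_weight -expRD -natr1; congr expR; ring. Qed.

Lemma level_weight1_lt1 s : 0 < s -> level_weight s 1 < 1.
Proof.
move=> s0; rewrite -[ltRHS]expR0 ltr_expR oppr_lt0 mulr1; exact: mulr_gt0 s0 Lam_gt0.
Qed.

Lemma sum_level_weight s n0 M : 0 < s ->
  \sum_(n0 <= n < M) level_weight s n <= level_weight s n0 / (1 - level_weight s 1).
Proof.
move=> s0; have w1 := level_weight1_lt1 s s0.
rewrite ler_pdivlMr ?subr_gt0 //.
have [h|h] := leqP M n0.
  by rewrite big_geq // mul0r ltW // level_weight_gt0.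
rewrite mulr_suml (eq_bigr (fun n => - (level_weight s n.+1 - level_weight s n))); last first.
  by move=> n _; rewrite (level_weightS s n); ring.
by rewrite sumrN telescope_sumr ?(ltnW h) // opprB gerBl ltW // level_weight_gt0.
Qed.

(** The cover consists of the heavy balls of all levels [n >= n0]. Split [s = s1 + s2]: with [s1]
    above the dimension each point lies in heavy balls of arbitrarily high level, and a level has at
    most [1 / level_weight s1 n] balls, while [s2 > 0] makes the sum over the levels small. *)
Lemma hausdorff_measure_eq0 s : dimension < s -> hausdorff_measure dist s (X_ q Omega) = 0%E.
Proof.
move=> Ds; have D0 := dimension_ge0.
have s_ge0 : 0 <= s by lra.
pose s1 := (dimension + s) / 2.
pose s2 := (s - dimension) / 2.
have s20 : 0 < s2 by rewrite /s2; lra.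
have Ds1 : dimension < s1 by rewrite /s1; lra.
have ss : s = s1 + s2 by rewrite /s1 /s2; lra.
have w1 := level_weight1_lt1 s2 s20.
have pre0 (delta : R) : 0 < delta -> hausdorff_premeasure dist s delta (X_ q Omega) = 0%E.
  move=> delta0; apply/eqP; rewrite eq_le; apply/andP; split; last first.
    apply: le_ereal_inf_tmp => _ [U _ <-]; apply: nneseries_ge0 => i _ _; exact: diam_pow_ge0.
  apply/lee_addgt0Pr => eta eta0; rewrite add0e.
  have [na hna] := level_weight_small 1 delta ltr01 delta0.
  have [nb hnb] := level_weight_small s2 (eta * (1 - level_weight s2 1)) s20
    ltac:(by rewrite mulr_gt0 // subr_gt0).
  pose n0 := maxn na nb.
  pose r n := sval (cid (heavy_balls n (level_weight s1 n) (level_weight_gt0 s1 n))).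
  have rP n : (size (r n))%:R * level_weight s1 n <= 1 /\ forall x, level_weight s1 n <= mP (cball R x n) ->
      exists2 y, y \in r n & cball R y n x by rewrite /r; case: cid.
  (* Codes of no ball are filled with the empty set, which contributes 0 by the convention in
     [diam_pow]. *)
  pose U' (p : nat * nat) : set (Sigma d m) :=
    if (n0 <= p.1)%N && (p.2 < size (r p.1))%N then cball R (nth point (r p.1) p.2) p.1 else set0.
  pose U i := oapp U' set0 (pickle_inv i).
  pose v (p : nat * nat) : R :=
    if (n0 <= p.1)%N && (p.2 < size (r p.1))%N then level_weight s p.1 else 0.
  have v0 p : 0 <= v p by rewrite /v; case: ifP => // _; rewrite ltW // level_weight_gt0.
  have set0_pow : diam_pow dist s set0 = 0%E by rewrite /diam_pow asboolT.
  have Uv i : (diam_pow dist s (U i) <= (oapp v 0 (pickle_inv i))%:E)%E.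
    rewrite /U; case: (pickle_inv i) => [p|] /=; last by rewrite set0_pow.
    by rewrite /U' /v; case: ifP => _; [exact: diam_pow_cball | rewrite set0_pow].
  apply: (@le_trans _ _ (\sum_(0 <= i <oo) diam_pow dist s (U i))%E).
    apply: ereal_inf_lbound; exists U => //; split.
      move=> x xX; have [n hn hm] := level_mass_often x s1 n0 xX Ds1.
      have [_ /(_ x hm)[y yr yx]] := rP n.
      exists (pickle (n, index y (r n))) => //; rewrite /U pickleK_inv /= /U' /=.
      by rewrite hn index_mem yr nth_index.
    move=> i; have d0 : (diam dist set0 <= delta%:E)%E.
      by apply: ge_ereal_sup => _ [z [] []].
    rewrite /U; case: (pickle_inv i) => [[n j]|] //=; rewrite /U' /=.
    case: ifP => // /andP[hn _]; apply: le_trans (diam_cball _ _) _; rewrite lee_fin.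
    have := hna n ltac:(by apply: leq_trans hn; exact: leq_maxl).
    by rewrite /level_weight mul1r => /ltW.
  apply: nneseries_le => [i|M]; first exact: diam_pow_ge0.
  apply: (@le_trans _ _ (\sum_(0 <= i < M) (oapp v 0 (pickle_inv i))%:E)%E).
    by apply: lee_sum => i _; exact: Uv.
  rewrite sumEFin lee_fin.
  apply: (sum_pickle_le v (fun n => if (n0 <= n)%N then level_weight s2 n else 0)) => //.
    move=> n J; rewrite /v /=; case: (leqP n0 n) => hn /=; last by rewrite big1.
    have [sr _] := rP n.
    apply: (@le_trans _ _ (\sum_(0 <= j < size (r n)) level_weight s n)).
      have [hJ|hJ] := leqP J (size (r n)).
        rewrite [leRHS](@big_cat_nat _ _ _ J) //= -[leLHS]addr0; apply: lerD.
          by apply: ler_sum => j _; case: ifP => // _; rewrite ltW // level_weight_gt0.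
        by apply: sumr_ge0 => j _; rewrite ltW // level_weight_gt0.
      rewrite (@big_cat_nat _ _ _ (size (r n))) ?(ltnW hJ) //= -[leRHS]addr0; apply: lerD.
        by apply: ler_sum => j _; case: ifP => // _; rewrite ltW // level_weight_gt0.
      by rewrite big_nat big1 // => j /andP[h _]; rewrite ltnNge h.
    rewrite sumr_const_nat subn0 -[_ *+ size _]mulr_natl {1}ss level_weightD mulrA.
    by rewrite ler_piMl // ltW // level_weight_gt0.
  have n0b : level_weight s2 n0 / (1 - level_weight s2 1) <= eta.
    rewrite ler_pdivrMr ?subr_gt0 //; apply: ltW; apply: hnb; exact: leq_maxr.
  move=> A; apply: le_trans n0b; apply: le_trans (sum_level_weight s2 n0 A s20).
  have [hA|hA] := leqP A n0.
    rewrite [leRHS]big_geq // big_nat big1 // => n /andP[_ h].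
    by rewrite leqNgt (leq_trans h hA).
  rewrite (@big_cat_nat _ _ _ n0) ?(ltnW hA) //= big_nat big1 ?add0r; last first.
    by move=> n /andP[_ h]; rewrite leqNgt h.
  by rewrite big_nat [leRHS]big_nat; apply: ler_sum => n /andP[-> _].
apply/eqP; rewrite eq_le; apply/andP; split.
  by apply: ge_ereal_sup => _ [delta /= d0 <-]; rewrite pre0.
apply: le_ereal_sup_tmp; exists 0%E => //; exists 1 => /=; first exact: ltr01.
exact: pre0 ltr01.
Qed.

(** * Lower bound on the dimension *)

Lemma negligible_X : P.-negligible (~` X_ q Omega : set (SigmaB d m)).
Proof.
(* The null sets [N i r] cover the complement, because [Omega] is closed. *)
pose N (i r : nat) : set (Sigma d m) :=
  [set x | [/\ (1 <= i)%N, ~~ (q %| i)%N & Omega `&` cyl (subsequence q x i) r = set0]].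
have sub : ~` X_ q Omega `<=` \bigcup_i \bigcup_r N i r.
  move=> x nx; apply: contrapT => nN; apply: nx => i i1 qi.
  apply: (closed_cyl Omega) => // r; apply: contrapT => h; apply: nN.
  exists i => //; exists r => //; split=> //.
  by apply/seteqP; split=> // y [Oy cy]; apply: h; exists y.
apply: (@negligibleS _ (SigmaB d m) R P _ _ sub).
apply: (@negligible_bigcup _ (SigmaB d m) R P) => i.
apply: (@negligible_bigcup _ (SigmaB d m) R P) => r.
have [/andP[i1 qi]|h] := boolP ((1 <= i)%N && ~~ (q %| i)%N); last first.
  rewrite (_ : N i r = set0); first exact: negligible_set0.
  by apply/seteqP; split=> // x [i1 qi _]; move: h; rewrite i1 qi.
have Npre : forall x y, (forall j, (j < i * q ^ r)%N -> y j = x j) -> N i r x -> N i r y.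
  move=> x y h [_ _ e]; split=> //; rewrite -e; congr (_ `&` _).
  apply/seteqP; split=> z /cylP hz; apply/cylP => l hl; rewrite hz // /subsequence h //;
    have : (q ^ l <= q ^ r)%N by [rewrite leq_exp2l // ltnW];
    have : (1 <= q ^ l)%N by [rewrite expn_gt0; lia]; nia.
have mN : msr (N i r) by apply: measurable_of_open; exact: (open_of_prefix (i * q ^ r)).
apply/negligibleP => //; apply: eq_trans (mass_fin P _ mN) _; congr (_%:E).
rewrite (mass_prefix P _ _ Npre) (eq_word_sum _ _ (fun=> 0 * 0)) ?word_sumZ ?mul0r // => u.
case: asboolP => // -[_ _ e]; rewrite mass_P_cyl.
have qr1 : (1 <= q ^ r)%N by rewrite expn_gt0; lia.
(* The factor of the chain of [i] is the mass under mu of a cylinder that misses [Omega]. *)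
rewrite (bigD1_seq i) //=; last by rewrite filter_uniq // iota_uniq.
  rewrite mass_OmegaC ?mul0r //.
  apply/seteqP; split=> // y [/cylP hy Oy]; rewrite -e; split=> //; apply/cylP => l hl.
  by apply: hy; rewrite chain_depthP // leq_mul2l leq_exp2l ?(ltnW hl) ?orbT.
by rewrite mem_chain_starts i1 qi leq_pmulr.
Qed.

Lemma P_cover W : msr W -> X_ q Omega `<=` W -> P W = 1%E.
Proof.
move=> mW XW; have : P (~` W) = 0%E.
  apply: measure_negligible; first exact: measurableC.
  by apply: negligibleS negligible_X; exact: subsetC.
rewrite probability_setC // mass_fin // -EFinB => -[] /eqP; rewrite subr_eq0 => /eqP <- //.
Qed.

(** The ball has level the integer part of [v = - log_{m_1} (diam U)], so its radius exceeds the
    diameter at most by the factor [m_1], whence [expR (s1 * Lam)]. Empty sets and sets of diameter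
    0 lie in balls of any level; [eta] pays for them. *)
Lemma cover_ball s s1 n0 (eta : R) (U : set (Sigma d m)) :
  0 <= s < s1 -> 0 < eta -> (diam dist U <= (expR (- (n0%:R * Lam)))%:E)%E ->
  exists p : Sigma d m * nat, [/\ (n0 <= p.2)%N, U `<=` cball R p.1 p.2 &
    ((level_weight s1 p.2)%:E <= (expR (s1 * Lam))%:E * diam_pow dist s U + eta%:E)%E].
Proof.
move=> /andP[s0 ss] eta0 hU; have L0 := Lam_gt0.
have s10 : 0 < s1 by exact: le_lt_trans ss.
have [n1 hn1] := level_weight_small s1 eta s10 eta0.
have small x : (forall n, U `<=` cball R x n) ->
  exists p : Sigma d m * nat, [/\ (n0 <= p.2)%N, U `<=` cball R p.1 p.2 &
    ((level_weight s1 p.2)%:E <= (expR (s1 * Lam))%:E * diam_pow dist s U + eta%:E)%E].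
  move=> h; exists (x, maxn n0 n1); split=> //=; first exact: leq_maxl.
  apply: (@le_trans _ _ eta%:E); first by rewrite lee_fin ltW // hn1 // leq_maxr.
  by rewrite leeDr // mule_ge0 ?lee_fin ?expR_ge0 // diam_pow_ge0.
have [/set0P[x Ux]|/negPn/eqP U0] := boolP (U != set0); last first.
  by apply: (small point) => n; rewrite U0.
have d0 : (0 <= diam dist U)%E.
  by apply: le_trans (diam_ge U x x Ux Ux); rewrite lee_fin dist_ge0.
have dxu u : U u -> ((dist x u)%:E <= diam dist U)%E by exact: diam_ge.
have dpow : diam_pow dist s U = (diam dist U `^ s)%E.
  by rewrite /diam_pow asboolF // => U0; rewrite U0 in Ux.
move: dpow d0 hU dxu; case: (diam dist U) => [dd||] // dpow; rewrite lee_fin => d0.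
rewrite lee_fin => hdd dxu; move: d0; rewrite le_eqVlt => /orP[/eqP dd0|d0].
  apply: (small x) => n u /dxu; rewrite lee_fin -dd0 => h.
  by apply: cball_of_dist; apply: le_trans h (expR_ge0 _).
pose v := - ln dd / Lam.
have vE : ln dd = - (v * Lam) by rewrite /v divfK ?opprK // gt_eqF.
have ddE : dd = expR (- (v * Lam)) by rewrite -vE lnK.
have n0v : n0%:R <= v by move: hdd; rewrite ddE ler_expR lerN2 ler_pM2r.
have v0 : 0 <= v by apply: le_trans n0v.
have /andP[v1 v2] := truncn_bounds v v0.
exists (x, Num.truncn v); split=> /=.
- by rewrite -le_truncn.
- move=> u /dxu; rewrite lee_fin => h; apply: cball_of_dist; apply: le_trans h _.
  by rewrite ddE ler_expR lerN2 ler_wpM2r // ltW.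
rewrite dpow poweR_EFin -EFinM -EFinD lee_fin.
apply: (@le_trans _ _ (expR (s1 * Lam) * dd `^ s)); last by rewrite lerDl ltW.
rewrite /powR gt_eqF // vE -expRD ler_expR.
have -> : s1 * Lam + s * - (v * Lam) = (s1 - s * v) * Lam by ring.
have -> : - (s1 * (Num.truncn v)%:R * Lam) = (- (s1 * (Num.truncn v)%:R)) * Lam by ring.
rewrite ler_wpM2r ?(ltW L0) //; nra.
Qed.

(** The bad sets of levels from [n0] on have mass at most 1/4, the other balls of a cover at most
    1/4 from the powers of the diameters and 1/4 from the errors in [cover_ball]; but together they
    have mass 1. *)
Lemma hausdorff_measure_neq0 s : 0 <= s ->
  hausdorff_measure dist s (X_ q Omega) = 0%E -> dimension <= s.
Proof.
move=> s0 H0; rewrite leNgt; apply/negP => sD.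
have L0 := Lam_gt0; have l0 := ln_md_gt0.
(* [s1] is the midpoint and [e] is such that [c = s1 * ln m_d]; a ball of level [n] that is not bad
   then has mass at most [m_1^(- s1 n)]. *)
pose s1 := (s + dimension) / 2.
have ss1 : 0 <= s < s1 by rewrite s0 /s1; lra.
have s1D : s1 < dimension by rewrite /s1; lra.
have s10 : 0 < s1 by case/andP: ss1 => h1 h2; exact: le_lt_trans h2.
pose e := (dimension - s1) * ln (m d)%:R.
have e0 : 0 < e by rewrite mulr_gt0 // subr_gt0.
have [a [C [a0 C0 hbad]]] := bad_mass e e0.
pose c := cq * f_ [::] - e.
have cE : c = s1 * ln (m d)%:R by rewrite /c dimensionE /e; ring.
have good u n : ~ bad_set c n u -> mP (cball R u n) <= level_weight s1 n.
  rewrite /bad_set /= => /negP; rewrite -leNgt => h; apply: le_trans h _.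
  rewrite ler_expR lerN2; have /andP[h _] := Lcomp_d_bounds n.
  have -> : s1 * n%:R * Lam = c * scale n by rewrite cE -mulrA -scale_ln; ring.
  by rewrite ler_wpM2l // cE mulr_ge0 // ltW.
pose b := a / Lam.
have b0 : 0 < b by rewrite divr_gt0.
have bE n : expR (- (a * n%:R)) = level_weight b n.
  by congr expR; rewrite /b; field; rewrite gt_eqF.
have w1 := level_weight1_lt1 b b0.
have [n0 hn0] := level_weight_small b ((1 - level_weight b 1) / (4 * (C + 1))) b0
  ltac:(by rewrite divr_gt0 ?subr_gt0 //; lra).
pose Bad := \bigcup_n bad_set c (n0 + n).
have PBad : (P Bad <= (4^-1)%:E)%E.
  have mB : msr Bad by exact: bigcup_measurable.
  have sub := @measure_sigma_subadditive _ _ _ P Bad (fun n => bad_set c (n0 + n))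
    (fun n => measurable_bad_set c (n0 + n)) mB (@subset_refl _ Bad).
  apply: le_trans sub _.
  apply: nneseries_le => [i|M]; first exact: measure_ge0.
  apply: (@le_trans _ _ (\sum_(0 <= n < M) (C * level_weight b (n0 + n))%:E)%E).
    apply: lee_sum => n _; apply: (@le_trans _ _ (mP (bad_set c (n0 + n)))%:E).
      by rewrite -mass_fin.
    by rewrite lee_fin -bE; exact: hbad.
  rewrite sumEFin lee_fin -mulr_sumr.
  have -> : \sum_(0 <= n < M) level_weight b (n0 + n) = \sum_(n0 <= n < n0 + M) level_weight b n.
    by rewrite -{2}[n0]add0n big_addn addKn; apply: eq_bigr => i _; rewrite addnC.
  apply: le_trans (ler_wpM2l C0 (sum_level_weight b n0 (n0 + M) b0)) _.
  have h : level_weight b n0 / (1 - level_weight b 1) <= 1 / (4 * (C + 1)).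
    rewrite ler_pdivrMr ?subr_gt0 //.
    by have := hn0 n0 (leqnn _); move=> /ltW h; apply: le_trans h _; rewrite mulrAC mul1r.
  apply: le_trans (ler_wpM2l C0 h) _.
  by rewrite mul1r ler_pdivrMr; lra.
pose K := expR (s1 * Lam).
have K0 : 0 < K by exact: expR_gt0.
have /ereal_inf_lt[_ [U [XU dU] <-] sumU] : (hausdorff_premeasure dist s (expR (- (n0%:R * Lam))) (X_ q Omega)
    < ((4 * K)^-1)%:E)%E.
  apply: (@le_lt_trans _ _ 0%E); last by rewrite lte_fin invr_gt0 mulr_gt0.
  rewrite -H0; apply: ereal_sup_ubound; exists (expR (- (n0%:R * Lam))) => //=.
  exact: expR_gt0.
have eta_gt0 i : 0 < 4^-1 / (2 ^ i.+1)%:R :> R by rewrite divr_gt0 // ltr0n expn_gt0.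
have /choice[p hp] : forall i, exists p : Sigma d m * nat, [/\ (n0 <= p.2)%N,
    U i `<=` cball R p.1 p.2 & ((level_weight s1 p.2)%:E <=
    K%:E * diam_pow dist s (U i) + (4^-1 / (2 ^ i.+1)%:R)%:E)%E].
  by move=> i; exact: (cover_ball s s1 n0 _ (U i) ss1 (eta_gt0 i) (dU i)).
pose V i := cball R (p i).1 (p i).2.
pose V' i := if `[< bad_set c (p i).2 (p i).1 >] then set0 else V i.
have mV' i : msr (V' i) by rewrite /V'; case: ifP => // _; exact: measurable_cball.
have mV'U : msr (\bigcup_i V' i) by exact: bigcup_measurable.
have mB : msr Bad by exact: bigcup_measurable.
have cov : X_ q Omega `<=` Bad `|` \bigcup_i V' i.
  move=> x /XU[i _ Uix]; have [h1 h2 _] := hp i.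
  have Vx := h2 x Uix.
  (* Bad sets are unions of balls of their level, so a bad ball of the cover is contained in [Bad]
     and may be dropped. *)
  have [bi|nbi] := pselect (bad_set c (p i).2 (p i).1); last first.
    by right; exists i => //; rewrite /V' asboolF.
  left; exists ((p i).2 - n0)%N => //; rewrite subnKC //.
  by rewrite /bad_set /= (cball_eq (p i).1 x _ Vx); exact: bi.
have := P_cover _ (measurableU _ _ mB mV'U) cov.
have PV' : (P (\bigcup_i V' i) <= (2^-1)%:E)%E.
  have sub := @measure_sigma_subadditive _ _ _ P _ V' mV' mV'U (@subset_refl _ _).
  apply: le_trans sub _.
  apply: (@le_trans _ _ (\sum_(0 <= i <oo)
     (K%:E * diam_pow dist s (U i) + (4^-1 / (2 ^ i.+1)%:R)%:E))%E).
    apply: lee_nneseries => [i _ _|i _]; first exact: measure_ge0.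
    have [_ _ h] := hp i; apply: le_trans h.
    rewrite /V'; case: asboolP => [_|nb]; first by rewrite measure0 lee_fin ltW ?level_weight_gt0.
    apply: (@le_trans _ _ (mP (V i))%:E); first by rewrite -mass_fin //; exact: measurable_cball.
    by rewrite lee_fin; exact: good.
  apply: le_trans (epsilon_trick _ _ _) _.
  - by move=> i; rewrite mule_ge0 ?lee_fin ?(ltW K0) // diam_pow_ge0.
  - by rewrite invr_ge0.
  rewrite nneseriesZl; last by move=> i _; exact: diam_pow_ge0.
  apply: (@le_trans _ _ (K%:E * ((4 * K)^-1)%:E + (4^-1)%:E)%E).
    by rewrite leeD2r // lee_pmul2l // ltW.
  rewrite -EFinM -EFinD lee_fin.
  have -> : K * (4 * K)^-1 = 4^-1 by field; rewrite gt_eqF.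
  lra.
move=> PW; have : (P (Bad `|` \bigcup_i V' i) <= P Bad + P (\bigcup_i V' i))%E.
  exact: measureU2.
rewrite PW => h; have := le_trans h (leeD PBad PV').
by rewrite -EFinD lee_fin; lra.
Qed.

Lemma hausdorff_dimE : hausdorff_dim dist (X_ q Omega) = dimension%:E.
Proof.
have D0 := dimension_ge0; apply/eqP; rewrite eq_le; apply/andP; split; last first.
  apply: le_ereal_inf_tmp => _ [s /= [s0 H0] <-]; rewrite lee_fin.
  exact: hausdorff_measure_neq0.
apply/lee_addgt0Pr => e e0; apply: ereal_inf_lbound; exists (dimension + e) => //=.
split; first by rewrite addr_ge0 // ltW.
by apply: hausdorff_measure_eq0; rewrite ltrDl.
Qed.

Lemma limn_einf_le (x : Sigma d m) : X_ q Omega x ->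
  (limn_einf (fun n : nat => - logbe (m d)%:R (P (cball R x n)) *
     (((Lcomp d n)%:R)^-1)%:E) <= dimension%:E)%E.
Proof.
move=> xX; have l0 := ln_md_gt0; apply/lee_addgt0Pr => e e0.
have e1 : 0 < e * ln (m d)%:R by rewrite mulr_gt0.
rewrite limn_einf_lim; set u := (X in einfs X).
rewrite (cvg_lim _ (@cvg_einfs_sup _ u)) //; apply: ge_ereal_sup => _ [n _ <-].
(* [n.+1] makes [k] positive, so that the division by [Lcomp d k] is not by 0. *)
have [k hk hm] := ball_mass_often x xX (e * ln (m d)%:R) n.+1 e1.
apply: ge_ereal_inf; exists (u k); first by exists k => //=; exact: ltnW.
have p0 : 0 < mP (cball R x k) by apply: lt_le_trans hm; exact: expR_gt0.
have L0 : 0 < (Lcomp d k)%:R :> R.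
  have /andP[h _] := Lcomp_d_bounds k; apply: lt_le_trans h.
  by rewrite divr_gt0 ?gamma_prod_gt0 // ltr0n (leq_trans _ hk).
have -> : u k = (- (ln (mP (cball R x k)) / ln (m d)%:R) / (Lcomp d k)%:R)%:E.
  by rewrite /u /logbe mass_fin // lne_EFin.
rewrite -EFinD lee_fin.
rewrite ler_pdivrMr // -mulNr ler_pdivrMr // lerNl -ler_expR lnK //.
apply: le_trans hm; rewrite ler_expR lerN2 dimensionE -mulrDl.
by rewrite mulrAC.
Qed.

Lemma dimension_omega : dimension = omega 1 * logb (m d)%:R (t_empty q Omega t).
Proof. by rewrite /dimension /logb omega_1 /f_ S_0 mulrA. Qed.
End Setting.

Theorem theorem3p3 (R : realType) (d q : nat) (m : nat -> nat)
    (d_ge2 : (2 <= d)%N) (q_ge2 : (2 <= q)%N)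
    (m_ge2 : forall k, (1 <= k <= d)%N -> (2 <= m k)%N)
    (m_noninc : forall k, (1 <= k < d)%N -> (m k.+1 <= m k)%N)
    (Omega : set (Sigma d m)) (Omega_neq0 : Omega !=set0)
    (Omega_closed : closed Omega)
    (t : seq nat -> R) (tP : is_t q Omega t)
    (mu : probability (SigmaB d m) R) (muP : is_mu q Omega t mu)
    (P : probability (SigmaB d m) R) (PP : is_P_mu q mu P) :
  (forall x, X_ q Omega x ->
    (limn_einf (fun n : nat => - logbe (m d)%:R (P (cball R x n)) *
                               (((Lcomp R m d n)%:R)^-1)%:E)
       <= (omega R d q m 1 * logb (m d)%:R (t_empty q Omega t))%:E)%E) /\
  hausdorff_dim (@Sigma_dist R d m) (X_ q Omega) =
    (omega R d q m 1 * logb (m d)%:R (t_empty q Omega t))%:E /\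
  omega R d q m 1 * logb (m d)%:R (t_empty q Omega t) =
    (q%:R - 1) / q%:R * logb (m d)%:R (t_empty q Omega t).
Proof.
have dE := dimension_omega R d q m d_ge2 q_ge2 m_ge2 m_noninc Omega t.
split; [|split].
- by move=> x xX; rewrite -dE; apply: limn_einf_le xX => //; eassumption.
- by rewrite -dE; apply: hausdorff_dimE => //; eassumption.
- by rewrite omega_1.
Qed.
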